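(* Let $\Omega\subset\mathbb{R}^d$ be non-empty and open, $v\colon\Omega\to(0,\infty)$ continuous, $(E,\|\cdot\|_E)$ a normed space over $\mathbb{C}$ and $P(\partial)^E$ a linear partial differential operator with constant complex coefficients such that $P(\partial)^{\mathbb{C}}$ is hypoelliptic. Let \[ \mathcal{C}_Pv(\Omega,E):=\Bigl\{f\in\mathcal{C}^\infty(\Omega,E): P(\partial)^Ef=0\ \text{and}\ \|f\|^E:=\sup_{x\in\Omega}\|f(x)\|_Ev(x)<\infty\Bigr\}, \] with $\mathcal{C}_Pv(\Omega):=\mathcal{C}_Pv(\Omega,\mathbb{C})$ and $\|\cdot\|:=\|\cdot\|^{\mathbb{C}}$. Then the following assertions hold. (a) $(\mathcal{C}_Pv(\Omega,E),\|\cdot\|^E,\tau_{\mathrm{co}}^E)$ is a C-sequential Saks space. (b) If $E=\mathbb{C}$, then $(\mathcal{C}_Pv(\Omega),\|\cdot\|,\tau_{\mathrm{co}})$ is semi-Montel and $\gamma(\|\cdot\|,\tau_{\mathrm{co}})=\gamma_{\mathrm{s}}(\|\cdot\|,\tau_{\mathcal{S}})$ for $\mathcal{S}\in\{\mathcal{N}_\Omega,\mathcal{K}_\Omega\}$. (c) If $E$ is a Banach space, then $\mathcal{C}_Pv(\Omega,E)=\mathcal{C}_Pv(\Omega,E)_\sigma$ and the Saks space $(\mathcal{C}_Pv(\Omega,E),\|\cdot\|^E,\tau_{\mathrm{co}}^E)$ is complete.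
   Context: $\mathcal{C}^\infty(\Omega,E)$ is the space of infinitely continuously partially differentiable functions $\Omega\to E$ with partial derivatives $(\partial^\beta)^Ef$, $\beta\in\mathbb{N}_0^d$. For a polynomial $P$ on $\mathbb{R}^d$ with constant complex coefficients, $P(\partial)^E$ is the associated linear partial differential operator on $\mathcal{C}^\infty(\Omega,E)$, obtained by substituting the partial derivatives $(\partial)^E$ for the variables in $P$. Hypoelliptic is meant in the usual sense for linear partial differential operators (distributions $u$ are smooth wherever $P(\partial)u$ is smooth). Saks spaces. Let $(X,\|\cdot\|)$ be a normed space and $\tau$ a locally convex Hausdorff topology on $X$ coarser than the norm topology $\tau_{\|\cdot\|}$. The mixed topology $\gamma=\gamma(\|\cdot\|,\tau)$ is the finest linear topology on $X$ that coincides with $\tau$ on $\|\cdot\|$-bounded sets and lies between $\tau$ and $\tau_{\|\cdot\|}$; it is locally convex Hausdorff. $(X,\|\cdot\|,\tau)$ is a Saks space if there is a directed system $\Gamma_\tau$ of continuous seminorms generating $\tau$ with $\|x\|=\sup_{q\in\Gamma_\tau}q(x)$ for all $x$. The submixed topology $\gamma_{\mathrm{s}}(\|\cdot\|,\tau)$ is generated by the seminorms $x\mapsto\sup_{n\in\mathbb{N}}q_n(x)a_n$ with $(q_n)_{n\in\mathbb{N}}\subset\Gamma_\tau$ and $(a_n)_{n\in\mathbb{N}}$ a real non-negative null-sequence (independent of the choice of such $\Gamma_\tau$). A Saks space is complete if $(X,\gamma)$ is complete; semi-Montel if $(X,\gamma)$ is a semi-Montel space (bounded sets are relatively compact); C-sequential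 if every convex sequentially open subset of $(X,\gamma)$ is open. Topologies. $\tau_{\mathrm{co}}^E$ is the (relative) topology of uniform convergence on compact subsets of $\Omega$; $\tau_{\mathrm{co}}:=\tau_{\mathrm{co}}^{\mathbb{C}}$. $\mathcal{N}_\Omega$ and $\mathcal{K}_\Omega$ are the families of finite resp. compact subsets of $\Omega$, and $\tau_{\mathcal{S}}$ on $\mathcal{C}_Pv(\Omega)$ is generated by the seminorms $f\mapsto\sup_{x\in S}|f(x)|v(x)$, $S\in\mathcal{S}$. Weak version. $\mathcal{C}_Pv(\Omega,E)_\sigma:=\{f\colon\Omega\to E:e^*\circ f\in\mathcal{C}_Pv(\Omega)\text{ for all }e^*\in E^*\}$. *)

(* Defs.v *)
From HB Require Import structures.
From mathcomp Require Import all_boot all_order all_algebra.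
From mathcomp Require Import all_classical all_reals all_analysis.
From mathcomp Require Import complex.
From mathcomp Require mpoly.

Set Implicit Arguments.
Unset Strict Implicit.
Unset Printing Implicit Defensive.

Import Order.TTheory GRing.Theory Num.Theory.
Import numFieldNormedType.Exports.

Local Open Scope classical_set_scope.
Local Open Scope ring_scope.
Local Open Scope complex_scope.

(* Norms over R[i] take values in R[i]; normR is the same norm as an element
   of R. *)
Definition normR (R : realType) (E : normedModType R[i]) (x : E) : R :=
  complex.Re `|x|.

Lemma normR_ge0 (R : realType) (E : normedModType R[i]) (x : E) : 0 <= normR x.
Proof. by have := normr_ge0 x; rewrite lecE => /andP[]. Qed.

Lemma normRC (R : realType) (E : normedModType R[i]) (x : E) :
  `|x| = (normR x)%:C.
Proof.
rewrite /normR; have := normr_ge0 x; rewrite lecE /= => /andP[/eqP + _].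
by case: `|x| => a b /= ->.
Qed.

Lemma normRZ (R : realType) (E : normedModType R[i]) (a : R[i]) (x : E) :
  normR (a *: x) = complex.Re `|a| * normR x.
Proof.
rewrite {1}/normR normrZ normRC.
rewrite -[`|a|](@normRC R R[i]^o a) /=.
by rewrite mulr0 subr0.
Qed.

Lemma normRD (R : realType) (E : normedModType R[i]) (x y : E) :
  normR (x + y) <= normR x + normR y.
Proof.
by have := ler_normD x y; rewrite !normRC lecE /= => /andP[].
Qed.

Definition banach (R : realType) (E : normedModType R[i]) : Prop :=
  forall F : set_system E, ProperFilter F -> cauchy F -> cvg F.

(* One vector space carries several topologies here, so a topology is a term
   tau; top_space tau is the library topological space with these open sets. *)

Record topology (T : choiceType) := Topology {
  opens :> set (set T) ;
  opensT : opens setT ;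
  opensI : setI_closed opens ;
  opens_bigU : forall (I : Type) (f : I -> set T),
    (forall i, opens (f i)) -> opens (\bigcup_i f i) }.

Definition top_space (T : choiceType) (tau : topology T) : Type := T.

HB.instance Definition _ (T : choiceType) (tau : topology T) :=
  Choice.copy (top_space tau) T.
HB.instance Definition _ (T : choiceType) (tau : topology T) :=
  isOpenTopological.Build (top_space tau)
    (opensT tau) (@opensI _ tau) (@opens_bigU _ tau).
HB.instance Definition _ (K : numFieldType) (X : lmodType K)
    (tau : topology X) := GRing.Lmodule.copy (top_space tau) X.

Definition topology_of (T : topologicalType) : topology T :=
  Topology (@openT T) (@openI T) (fun I f => @bigcup_open T I setT f \o
    (fun h i _ => h i)).

Section LinearTopologies.
Variables (R : realType) (X : lmodType R[i]).
Implicit Types (tau sigma : topology X) (nm : X -> R) (Gamma : set (X -> R)).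

Definition linear_topology tau : Prop :=
  continuous (fun z : top_space tau * top_space tau => z.1 + z.2) /\
  continuous (fun z : R[i]^o * top_space tau => z.1 *: z.2).

Definition locally_convex_topology tau : Prop :=
  linear_topology tau /\
  exists2 B : set_system (top_space tau),
    (forall b, b \in B -> convex_set b) & basis B.

Definition seminorm (q : X -> R) : Prop :=
  (forall x y, q (x + y) <= q x + q y) /\
  (forall (a : R[i]) x, q (a *: x) = complex.Re `|a| * q x).

Definition is_norm nm : Prop :=
  seminorm nm /\ forall x, nm x = 0 -> x = 0.

Definition seminorm_open Gamma (U : set X) : Prop :=
  forall x, U x -> exists F : set (X -> R), exists e : R,
    [/\ finite_set F, F `<=` Gamma, 0 < e &
      forall y, (forall q, F q -> q (y - x) < e) -> U y].

Lemma seminorm_openT Gamma : seminorm_open Gamma setT.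
Proof.
by move=> x _; exists set0, 1; split => //; exact: sub0set.
Qed.

Lemma seminorm_openI Gamma : setI_closed (seminorm_open Gamma).
Proof.
move=> U V oU oV x [/oU[F [e [finF FG e0 FU]]] /oV[G [r [finG GG r0 GV]]]].
exists (F `|` G), (Num.min e r); split.
- by rewrite finite_setU.
- by rewrite subUset.
- by rewrite lt_min e0.
- move=> y FGy; split.
    by apply: FU => q Fq; have := FGy q (or_introl Fq); rewrite lt_min => /andP[].
  by apply: GV => q Gq; have := FGy q (or_intror Gq); rewrite lt_min => /andP[].
Qed.

Lemma seminorm_open_bigU Gamma (I : Type) (f : I -> set X) :
  (forall i, seminorm_open Gamma (f i)) -> seminorm_open Gamma (\bigcup_i f i).
Proof.
move=> of_ x [i _ /of_[F [e [finF FG e0 Ff]]]]; exists F, e; split => //.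
by move=> y /Ff fy; exists i.
Qed.

Definition seminorm_topology Gamma : topology X :=
  Topology (seminorm_openT Gamma) (@seminorm_openI Gamma)
    (@seminorm_open_bigU Gamma).

Definition norm_topology nm : topology X := seminorm_topology [set nm].

Definition directed_seminorms Gamma : Prop :=
  Gamma !=set0 /\
  forall p q, Gamma p -> Gamma q ->
    exists2 r, Gamma r & forall x, p x <= r x /\ q x <= r x.

Definition saks_system nm tau Gamma : Prop :=
  [/\ forall q, Gamma q ->
        seminorm q /\ continuous (q : top_space tau -> R),
      directed_seminorms Gamma,
      opens tau = opens (seminorm_topology Gamma) &
      forall x, ((nm x)%:E = ereal_sup [set (q x)%:E | q in Gamma])%E].

Definition saks_space nm tau : Prop :=
  [/\ is_norm nm,
      locally_convex_topology tau,
      hausdorff_space (top_space tau),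
      opens tau `<=` opens (norm_topology nm) &
      exists Gamma, saks_system nm tau Gamma].

Definition coincide_on_bounded nm tau sigma : Prop :=
  forall (B : set X) (M : R), (forall x, B x -> nm x <= M) ->
    [set A `&` B | A in opens sigma] = [set A `&` B | A in opens tau].

Definition mixed_candidate nm tau sigma : Prop :=
  [/\ linear_topology sigma,
      coincide_on_bounded nm tau sigma,
      opens tau `<=` opens sigma &
      opens sigma `<=` opens (norm_topology nm)].

(* gamma = gamma(nm, tau); there is at most one such gamma. *)
Definition is_mixed_topology nm tau gamma : Prop :=
  mixed_candidate nm tau gamma /\
  forall sigma, mixed_candidate nm tau sigma -> opens sigma `<=` opens gamma.

Definition submixed_seminorms Gamma : set (X -> R) :=
  [set p | exists (q : nat -> X -> R) (a : nat -> R),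
    [/\ forall n, Gamma (q n), forall n, 0 <= a n,
        a @ \oo --> (0 : R) &
        p = fun x => sup (range (fun n => q n x * a n))]].

(* gamma = gamma_s(nm, tau). The submixed topology does not depend on the
   generating system, hence the condition for every Gamma. *)
Definition is_submixed_topology nm tau gamma : Prop :=
  (exists Gamma, saks_system nm tau Gamma) /\
  forall Gamma, saks_system nm tau Gamma ->
    opens gamma = opens (seminorm_topology (submixed_seminorms Gamma)).

Definition complete_topology tau : Prop :=
  forall F : set_system (top_space tau), ProperFilter F ->
    (forall U : set (top_space tau), nbhs (0 : top_space tau) U ->
      exists2 A, F A & forall x y, A x -> A y -> U (x - y)) ->
    exists x : top_space tau, F --> x.

Definition bounded_in tau (B : set (top_space tau)) : Prop :=
  forall U : set (top_space tau), nbhs (0 : top_space tau) U ->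
    exists2 r : R, 0 < r & B `<=` [set r%:C *: x | x in U].

Definition semi_montel_topology tau : Prop :=
  [/\ locally_convex_topology tau, hausdorff_space (top_space tau) &
      forall B : set (top_space tau), bounded_in B -> precompact B].

Definition sequentially_open (T : topologicalType) (U : set T) : Prop :=
  forall (u : nat -> T) (x : T), U x -> u @ \oo --> x ->
    \forall n \near \oo, U (u n).

Definition C_sequential_topology tau : Prop :=
  forall U : set (top_space tau), convex_set U -> sequentially_open U -> open U.

Definition complete_saks nm tau : Prop :=
  exists2 gamma, is_mixed_topology nm tau gamma & complete_topology gamma.

Definition semi_montel_saks nm tau : Prop :=
  exists2 gamma, is_mixed_topology nm tau gamma & semi_montel_topology gamma.

Definition C_sequential_saks nm tau : Prop :=
  exists2 gamma, is_mixed_topology nm tau gamma & C_sequential_topology gamma.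

End LinearTopologies.

Section PartialDerivatives.
Variables (R : realType) (d : nat) (E : normedModType R[i]).
Implicit Types (f g : 'rV[R]_d -> E) (x : 'rV[R]_d) (i : 'I_d).

(* The increment h is real although the scalars of E are complex. *)
Definition diff_quotient i f x (h : R) : E :=
  (h^-1)%:C *: (f (x + h *: delta_mx 0 i) - f x).

Definition pderivable i f x : Prop := cvg (diff_quotient i f x @ 0^').

Definition pderiv i f x : E := lim (diff_quotient i f x @ 0^').

Definition pderivs (s : seq 'I_d) f : 'rV[R]_d -> E := foldr pderiv f s.

(* The multi-index b is turned into the list of directions in which i occurs
   b i times. *)
Definition pderivm (b : mpoly.multinom d) f : 'rV[R]_d -> E :=
  pderivs (flatten [seq nseq (mpoly.fun_of_multinom b i) i | i <- enum 'I_d]) f.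

(* For Omega open, this only depends on the values of f on Omega. *)
Definition smooth (Omega : set 'rV[R]_d) f : Prop :=
  forall (s : seq 'I_d) x, Omega x ->
    {for x, continuous (pderivs s f)} /\
    forall i, pderivable i (pderivs s f) x.

Definition diff_op (P : mpoly.mpoly d R[i]) f x : E :=
  \sum_(b <- mpoly.msupp P) mpoly.mcoeff b P *: pderivm b f x.

Lemma diff_quotient_near_eq (Omega : set 'rV[R]_d) i f g x :
  open Omega -> Omega x -> {in Omega, f =1 g} ->
  \forall h \near 0^', diff_quotient i f x h = diff_quotient i g x h.
Proof.
move=> oO Ox fg.
have : (fun h : R => x + h *: delta_mx 0 i) @ (0 : R) --> x.
  have {2}-> : x = x + (0 : R) *: delta_mx 0 i by rewrite scale0r addr0.
  by apply: cvgD; [exact: cvg_cst|apply: cvgZr_tmp; exact: cvg_id].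
move=> /(_ _ (open_nbhs_nbhs (conj oO Ox))) nO.
apply: cvg_within.
have {}nO : nbhs (0 : R) [set h | Omega (x + h *: delta_mx 0 i)] by exact: nO.
apply: (@filterS _ (nbhs (0 : R)) _ [set h | Omega (x + h *: delta_mx 0 i)] _ _ nO) => h Oh.
by rewrite /diff_quotient !fg// inE.
Qed.

Lemma cvg_diff_quotient_lin (Omega : set 'rV[R]_d) i (a : R[i]) f g k x :
  open Omega -> Omega x -> {in Omega, k =1 fun y => a *: f y + g y} ->
  pderivable i f x -> pderivable i g x ->
  diff_quotient i k x @ 0^' --> a *: pderiv i f x + pderiv i g x.
Proof.
move=> oO Ox kE df dg.
have near_k := diff_quotient_near_eq i oO Ox (fun y Oy => esym (kE y Oy)).
apply: (cvg_trans (near_eq_cvg near_k)).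
rewrite (_ : diff_quotient i _ x = fun h : R =>
    a *: diff_quotient i f x h + diff_quotient i g x h); last first.
  apply/funext => h; rewrite /diff_quotient opprD addrACA scalerDr.
  by rewrite -scalerBr scalerA mulrC -scalerA.
by apply: cvgD => //; apply: cvgZl_tmp.
Qed.

Lemma pderiv_lin (Omega : set 'rV[R]_d) i (a : R[i]) f g k x :
  open Omega -> Omega x -> {in Omega, k =1 fun y => a *: f y + g y} ->
  pderivable i f x -> pderivable i g x ->
  pderivable i k x /\ pderiv i k x = a *: pderiv i f x + pderiv i g x.
Proof.
move=> oO Ox kE df dg.
have c := cvg_diff_quotient_lin oO Ox kE df dg.
by split; [apply/cvg_ex; eexists; exact: c|exact: cvg_lim c].
Qed.

Lemma pderivs_lin (Omega : set 'rV[R]_d) (a : R[i]) f g s :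
  open Omega -> smooth Omega f -> smooth Omega g ->
  {in Omega, pderivs s (a *: f + g) =1
    fun y => a *: pderivs s f y + pderivs s g y}.
Proof.
move=> oO sf sg; elim: s => [//|i s IH] x; rewrite inE => Ox.
exact: (pderiv_lin (i := i) oO Ox IH
  ((sf s x Ox).2 i) ((sg s x Ox).2 i)).2.
Qed.

Lemma smooth_lin (Omega : set 'rV[R]_d) (a : R[i]) f g :
  open Omega -> smooth Omega f -> smooth Omega g -> smooth Omega (a *: f + g).
Proof.
move=> oO sf sg s x Ox; split; last first.
  move=> i; have IH := pderivs_lin a s oO sf sg.
  by have [] := pderiv_lin (i := i) oO Ox IH
    ((sf s x Ox).2 i) ((sg s x Ox).2 i).
have E1 : \forall y \near nbhs x,
    a *: pderivs s f y + pderivs s g y = pderivs s (a *: f + g) y.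
  apply: filterS (open_nbhs_nbhs (conj oO Ox)) => y Oy.
  by rewrite (pderivs_lin a s oO sf sg)// inE.
rewrite /prop_for /continuous_at -(nbhs_singleton E1).
apply: (cvg_trans (near_eq_cvg E1)).
apply: cvgD; last exact: (sg s x Ox).1.
by apply: cvgZl_tmp; exact: (sf s x Ox).1.
Qed.

Lemma diff_quotient0 i : diff_quotient i (0 : 'rV[R]_d -> E) = fun _ _ => 0.
Proof.
by apply/funext => y; apply/funext => h; rewrite /diff_quotient subrr scaler0.
Qed.

Lemma pderivs0 s : pderivs s (0 : 'rV[R]_d -> E) = 0.
Proof.
elim: s => [//|i s IH]; rewrite /= IH; apply/funext => x.
by rewrite /pderiv diff_quotient0; apply: cvg_lim => //; exact: cvg_cst.
Qed.

Lemma smooth0 (Omega : set 'rV[R]_d) : smooth Omega (0 : 'rV[R]_d -> E).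
Proof.
move=> s x _; rewrite pderivs0; split; last first.
by move=> i; rewrite /pderivable diff_quotient0; exact: is_cvg_cst.
exact: (@cst_continuous 'rV[R]_d E 0 x).
Qed.

End PartialDerivatives.

Section Distributions.
Variables (R : realType).

(* The d-dimensional Lebesgue integral as an iterated integral; by Fubini the
   two agree for continuous functions with compact support, the only ones
   integrated below. *)
Fixpoint lebesgue_int d : ('rV[R]_d -> R) -> R :=
  match d return ('rV[R]_d -> R) -> R with
  | 0 => fun f => f 0
  | d'.+1 => fun f => \int[@lebesgue_measure R]_(t in setT)
      lebesgue_int (fun y : 'rV[R]_d' => f (row_mx (const_mx t : 'rV_1) y))
  end.

Variable d : nat.
Implicit Types (U K : set 'rV[R]_d) (phi : 'rV[R]_d -> R[i]^o)
  (u : ('rV[R]_d -> R[i]^o) -> R[i]^o) (P : mpoly.mpoly d R[i]).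

Definition complex_int phi : R[i] :=
  (lebesgue_int (fun x => complex.Re (phi x)))
    +i* (lebesgue_int (fun x => complex.Im (phi x))).

Definition test_function_on K phi : Prop :=
  smooth setT phi /\ forall x, ~ K x -> phi x = 0.

Definition test_function U phi : Prop :=
  exists K, [/\ compact K, K `<=` U & test_function_on K phi].

(* Only the values of u at test functions on U matter; M ranges over the upper
   bounds of the derivatives of phi of order at most N. *)
Definition distribution U u : Prop :=
  (forall (a : R[i]) phi psi, test_function U phi -> test_function U psi ->
     u (a *: phi + psi) = a *: u phi + u psi) /\
  (forall K, compact K -> K `<=` U -> exists (C : R) (N : nat),
     forall phi, test_function_on K phi -> forall M : R,
       (forall b x, (mpoly.mdeg b <= N)%N -> normR (pderivm b phi x) <= M) ->
       normR (u phi) <= C * M).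

Definition smooth_distribution U u : Prop :=
  exists2 g : 'rV[R]_d -> R[i]^o, smooth U g &
    forall phi, test_function U phi ->
      u phi = complex_int (fun x => g x * phi x).

Definition transpose_op P phi : 'rV[R]_d -> R[i]^o := fun x =>
  \sum_(b <- mpoly.msupp P)
    ((-1) ^+ mpoly.mdeg b * mpoly.mcoeff b P) *: pderivm b phi x.

(* (P(partial) u)(phi) = u(P(- partial) phi) *)
Definition dist_op P u : ('rV[R]_d -> R[i]^o) -> R[i]^o :=
  fun phi => u (transpose_op P phi).

Definition hypoelliptic P : Prop :=
  forall U u, open U -> distribution U u ->
    smooth_distribution U (dist_op P u) -> smooth_distribution U u.

End Distributions.

Section WeightedSpaces.
Variables (R : realType) (d : nat) (Omega : set 'rV[R]_d).
Variables (v : Omega -> {posnum R}) (P : mpoly.mpoly d R[i]) (E : normedModType R[i]).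

(* Derivatives of a function on the open set Omega are those, at points of
   Omega, of its extension by zero. *)
Definition ext0 (f : Omega -> E) : 'rV[R]_d -> E := 'valL_ 0 f.

Definition CPv : set (Omega -> E) :=
  [set f | [/\ smooth Omega (ext0 f),
               forall x, Omega x -> diff_op P (ext0 f) x = 0 &
               exists M : R, forall x, normR (f x) * (v x)%:num <= M]].

End WeightedSpaces.

Definition CPv_sigma (R : realType) (d : nat) (Omega : set 'rV[R]_d)
    (v : Omega -> {posnum R}) (P : mpoly.mpoly d R[i]) (E : normedModType R[i]) :
    set (Omega -> E) :=
  [set f | forall e : {linear E -> R[i]^o}, continuous e ->
    CPv v P (fun x => e (f x) : R[i]^o)].

Section CPvSpace.
Variables (R : realType) (d : nat) (Omega : set 'rV[R]_d).
Variables (oOmega : open Omega) (v : Omega -> {posnum R}).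
Variables (P : mpoly.mpoly d R[i]) (E : normedModType R[i]).

Lemma ext0_lin (a : R[i]) (f g : Omega -> E) :
  ext0 (a *: f + g) = a *: ext0 f + ext0 g.
Proof.
apply/funext => x; rewrite /ext0 /valL_ /= !fctE /=.
by case: ('oinv_set_val x) => [y|] /=; rewrite ?scaler0 ?addr0.
Qed.

Lemma ext00 : ext0 (0 : Omega -> E) = 0.
Proof.
by apply/funext => x; rewrite /ext0 /valL_ /=; case: ('oinv_set_val x).
Qed.

Definition CPv_pred : {pred Omega -> E} := mem (@CPv R d Omega v P E).

Lemma CPv_submod_closed : open Omega -> submod_closed CPv_pred.
Proof.
move=> oO; split.
  rewrite inE; split.
  - by rewrite ext00; exact: smooth0.
  - move=> x Ox; rewrite ext00 /diff_op big1// => b _.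
    by rewrite /pderivm pderivs0 scaler0.
  - by exists 0 => x; rewrite /normR normr0 mul0r.
move=> a f g; rewrite !inE => -[sf Pf [M fM]] [sg Pg [N gN]]; split.
- by rewrite ext0_lin; exact: smooth_lin.
- move=> x Ox; rewrite ext0_lin.
  have <- : a *: diff_op P (ext0 f) x + diff_op P (ext0 g) x = 0.
    by rewrite Pf// Pg// scaler0 addr0.
  rewrite /diff_op scaler_sumr -big_split /=; apply: eq_bigr => b _.
  rewrite /pderivm (pderivs_lin a _ oO sf sg) ?inE//.
  by rewrite scalerDr !scalerA mulrC.
- exists (complex.Re `|a| * M + N) => x.
  apply: (@le_trans _ _ ((complex.Re `|a| * normR (f x) + normR (g x)) * (v x)%:num)).
    by rewrite ler_pM2r// -normRZ; exact: normRD.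
  rewrite mulrDl -mulrA lerD// ler_wpM2l//.
  exact: (@normR_ge0 R R[i]^o a).
Qed.

End CPvSpace.

(* oOmega is recorded because the vector space structure depends on it. *)
Record CPv_space (R : realType) (d : nat) (Omega : set 'rV[R]_d)
    (oOmega : open Omega) (v : Omega -> {posnum R}) (P : mpoly.mpoly d R[i])
    (E : normedModType R[i]) := CPvSpace {
  CPv_fun :> Omega -> E ;
  _ : CPv_fun \in CPv_pred v P (E := E) }.

Section CPvLmodule.
Variables (R : realType) (d : nat) (Omega : set 'rV[R]_d).
Variables (oOmega : open Omega) (v : Omega -> {posnum R}).
Variables (P : mpoly.mpoly d R[i]) (E : normedModType R[i]).

Local Notation X := (CPv_space oOmega v P E).

HB.instance Definition _ := [isSub for @CPv_fun R d Omega oOmega v P E].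
HB.instance Definition _ := [Choice of X by <:].
#[local] HB.instance Definition _ := GRing.isSubmodClosed.Build R[i] (Omega -> E)
  (@CPv_pred R d Omega v P E) (CPv_submod_closed v P E oOmega).
HB.instance Definition _ := [SubChoice_isSubLmodule of X by <:].

End CPvLmodule.

Section CPvTopologies.
Variables (R : realType) (d : nat) (Omega : set 'rV[R]_d).
Variables (oOmega : open Omega) (v : Omega -> {posnum R}).
Variables (P : mpoly.mpoly d R[i]) (E : normedModType R[i]).

Local Notation X := (CPv_space oOmega v P E).

Definition CPv_norm (f : X) : R :=
  sup (range (fun x : Omega => normR (f x) * (v x)%:num)).

Definition tau_co : topology X :=
  topology_of (initial_topology
    ((fun f => f) : X -> {family compact, Omega -> E})).

(* The topology tau_S for a family S of subsets of Omega. *)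
Definition tau_fam (S : set (set Omega)) : topology X :=
  seminorm_topology [set p | exists2 A, S A &
    p = fun f : X => sup [set normR (f x) * (v x)%:num | x in A]].

End CPvTopologies.

Arguments CPv {R d Omega} v P E.
Arguments CPv_sigma {R d Omega} v P E.
Arguments CPv_space {R d Omega} oOmega v P E.
Arguments CPv_norm {R d Omega} oOmega v P E.
Arguments tau_co {R d Omega} oOmega v P E.
Arguments tau_fam {R d Omega} oOmega v P E.

(* Main.v *)
(** The mixed topology is generated by all seminorms that are small on the
    norm-bounded tau-small sets. Every neighbourhood of 0 for a candidate
    topology contains the unit ball of an infimal convolution of seminorms
    max(r_k, nm / (k + 1)) with tau-continuous r_k; the same seminorms give
    completeness and, as Omega has a countable compact exhaustion,
    C-sequentiality.

    Hypoellipticity is used once: a function that is, on every compact set, a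
    uniform limit of scalar solutions defines a distribution solution, hence is
    a smooth solution. So the scalar space is a Banach space, and the
    Banach-Steinhaus theorem for difference quotients shows that its balls are
    equicontinuous, hence tau_co-compact. On compact balls the submixed and the
    mixed topologies agree, for any family of seminorms whose supremum is the
    norm.

    If E is a Banach space, the Hahn-Banach and Banach-Steinhaus theorems turn
    bounds for e o f, e in E*, into bounds for f. Applied to differences of
    difference quotients they show that weakly smooth functions are smooth, and
    the limit of a Cauchy filter is a solution because it is so weakly. *)

Require Import Defs.
From HB Require Import structures.
From mathcomp Require Import all_boot all_order all_algebra.
From mathcomp Require Import all_classical all_reals all_analysis.
From mathcomp Require Import complex.
From mathcomp Require mpoly.
From mathcomp Require Import ring lra.

Set Implicit Arguments.
Unset Strict Implicit.
Unset Printing Implicit Defensive.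

Import Order.TTheory GRing.Theory Num.Theory.
Import numFieldNormedType.Exports.

Local Open Scope classical_set_scope.
Local Open Scope ring_scope.
Local Open Scope complex_scope.


(** A candidate for the mixed topology is linear but not assumed locally convex, so its
    neighbourhoods of 0 are reached through repeated halving, [V k.+1 + V k.+1] inside [V k]. A
    finite sum with k-th term in [V k.+1] stays in [V 0], and an infimal convolution is a seminorm
    whose small values produce such sums.

    Hypoellipticity carries no estimate for derivatives. Equicontinuity is obtained softly: the
    scalar space is complete, each single solution is Lipschitz at a given point because it is
    smooth, and uniform boundedness turns these separate constants into one multiple of the norm.

    Uniform boundedness is stated for a functional [N] on a subset [S] of a vector space, so that it
    serves both the space of solutions and the dual of [E].

    A Cauchy filter of the mixed topology need not contain a norm-bounded set. The limit is
    therefore taken uniformly on compact sets, and its boundedness and the mixed convergence need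
    arguments of their own. *)

Lemma half_ltr (R : realFieldType) (r : R) : 0 < r -> r / 2 < r.
Proof. by move=> r0; rewrite ltr_pdivrMr// ltr_pMr// ltr1n. Qed.

(** The [+ 1] in the denominator covers [M = 0]. This is the choice of delta for a linear modulus of
    continuity. *)
Lemma small_multiple (R : realFieldType) (M e : R) : 0 < e ->
  exists2 c, 0 < c & forall t, 0 <= t <= c -> M * t < e.
Proof.
move=> e0; have M1 : 0 < `|M| + 1 by rewrite ltr_wpDl.
exists (e / (`|M| + 1)) => [|t /andP[t0 tc]]; first by rewrite divr_gt0.
apply: (@le_lt_trans _ _ (`|M| * t)); first by rewrite ler_wpM2r// ler_norm.
apply: (@le_lt_trans _ _ (`|M| * (e / (`|M| + 1)))); first by rewrite ler_wpM2l.
by rewrite mulrA ltr_pdivrMr// mulrC ltr_pM2l// ltrDl.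
Qed.

(** Comparable elements of [R[i]] share their imaginary part, so complex-valued radii of balls are
    real. *)
Lemma posC_real (R : realType) (e : R[i]) : 0 < e -> exists2 r : R, 0 < r & e = r%:C.
Proof.
by case: e => a b; rewrite ltcE /= => /andP[/eqP -> a0]; exists a.
Qed.

(** * Real-valued norms and the complex plane *)

Section NormR.
Context {R : realType} {E : normedModType R[i]}.
Implicit Types x y z : E.

Lemma normR0 : normR (0 : E) = 0.
Proof. by rewrite /normR normr0. Qed.

Lemma normRN x : normR (- x) = normR x.
Proof. by rewrite /normR normrN. Qed.

Lemma normRBC x y : normR (x - y) = normR (y - x).
Proof. by rewrite -normRN opprB. Qed.

Lemma normR0_eq0 x : normR x = 0 -> x = 0.
Proof. by move=> x0; apply/normr0_eq0; rewrite normRC x0. Qed.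

Lemma normR_gt0 x : x != 0 -> 0 < normR x.
Proof.
by move=> x0; rewrite lt_neqAle normR_ge0 andbT eq_sym; apply: contraNneq x0 => /normR0_eq0 ->.
Qed.

Lemma normRB x y : normR (x - y) <= normR x + normR y.
Proof. by rewrite -(normRN y) normRD. Qed.

Lemma normR_distD z x y : normR (x - y) <= normR (x - z) + normR (z - y).
Proof. by rewrite (le_trans _ (normRD _ _))// addrA subrK. Qed.

Lemma normR_sum (I : Type) (r : seq I) (P : pred I) (F : I -> E) :
  normR (\sum_(i <- r | P i) F i) <= \sum_(i <- r | P i) normR (F i).
Proof.
elim/big_ind2 : _ => [|x a y b xa yb|//]; first by rewrite normR0.
by rewrite (le_trans (normRD _ _))// lerD.
Qed.

Lemma normR_nbhsP x (U : set E) :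
  nbhs x U <-> exists2 e : R, 0 < e & forall y, normR (y - x) < e -> U y.
Proof.
split=> [/nbhs_ballP[_ /= /posC_real[e e0 ->] xeU]|[e e0 xeU]].
  exists e => // y yx; apply: xeU; rewrite -ball_normE/=.
  by rewrite normRC ltcR normRBC.
apply/nbhs_ballP; exists e%:C; first by rewrite /= ltcR.
by move=> y; rewrite -ball_normE/= normRC ltcR normRBC; exact: xeU.
Qed.

Lemma cvg_normRP {T : Type} {F : set_system T} {FF : Filter F} (f : T -> E) x :
  f @ F --> x <-> forall e : R, 0 < e -> \forall t \near F, normR (f t - x) < e.
Proof.
split=> [fx e e0|fx U /normR_nbhsP[e e0 eU]].
  by apply: (fx [set y | normR (y - x) < e]); apply/normR_nbhsP; exists e.
by apply: filterS (fx e e0) => t; exact: eU.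
Qed.

Lemma normR_lipschitz_continuous (f : E -> R) :
  (forall x y, `|f x - f y| <= normR (x - y)) -> continuous f.
Proof.
move=> fl x; apply/cvgrPdist_lt => e e0; apply/normR_nbhsP; exists e => // y yx.
by rewrite (le_lt_trans (fl _ _))// normRBC.
Qed.

Lemma ler_dist_normR x y : `|normR x - normR y| <= normR (x - y).
Proof.
rewrite ler_norml; apply/andP; split.
  by rewrite lerNl opprB lerBlDr normRBC (le_trans _ (normRD _ _))// subrK.
by rewrite lerBlDr (le_trans _ (normRD _ _))// subrK.
Qed.

Lemma normR_continuous : continuous (@normR R E).
Proof. exact: normR_lipschitz_continuous ler_dist_normR. Qed.

End NormR.

Section AbsC.
Context {R : realType}.
Implicit Types (a b z : R[i]^o).
Local Notation absC := (@normR R R[i]^o).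

Lemma normR_scale {E : normedModType R[i]} (a : R[i]) (x : E) :
  normR (a *: x) = absC a * normR x.
Proof. exact: normRZ. Qed.

Lemma absCM a b : absC (a * b) = absC a * absC b.
Proof. exact: (@normRZ R R[i]^o a b). Qed.

Lemma absC_real (r : R) : absC r%:C = `|r|.
Proof. by rewrite /normR normc_def/= expr0n addr0 sqrtr_sqr. Qed.

Lemma absC_Re z : `|complex.Re z| <= absC z.
Proof. by rewrite -lecR -normRC; exact: normc_ge_Re. Qed.

Lemma absC_Im z : `|complex.Im z| <= absC z.
Proof.
have -> : absC z = Num.sqrt (complex.Re z ^+ 2 + complex.Im z ^+ 2).
  by rewrite /normR normc_def.
by rewrite -sqrtr_sqr ler_wsqrtr// lerDr sqr_ge0.
Qed.

(** The source of the factors 2 in [hahn_banach], [mean_value] and [complex_int_le], where a complex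
    estimate is reduced to two real ones. *)
Lemma absC_le z : absC z <= `|complex.Re z| + `|complex.Im z|.
Proof.
have -> : z = (complex.Re z)%:C + 'i%C * (complex.Im z)%:C :> R[i]^o by exact: complexE.
apply: le_trans (normRD _ _) _; rewrite absCM !absC_real.
rewrite [absC 'i%C]/normR normc_def /= expr0n /= add0r expr1n sqrtr1 mul1r.
by rewrite !mul0r !mul1r !subr0 !addr0 !add0r.
Qed.

Lemma cReD a b : complex.Re (a + b) = complex.Re a + complex.Re b.
Proof. by case: a; case: b. Qed.

Lemma cImD a b : complex.Im (a + b) = complex.Im a + complex.Im b.
Proof. by case: a; case: b. Qed.

Lemma cReB a b : complex.Re (a - b) = complex.Re a - complex.Re b.
Proof. by case: a; case: b. Qed.

Lemma cImB a b : complex.Im (a - b) = complex.Im a - complex.Im b.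
Proof. by case: a; case: b. Qed.

Lemma cReM a b : complex.Re (a * b) =
  complex.Re a * complex.Re b - complex.Im a * complex.Im b.
Proof. by case: a; case: b. Qed.

Lemma cImM a b : complex.Im (a * b) =
  complex.Re a * complex.Im b + complex.Im a * complex.Re b.
Proof. by case: a; case: b => *; rewrite /= addrC. Qed.

Lemma Re_continuous : continuous (@complex.Re R : R[i]^o -> R).
Proof.
apply: (@normR_lipschitz_continuous _ R[i]^o) => x y.
by rewrite -cReB absC_Re.
Qed.

Lemma Im_continuous : continuous (@complex.Im R : R[i]^o -> R).
Proof.
apply: (@normR_lipschitz_continuous _ R[i]^o) => x y.
by rewrite -cImB absC_Im.
Qed.

Lemma cvg_ReIm {T : Type} {F : set_system T} {FF : Filter F} (f : T -> R[i]^o) z :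
  @complex.Re R \o f @ F --> complex.Re z -> @complex.Im R \o f @ F --> complex.Im z ->
  f @ F --> z.
Proof.
move=> /cvgrPdist_lt fR /cvgrPdist_lt fI; apply/cvg_normRP => e e0.
have e2 : 0 < e / 2 by rewrite divr_gt0.
apply: filterS2 (fR _ e2) (fI _ e2) => t /= R1 I1.
rewrite (le_lt_trans (absC_le _))// cReB cImB [e](splitr e) ltrD//.
  by rewrite distrC.
by rewrite distrC.
Qed.

End AbsC.

(** Real and imaginary part are 1-Lipschitz, so they map a Cauchy filter to Cauchy filters of [R],
    whose limits are reassembled. *)
Lemma banach_complex (R : realType) : banach (R[i]^o : normedModType R[i]).
Proof.
move=> F FF cF.
have H (g : R[i]^o -> R) : (forall x y, `|g x - g y| <= normR (x - y)) ->
    cvg (g @ F).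
  move=> gl; apply: cauchy_cvg; apply/cauchy_ballP => e e0.
  have cFe : entourage [set xy : R[i]^o * R[i]^o | normR (xy.1 - xy.2) < e].
    rewrite -entourage_ballE; exists e%:C; first by rewrite /= ltcR.
    move=> [x y] /=; rewrite -ball_normE/= /ball_/= normRC.
    by move=> h; rewrite -ltcR; exact: h.
  have {cFe} := cF _ cFe; rewrite !near_simpl => -[[A B] /= [FA FB] AB].
  exists (A, B) => //= -[x y] /= xy.
  by case: xy => Ax By; rewrite -ball_normE/= (le_lt_trans (gl _ _))//; exact: (AB (x, y)).
have /cvg_ex[a Fa] := H _ (fun x y => le_trans (eq_ind _ (fun t => `|t| <= _) (absC_Re _) _ (cReB _ _)) (lexx _)).
have /cvg_ex[b Fb] := H _ (fun x y => le_trans (eq_ind _ (fun t => `|t| <= _) (absC_Im _) _ (cImB _ _)) (lexx _)).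
by apply/cvg_ex; exists (a +i* b); exact: (@cvg_ReIm _ _ F _ id).
Qed.

Lemma cvg_lin (R : realType) (E : normedModType R[i]) {T : Type}
    {F : set_system T} {FF : Filter F} (a : R[i]) (f g : T -> E) x y :
  f @ F --> x -> g @ F --> y -> (fun t => a *: f t + g t) @ F --> a *: x + y.
Proof. by move=> fx gy; apply: cvgD => //; exact: cvgZl_tmp. Qed.

(** * The Hahn-Banach theorem *)

Section HahnBanach.
Context {R : realType} {E : normedModType R[i]}.
Implicit Types (x y z : E) (G : set (E * R)).

(** A real-linear functional on a real subspace is encoded by its graph, so that extension is
    inclusion and the union of a chain is a union of sets. Single-valuedness is a consequence of the
    domination by the norm ([dominated_graph_fun]). *)
Definition dominated_graph G : Prop :=
  (forall u w (t : R), G u -> G w -> G (u.1 + t%:C *: w.1, u.2 + t * w.2)) /\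
  forall u, G u -> u.2 <= normR u.1.

Lemma dominated_graph_scale G u (t : R) : dominated_graph G -> G u ->
  G (t%:C *: u.1, t * u.2).
Proof.
move=> [Glin _] Gu; have := Glin _ _ (- 1) Gu Gu.
rewrite rmorphN1 scaleN1r mulN1r !subrr => G0.
by have := Glin _ _ t G0 Gu; rewrite /= !add0r.
Qed.

Lemma dominated_graph_fun G x r s : dominated_graph G ->
  G (x, r) -> G (x, s) -> r = s.
Proof.
move=> [Glin Gle] Gr Gs.
have H a b : G (x, a) -> G (x, b) -> a <= b.
  move=> Ga Gb; have := Gle _ (Glin _ _ (- 1) Ga Gb).
  by rewrite /= rmorphN1 scaleN1r mulN1r subrr normR0 subr_le0.
by apply/eqP; rewrite eq_le !H.
Qed.

(** An admissible value at [z] lies above all [u.2 - normR (u.1 - z)] and below all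
    [normR (u.1 + z) - u.2]. The triangle inequality makes this interval non-empty, and its lower
    end is taken. *)
Lemma dominated_graph_extend G z u0 : dominated_graph G -> G u0 ->
  exists a : R, dominated_graph
    [set w | exists2 u, G u & exists t : R, w = (u.1 + t%:C *: z, u.2 + t * a)].
Proof.
move=> dG; have [Glin Gle] := dG => Gu0.
pose A := [set u.2 - normR (u.1 - z) | u in G].
have Aub u : G u -> ubound A (normR (u.1 + z) - u.2).
  move=> Gu _ [w Gw <-]; rewrite lerBrDr addrAC lerBlDr.
  have := Gle _ (Glin _ _ 1 Gu Gw); rewrite /= scale1r mul1r addrC => /le_trans; apply.
  by rewrite (le_trans _ (normRD _ _))// addrACA subrr addr0.
have supA : has_sup A by split; [exists (u0.2 - normR (u0.1 - z)), u0|exists (normR (u0.1 + z) - u0.2); exact: Aub].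
exists (sup A); split.
  move=> _ _ t [u Gu [r ->]] [w Gw [s ->]]; exists (u.1 + t%:C *: w.1, u.2 + t * w.2).
    exact: Glin.
  exists (r + t * s) => /=; congr pair.
    by rewrite scalerDr scalerA rmorphD rmorphM /= scalerDl addrACA.
  by rewrite mulrDr mulrDl addrACA mulrA.
move=> _ [u Gu [t ->]] /=.
(* Division by the absolute value of [t] leaves two cases: the upper ends of the interval settle
   [t > 0], the lower ends [t < 0]. *)
have [->|t0] := eqVneq t 0; first by rewrite scale0r mul0r !addr0; exact: Gle.
have tC0 : t%:C != 0 :> R[i] by rewrite fmorph_eq0.
have Gtu := dominated_graph_scale t^-1 dG Gu.
have E1 : normR (u.1 + t%:C *: z) = `|t| * normR (t^-1%:C *: u.1 + z).
  rewrite -absC_real -normR_scale scalerDr scalerA.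
  by rewrite -rmorphM /= mulfV// scale1r.
case: (ltP 0 t) => [tp|tn].
  have := sup_le_ub supA.1 (Aub _ Gtu).
  rewrite lerBrDr -(ler_pM2l tp) mulrDr mulrA mulfV// mul1r /= => H.
  by rewrite addrC E1 gtr0_norm.
have tn' : t < 0 by rewrite lt_neqAle t0.
have Gv := dominated_graph_scale (-1) dG Gtu.
have := sup_upper_bound supA; move=> /(_ _ (imageP _ Gv)) /=.
rewrite rmorphN1 scaleN1r mulN1r -[X in normR X]opprD normRN => H.
have : - t * - (t^-1 * u.2) <= - t * (sup A + normR (t^-1%:C *: u.1 + z)).
  rewrite ler_pM2l ?oppr_gt0//; by move: H; set s := sup A; set n := normR _; set q := _ * _; lra.
rewrite mulrNN mulrA mulfV// mul1r mulrDr E1 ltr0_norm// mulNr.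
by rewrite -lerBlDl opprK.
Qed.

Lemma hahn_banach_real (x0 : E) : exists f : E -> R,
  [/\ forall x y (t : R), f (x + t%:C *: y) = f x + t * f y,
      forall x, f x <= normR x & f x0 = normR x0].
Proof.
(* Zorn's lemma also asks for the union of the empty chain, so the empty graph must satisfy [P];
   hence [x0] is required of non-empty graphs only. *)
pose P := [set G | dominated_graph G /\ (G !=set0 -> G (x0, normR x0))].
have [F FP Ftot|G [[dG Gx0] Gmax]] := @Zorn_bigcup _ P.
  split; [split|] => [u w t [A FA Au] [B FB Bw]|u [A FA Au]|[u [A FA Au]]].
  - have [AB|BA] := Ftot _ _ FA FB.
      by exists B => //; apply: (FP _ FB).1.1 => //; exact: AB.
    by exists A => //; apply: (FP _ FA).1.1 => //; exact: BA.
  - exact: (FP _ FA).1.2.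
  - by exists A => //; apply: (FP _ FA).2; exists u.
have GN : G !=set0.
  apply/set0P/eqP => G0.
  apply: (Gmax [set u | exists t : R, u = (t%:C *: x0, t * normR x0)]).
    rewrite G0; split; first exact: sub0set.
    by move=> /(_ (0%:C *: x0, 0 * normR x0)); apply; exists 0.
  split; [split|].
  - move=> _ _ t [r ->] [s ->]; exists (r + t * s) => /=.
    by rewrite scalerA -rmorphM -scalerDl -rmorphD mulrDl mulrA.
  - move=> _ [t ->] /=; rewrite normR_scale absC_real.
    by rewrite ler_wpM2r ?normR_ge0// ler_norm.
  - by move=> _; exists 1; rewrite scale1r mul1r.
have {GN}Gx0 := Gx0 GN.
(* A maximal graph is defined everywhere, as a missing point would allow a one-dimensional
   extension. *)
have tot x : exists r, G (x, r).
  apply: contrapT => nx.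
  have [a dG'] := dominated_graph_extend x dG Gx0.
  set G' := (X in dominated_graph X) in dG'.
  have GG' : G `<=` G'.
    by move=> [y r] Gy; exists (y, r) => //; exists 0; rewrite scale0r mul0r !addr0.
  apply: (Gmax G'); last by split => // _; exact: GG'.
  split => // G'G; apply: nx; exists (0 * normR x0 + 1 * a); apply: G'G.
  exists (0%:C *: x0, 0 * normR x0); first exact: (dominated_graph_scale 0 dG Gx0).
  by exists 1; rewrite /= scale0r add0r scale1r.
have /choice[f Gf] := tot; exists f; split.
- by move=> x y t; apply: (dominated_graph_fun dG (Gf _)); exact: (dG.1 (x, f x) (y, f y)).
- by move=> x; exact: (dG.2 (x, f x)).
- exact: (dominated_graph_fun dG (Gf _)).
Qed.

(* The constant 2 saves the rotation argument in the complexification. *)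
Lemma hahn_banach (x0 : E) : exists e : {linear E -> R[i]^o},
  (forall x, normR (e x) <= 2 * normR x) /\ normR x0 <= normR (e x0).
Proof.
have [f [flin fle fx0]] := hahn_banach_real x0.
have fD x y : f (x + y) = f x + f y by rewrite -[y]scale1r flin mul1r scale1r.
have f0 : f 0 = 0 by apply/(addrI (f 0)); rewrite -fD !addr0.
have fZ (t : R) x : f (t%:C *: x) = t * f x by rewrite -[LHS]addr0 -[_ *: _]add0r flin f0 !add0r addr0.
have fN x : f (- x) = - f x by rewrite -scaleN1r -(rmorphN1 (real_complex R)) fZ mulN1r.
have fabs x : `|f x| <= normR x.
  by rewrite ler_norml fle andbT lerNl -fN -normRN fle.
(* The only complex-linear functional with real part [f]. *)
pose g x : R[i]^o := f x -i* f ('i%C *: x).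
have glin : linear g.
  move=> a x y; rewrite /g scalerDr !fD.
  have aE : a = (complex.Re a)%:C + 'i%C * (complex.Im a)%:C by exact: complexE.
  have E1 z : f (a *: z) = complex.Re a * f z + complex.Im a * f ('i%C *: z).
    by rewrite {1}aE scalerDl fD fZ [_ * _%:C]mulrC -scalerA fZ.
  have E2 z : f ('i%C *: (a *: z)) = complex.Re a * f ('i%C *: z) - complex.Im a * f z.
    by rewrite scalerA mulrC -scalerA E1 scalerA -expr2 sqr_i scaleN1r fN mulrN.
  rewrite E1 E2; apply/eqP; rewrite eq_complex; case: (a) => r s /=.
  by apply/andP; split; apply/eqP; ring.
pose g_lin := GRing.isLinear.Build _ _ _ _ g glin.
pose e : {linear E -> R[i]^o} := HB.pack g g_lin.
exists e; split => [x|].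
  apply: le_trans (absC_le _) _; rewrite /= normrN mulr2n mulrDl mul1r lerD//.
  apply: le_trans (fabs _) _; rewrite normR_scale.
  have -> : normR ('i%C : R[i]^o) = 1.
    by rewrite /normR normc_def /= expr0n /= add0r expr1n sqrtr1.
  by rewrite mul1r.
by apply: le_trans (absC_Re _); rewrite /= fx0 ger0_norm// normR_ge0.
Qed.

Lemma functional_eq0 x :
  (forall e : {linear E -> R[i]^o}, continuous e -> e x = 0) -> x = 0.
Proof.
move=> ex; have [e [e2 ex0]] := hahn_banach x.
apply: normR0_eq0; apply/eqP; rewrite eq_le normR_ge0 andbT (le_trans ex0)//.
rewrite ex ?normR0// => y; apply/cvg_normRP => r r0; apply/normR_nbhsP.
exists (r / 2) => [|z zy]; first by rewrite divr_gt0.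
by rewrite -linearB (le_lt_trans (e2 _))// mulrC -ltr_pdivlMr.
Qed.

End HahnBanach.

(** * Uniform boundedness *)

Section UniformBoundedness.
Context {R : realType}.

(** The factor 3/2 is the sum of the geometric series of ratio 1/3: these are the tails of the
    series built in [uniform_boundedness]. *)
Lemma cvg_expr_third : (fun n => (3%:R / 2) * (3^-1 : R) ^+ n) @ \oo --> (0 : R).
Proof.
rewrite -[X in _ --> X](mulr0 (3%:R / 2)); apply: cvgMr; apply: cvg_expr.
by rewrite ger0_norm ?invr_ge0// invf_lt1// ltr1n.
Qed.

Section GlidingHump.
Variables (V : lmodType R[i]) (S : set V) (N : V -> R) (T : Type) (A : set T)
  (q : T -> V -> R).
Hypothesis S0 : S 0.
Hypothesis Slin : forall (a : R[i]) x y, S x -> S y -> S (x + a *: y).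
Hypothesis N_ge0 : forall x, S x -> 0 <= N x.
Hypothesis N0 : N 0 = 0.
Hypothesis ND : forall x y, S x -> S y -> N (x + y) <= N x + N y.
Hypothesis NZ : forall (a : R) x, S x -> N (a%:C *: x) <= `|a| * N x.
Hypothesis N_complete : forall (u : nat -> V) (r : nat -> R),
  (forall n, S (u n)) -> r @ \oo --> 0 ->
  (forall n m, (n <= m)%N -> N (u m - u n) <= r n) ->
  exists2 x, S x & forall n, N (x - u n) <= r n.
Hypothesis qD : forall t x y, q t (x + y) <= q t x + q t y.
Hypothesis qZ : forall t (a : R) x, q t (a%:C *: x) = `|a| * q t x.
Hypothesis q_bounded : forall t, A t -> exists C, forall x, S x -> q t x <= C * N x.
Hypothesis q_pointwise : forall x, S x -> exists M, forall t, A t -> q t x <= M.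

Let q0 t : q t 0 = 0.
Proof. by have := qZ t 0 0; rewrite scaler0 normr0 mul0r. Qed.

Let qN t x : q t (- x) = q t x.
Proof.
by have := qZ t (-1) x; rewrite normrN1 mul1r rmorphN1 scaleN1r.
Qed.

Let q_ge0 t x : 0 <= q t x.
Proof.
have := qD t x (- x); rewrite subrr q0 qN -mulr2n.
by rewrite pmulrn_lge0.
Qed.

(** Without a uniform constant, some [q t] has a supremum above [C] on the unit ball of [N]. That
    supremum is finite by [q_bounded], and [z] is chosen within a factor 3/4 of it. *)
Let almost_norming C : 0 < C ->
  ~ (exists C, forall t x, A t -> S x -> q t x <= C * N x) ->
  exists tz : T * V, [/\ A tz.1, S tz.2, N tz.2 <= 1, C < q tz.1 tz.2 &
    forall x, S x -> q tz.1 x <= (4%:R / 3%:R) * q tz.1 tz.2 * N x].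
Proof.
move=> C0 /forallNP/(_ C)/existsNP[t /existsNP[x /not_implyP[At /not_implyP[Sx /negP]]]].
rewrite -ltNge => Cq; have [K qK] := q_bounded At.
have SZ (a : R) y : S y -> S (a%:C *: y) by move=> Sy; rewrite -[_ *: _]add0r; exact: Slin.
have Nx0 : 0 < N x.
  rewrite lt_neqAle N_ge0// andbT; apply/eqP => Nx; move: Cq (qK _ Sx).
  by rewrite -Nx !mulr0 => /lt_le_trans/[apply]; rewrite ltxx.
pose B := [set q t y | y in [set y | S y /\ N y <= 1]].
have supB : has_sup B.
  split; first by exists (q t 0), 0 => //; rewrite /= N0; split.
  exists (Num.max K 0) => _ [y [Sy Ny] <-]; rewrite (le_trans (qK _ Sy))//.
  apply: le_trans (_ : Num.max K 0 * N y <= _).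
    by rewrite ler_wpM2r ?N_ge0// le_max lexx.
  by rewrite ler_piMr// le_max lexx orbT.
have normalize y : S y -> 0 < N y -> B (q t y / N y).
  move=> Sy Ny; exists ((N y)^-1%:C *: y).
    split; first exact: SZ.
    by rewrite (le_trans (NZ _ Sy))// gtr0_norm ?invr_gt0// mulVf// gt_eqF.
  by rewrite qZ gtr0_norm ?invr_gt0// mulrC.
have CB : C < sup B.
  apply: lt_le_trans (sup_upper_bound supB (normalize _ Sx Nx0)).
  by rewrite ltr_pdivlMr.
have eps0 : 0 < sup B - Num.max C (3%:R / 4%:R * sup B).
  have sB := lt_trans C0 CB.
  rewrite subr_gt0 gt_max CB/=; set s := sup B in sB *; lra.
have [_ [z [Sz Nz] <-]] := sup_adherent eps0 supB.
rewrite opprB addrC subrK gt_max => /andP[Cz qz].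
exists (t, z); split => //= y Sy.
have [Ny0|Ny0] := ltP 0 (N y); last first.
  have {}Ny0 : N y = 0 by apply/eqP; rewrite eq_le Ny0 N_ge0.
  by rewrite (le_trans (qK _ Sy))// Ny0 !mulr0.
rewrite -ler_pdivrMr//.
apply: le_trans (sup_upper_bound supB (normalize _ Sy Ny0)) _.
move: qz; set s := sup B; set p := q _ _; lra.
Qed.

(* A. Sokal's proof of the Banach-Steinhaus theorem. *)
Lemma uniform_boundedness :
  exists C, forall t x, A t -> S x -> q t x <= C * N x.
Proof.
apply: contrapT => unb.
(* The hump [z n] lies in the unit ball and satisfies [4 ^ n < q (t n) (z n)]. Scaled by [3^-n] the
   humps are summable, yet their values still grow at least like [(4/3)^n]. *)
have /choice[tz tzP] (n : nat) := almost_norming (exprn_gt0 n (ltr0n R 4)) unb.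
pose t n := (tz n).1; pose z n := (tz n).2.
pose c n : R := 3^-1 ^+ n.
have c_gt0 n : 0 < c n by rewrite exprn_gt0// invr_gt0.
have cS n : c n.+1 = 3^-1 * c n by rewrite /c exprS.
(* The sign is chosen so that the new hump is not cancelled by the earlier ones: [2 w] is the
   difference of [y + w] and [y - w], so one of these has a value at least that of [w]. *)
pose s n y : R := if c n * q (t n) (z n) <= q (t n) (y + (c n)%:C *: z n)
  then c n else - c n.
have sc n y : `|s n y| = c n.
  by rewrite /s; case: ifP => _; rewrite ?normrN gtr0_norm.
pose u := fix u n := if n is m.+1 then u m + (s m (u m))%:C *: z m else 0.
have Su n : S (u n).
  by elim: n => [|n IH] //=; apply: Slin => //; have [] := tzP n.
have SB x y : S x -> S y -> S (x - y).
  by move=> Sx Sy; rewrite -scaleN1r -(rmorphN1 (real_complex R)); exact: Slin.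
have qu n : c n * q (t n) (z n) <= q (t n) (u n.+1).
  rewrite /= /s; case: ifPn => //; rewrite -ltNge => lt.
  have := qD (t n) (u n + (c n)%:C *: z n) (- (u n + (- c n)%:C *: z n)).
  rewrite qN opprD addrACA subrr add0r rmorphN /= scaleNr opprK -scalerDl.
  rewrite -rmorphD qZ ger0_norm ?addr_ge0 ?(ltW (c_gt0 n))// => H.
  have := le_lt_trans H (ltr_leD lt (lexx _)).
  by rewrite mulrDl ltrD2l => /ltW.
have du n : N (u n.+1 - u n) <= c n.
  have [_ Sz Nz _ _] := tzP n.
  rewrite /= addrAC subrr add0r (le_trans (NZ _ Sz))// sc.
  by rewrite -[leRHS]mulr1 ler_wpM2l// ltW.
have uc n m : (n <= m)%N -> N (u m - u n) <= 3%:R / 2 * c n.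
  move=> nm; rewrite -(subnKC nm); move: (m - n)%N => k {m nm}.
  have H j : N (u (n + j)%N - u n) <= 3%:R / 2 * (c n - c (n + j)%N).
    elim: j => [|j IH]; first by rewrite addn0 !subrr N0 mulr0.
    rewrite addnS -[u _.+1](subrK (u (n + j)%N)) -addrA.
    rewrite (le_trans (ND (SB _ _ (Su _) (Su _)) (SB _ _ (Su _) (Su _))))//.
    apply: le_trans (lerD (du _) IH) _; rewrite cS; set a := c n; set b := c _; lra.
  apply: le_trans (H k) _; rewrite ler_pM2l ?divr_gt0//.
  by rewrite gerBl ltW.
have [x Sx xu] := N_complete Su cvg_expr_third uc.
have [M qM] := q_pointwise Sx.
(* The n-th hump survives in the limit: [x - u n.+1] has size at most [3^-n / 2], which costs at
   most [4/3 * 1/2 = 2/3] of [c n * q (t n) (z n)]. The remaining third is at least a third of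
   [(4/3)^n]. *)
have lower n : (4%:R / 3%:R) ^+ n <= 3%:R * M.
  have [At Sz Nz qz qK] := tzP n.
  have h1 : q (t n) (u n.+1) <= q (t n) x + q (t n) (x - u n.+1).
    by rewrite -(qN _ (x - _)) opprB (le_trans _ (qD _ _ _))// addrCA subrr addr0.
  have h2 := qK _ (SB _ _ Sx (Su n.+1)).
  have h3 := qM _ At.
  have h4 : 4%:R / 3%:R * q (t n) (z n) * N (x - u n.+1) <=
      4%:R / 3%:R * q (t n) (z n) * (3%:R / 2 * c n.+1).
    by rewrite ler_wpM2l// ?mulr_ge0// ?divr_ge0//; exact: xu.
  have h5 : (4%:R / 3%:R) ^+ n <= c n * q (t n) (z n).
    by rewrite exprMn mulrC ler_pM2l// ltW.
  have h6 := qu n.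
  move: h1 h2 h3 h4 h5 h6; rewrite cS -/(t n) -/(z n).
  set a := q _ (u _); set b := q _ x; set d := q _ (x - _); set e := q _ (z n).
  set f := c n; set g := N _ => h1 h2 h3 h4 h5 h6.
  have : 4%:R / 3%:R * e * (3%:R / 2 * (3^-1 * f)) = 2 / 3%:R * (f * e) by field.
  move: h4; set w := 4%:R / 3%:R * e * _ => h4 wE; rewrite -/d -/g -/e in h2.
  have hd : d <= 2 / 3%:R * (f * e) by rewrite -wE; exact: le_trans h2 h4.
  move: h1 h3 h5 h6 hd; rewrite -/f -/e; set P := _ ^+ _; set Q := f * e.
  by clearbody a b d P Q; lra.
have bernoulli n : 1 + n%:R / 3%:R <= (4%:R / 3%:R : R) ^+ n.
  elim: n => [|n IH]; first by rewrite mul0r addr0 expr0.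
  rewrite exprS; apply: le_trans (ler_wpM2l _ IH); last by rewrite divr_ge0.
  have : 0 <= n%:R :> R by [].
  rewrite -[n.+1%:R]natr1; set k := n%:R; lra.
(* Once n exceeds [9 |M|], the lower bound [1 + n / 3] exceeds [3 M]. *)
have := archi_boundP (normr_ge0 (9%:R * M)).
set n := Num.bound _ => nM.
have := le_trans (bernoulli n) (lower n); have := ler_norm (9%:R * M).
move: nM; set a := `|_|; set k := n%:R; lra.
Qed.

End GlidingHump.

Lemma banach_cvg_seq (E : normedModType R[i]) (u : nat -> E) (r : nat -> R) :
  banach E -> r @ \oo --> 0 ->
  (forall n m, (n <= m)%N -> normR (u m - u n) <= r n) ->
  exists x, u @ \oo --> x /\ forall n, normR (x - u n) <= r n.
Proof.
move=> bE r0 ur.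
have cu : cauchy (u @ \oo).
  apply/cauchyP => _ /posC_real[e e0 ->].
  have /cvgrPdist_lt/(_ _ e0)[n _ /(_ n (leqnn n)) rn] := r0.
  exists (u n); exists n => // m nm /=; rewrite -ball_normE/= normRC ltcR.
  rewrite normRBC (le_lt_trans (ur _ _ nm))//.
  by move: rn; rewrite sub0r normrN; exact: le_lt_trans (ler_norm _).
have ux : u @ \oo --> lim (u @ \oo) by exact: bE.
exists (lim (u @ \oo)); split=> [|n]; first exact: ux.
set x := lim _ in ux *.
apply/ler_addgt0Pr => e e0.
have /cvg_normRP/(_ _ e0)[k _ uk] := ux.
apply: le_trans (normR_distD (u (maxn k n)) _ _) _; rewrite addrC lerD//.
  by apply: ur; rewrite leq_maxr.
by rewrite normRBC ltW//; apply: uk; rewrite /= leq_maxl.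
Qed.

Lemma linear_bounded (E F : normedModType R[i]) (e : {linear E -> F}) :
  continuous e -> exists C : R, 0 < C /\ forall x, normR (e x) <= C * normR x.
Proof.
move=> /(_ 0); rewrite /continuous_at linear0 => /cvg_normRP/(_ _ ltr01).
move=> /normR_nbhsP[r r0 er]; exists (2 / r); split; first by rewrite divr_gt0.
move=> x; have [->|x0] := eqVneq x 0; first by rewrite linear0 !normR0 mulr0.
have nx := normR_gt0 x0; pose t := (r / 2 / normR x).
have t0 : 0 < t by rewrite !divr_gt0.
have : normR (e (t%:C *: x) - 0) < 1.
  apply: er; rewrite subr0 normR_scale absC_real gtr0_norm// /t mulfVK ?gt_eqF//.
  exact: half_ltr.
rewrite subr0 linearZ /= normR_scale absC_real gtr0_norm// mulrC -ltr_pdivlMr// => /ltW/le_trans; apply.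
by rewrite div1r /t invf_div mulrC invf_div.
Qed.

Lemma bounded_linear_continuous (E F : normedModType R[i]) (e : {linear E -> F})
  (C : R) : (forall x, normR (e x) <= C * normR x) -> continuous e.
Proof.
move=> eC y; apply/cvg_normRP => r r0; apply/normR_nbhsP.
have [c c0 cP] := small_multiple C r0; exists c => // z zy.
by rewrite -linearB (le_lt_trans (eC _))// cP// normR_ge0 ltW.
Qed.

(** Uniform boundedness on the dual of [E]: the points of [A] act there as evaluations, pointwise
    bounded by hypothesis, and the completeness involved is that of the dual. Hahn-Banach converts a
    bound on evaluations into a bound on norms. *)
Lemma weakly_bounded (E : normedModType R[i]) (A : set E) :
  (forall e : {linear E -> R[i]^o}, continuous e ->
     exists M, forall x, A x -> normR (e x) <= M) ->
  exists M, forall x, A x -> normR x <= M.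
Proof.
move=> Aw.
pose S := [set g : E -> R[i]^o | linear g /\ exists C, forall x, normR (g x) <= C * normR x].
pose B (g : E -> R[i]^o) := [set normR (g x) | x in [set x : E | normR x <= 1]].
pose N (g : E -> R[i]^o) := sup (B g).
have B0 g : B g !=set0 by exists (normR (g 0)), 0 => //=; rewrite normR0.
have supB g : S g -> has_sup (B g).
  move=> [_ [C gC]]; split => //; exists `|C| => _ [x /= x1 <-].
  apply: le_trans (gC x) _; apply: le_trans (_ : `|C| * normR x <= _).
    by rewrite ler_wpM2r ?normR_ge0// ler_norm.
  by rewrite ler_piMr.
have NP g : S g -> forall x, normR (g x) <= N g * normR x.
  move=> Sg x; have [glin _] := Sg.
  pose g_lin := GRing.isLinear.Build _ _ _ _ g glin.
  pose G : {linear E -> R[i]^o} := HB.pack g g_lin.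
  have g0 : g 0 = 0 by exact: (linear0 G).
  have gZ a y : g (a *: y) = a *: g y by rewrite -[a *: y]addr0 glin g0 addr0.
  have [->|x0] := eqVneq x 0; first by rewrite g0 !normR0 mulr0.
  have nx := normR_gt0 x0.
  rewrite -ler_pdivrMr//; apply: sup_upper_bound; first exact: supB.
  exists ((normR x)^-1%:C *: x) => /=.
    by rewrite normR_scale absC_real gtr0_norm ?invr_gt0// mulVf// gt_eqF.
  by rewrite gZ normR_scale absC_real gtr0_norm ?invr_gt0// mulrC.
have N_le g C : 0 <= C -> (forall x, normR (g x) <= C * normR x) -> N g <= C.
  move=> C0 gC; apply: sup_le_ub => // _ [x /= x1 <-].
  by rewrite (le_trans (gC x))// ler_piMr.
have N_ge0 g : S g -> 0 <= N g.
  move=> Sg; apply: le_trans (sup_upper_bound (supB g Sg) _); last first.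
    by exists 0 => //=; rewrite normR0.
  exact: normR_ge0.
have S0 : S 0.
  split; first by move=> a x y; rewrite scaler0 addr0.
  by exists 0 => x; rewrite normR0 mul0r.
have Slin (a : R[i]) g h : S g -> S h -> S (g + a *: h).
  move=> [gl [C gC]] [hl [D hD]]; split.
    move=> b x y; rewrite !fctE gl hl !scalerDr !addrA; congr (_ + _).
    by rewrite addrAC !scalerA [a * b]mulrC.
  exists (C + normR (a : R[i]^o) * D) => x.
  rewrite mulrDl (le_trans (normRD _ _))// lerD// normR_scale -mulrA ler_wpM2l//.
  exact: normR_ge0.
have [||||||||C HC] := @uniform_boundedness _ S N E A (fun x g => normR (g x)) S0 Slin N_ge0.
- apply/eqP; rewrite eq_le N_ge0// andbT N_le// => x.
  by rewrite normR0 mul0r.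
- move=> g h Sg Sh; apply: N_le; first by rewrite addr_ge0// N_ge0.
  by move=> x; rewrite mulrDl (le_trans (normRD _ _))// lerD// NP.
- move=> a g Sg; apply: N_le => [|x]; first by rewrite mulr_ge0// N_ge0.
  by rewrite normR_scale absC_real -mulrA ler_wpM2l// NP.
(* Completeness of the dual: the pointwise limits converge at the rate [r n * normR x], so they are
   linear and inherit the rate [r n] in the dual norm. *)
- move=> u r Su r0 ur.
  have pw x n m : (n <= m)%N -> normR (u m x - u n x) <= r n * normR x.
    move=> nm; have Sd : S (u m - u n) by rewrite -scaleN1r; exact: Slin.
    by rewrite (le_trans (NP _ Sd x))// ler_wpM2r ?normR_ge0// ur.
  have rx0 (x : E) : (fun n => r n * normR x) @ \oo --> 0.
    by rewrite -[X in _ --> X](mul0r (normR x)); apply: cvgMl.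
  have /choice[g gP] (x : E) := banach_cvg_seq (@banach_complex R) (rx0 x) (pw x).
  have gl : linear g.
    move=> a x y; have cx := (gP x).1; have cy := (gP y).1; have cz := (gP (a *: x + y)).1.
    have : (fun n => a *: u n x + u n y) @ \oo --> a *: g x + g y.
      by exact: (@cvg_lin R R[i]^o nat \oo _ a (fun n => u n x) (fun n => u n y) (g x) (g y) cx cy).
    have -> : (fun n => a *: u n x + u n y) = (fun n => u n (a *: x + y)).
      by apply/funext => n; rewrite (Su n).1.
    by move=> cz'; exact: (cvg_unique _ cz cz').
  have r_ge0 n : 0 <= r n.
    have := ur n n (leqnn n); rewrite subrr; apply: le_trans; exact: N_ge0.
  exists g; last by move=> n; apply: N_le => // x; exact: (gP x).2.
  split => //; have [_ [C0 uC]] := Su 0%N; exists (r 0%N + C0) => x.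
  by rewrite -(subrK (u 0%N x) (g x)) (le_trans (normRD _ _))// mulrDl lerD//; exact: (gP x).2.
- by move=> x g h; exact: normRD.
- by move=> x a g; rewrite normR_scale absC_real.
- by move=> x _; exists (normR x) => g Sg; rewrite mulrC NP.
- move=> g [glin [C gC]].
  pose g_lin := GRing.isLinear.Build _ _ _ _ g glin.
  pose G : {linear E -> R[i]^o} := HB.pack g g_lin.
  exact: (Aw G (@bounded_linear_continuous _ _ G C gC)).
(* The factor 2 is the bound on the Hahn-Banach functional. *)
exists (2 * `|C|) => x Ax; have [e [e2 ex]] := hahn_banach x.
have Se : S e by split; [exact: linearP|exists 2].
have N2 : N e <= 2 by apply: N_le.
rewrite (le_trans ex)// (le_trans (HC _ _ Ax Se))// mulrC.
by rewrite (le_trans (ler_norm _))// normrM ler_pM// ger0_norm ?N_ge0.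
Qed.

End UniformBoundedness.

(** * Topologies generated by seminorms *)

Section Seminorms.
Context {R : realType} {X : lmodType R[i]}.
Implicit Types (q p : X -> R) (G : set (X -> R)) (x y z : X).

Lemma seminormZ q (a : R) x : seminorm q -> q (a%:C *: x) = `|a| * q x.
Proof. by move=> [_ qZ]; rewrite qZ -(absC_real a). Qed.

Lemma seminorm0 q : seminorm q -> q 0 = 0.
Proof. by move=> qs; have := seminormZ 0 0 qs; rewrite scaler0 normr0 mul0r. Qed.

Lemma seminormN q x : seminorm q -> q (- x) = q x.
Proof.
by move=> qs; have := seminormZ (-1) x qs; rewrite rmorphN1 scaleN1r normrN1 mul1r.
Qed.

Lemma seminorm_ge0 q x : seminorm q -> 0 <= q x.
Proof.
move=> qs; have := qs.1 x (- x).
by rewrite subrr seminorm0// seminormN// -mulr2n pmulrn_lge0.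
Qed.

Lemma seminormB q x y : seminorm q -> q (x - y) = q (y - x).
Proof. by move=> qs; rewrite -(seminormN _ qs) opprB. Qed.

Lemma seminorm_triangle q y x z : seminorm q -> q (x - z) <= q (x - y) + q (y - z).
Proof. by move=> qs; rewrite (le_trans _ (qs.1 _ _))// addrA subrK. Qed.

Lemma seminorm_dist q x y : seminorm q -> `|q x - q y| <= q (x - y).
Proof.
move=> qs; rewrite ler_norml lerNl opprB !lerBlDr seminormB//.
rewrite (le_trans _ (qs.1 _ _)) ?subrK//= seminormB//.
by rewrite (le_trans _ (qs.1 _ _))// subrK.
Qed.

Lemma seminorm_sum q n (u : nat -> X) : seminorm q ->
  q (\sum_(k < n) u k) <= \sum_(k < n) q (u k).
Proof.
move=> qs; elim/big_ind2 : _ => [|x a y b xa yb|//]; first by rewrite seminorm0.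
by rewrite (le_trans (qs.1 _ _))// lerD.
Qed.

Lemma seminorm_max q p : seminorm q -> seminorm p ->
  seminorm (fun x => Num.max (q x) (p x)).
Proof.
move=> qs ps; split=> [x y|a x].
  by rewrite ge_max !(le_trans (qs.1 _ _), le_trans (ps.1 _ _))//= lerD// le_max lexx ?orbT.
by rewrite /= qs.2 ps.2 maxr_pMr//; exact: (@normR_ge0 R R[i]^o).
Qed.

Lemma seminorm_scale q (c : R) : 0 <= c -> seminorm q -> seminorm (fun x => c * q x).
Proof.
move=> c0 qs; split=> [x y|a x]; first by rewrite -mulrDr ler_wpM2l// qs.1.
by rewrite qs.2 mulrCA.
Qed.

(** The reverse of the third inequality is the same inequality for [a^-1] at [a *: x]. *)
Lemma seminorm_of_le q : (forall x, 0 <= q x) ->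
  (forall x y, q (x + y) <= q x + q y) ->
  (forall (a : R[i]) x, q (a *: x) <= normR (a : R[i]^o) * q x) -> seminorm q.
Proof.
move=> q0 qD qZ; split=> // a x.
apply/eqP; rewrite eq_le; apply/andP; split; first exact: qZ.
have an0 : a = 0 -> complex.Re `|a| = 0 by move=> ->; exact: (@normR0 R R[i]^o).
have [a0|a0] := eqVneq a 0; first by rewrite (an0 a0) mul0r.
have an : 0 < complex.Re `|a| by exact: (@normR_gt0 R R[i]^o a a0).
rewrite -ler_pdivlMl//; have := qZ a^-1 (a *: x).
rewrite scalerA mulVf// scale1r.
suff -> : normR (a^-1 : R[i]^o) = (complex.Re `|a|)^-1 by [].
apply: (mulfI (lt0r_neq0 an)); rewrite mulfV ?gt_eqF//.
by have := absCM (a : R[i]^o) a^-1; rewrite mulfV// /normR normr1 => <-.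
Qed.

Lemma topology_eq (T : choiceType) (s t : topology T) : opens s = opens t -> s = t.
Proof.
by case: s => s s1 s2 s3; case: t => t t1 t2 t3 /= st; subst t;
  congr Topology; exact: Prop_irrelevance.
Qed.

Definition seminorms G := forall q, G q -> seminorm q.

(** [seminorm_open] allows finite families of seminorms; this reduces them to a single one. The
    non-emptiness clause of directedness covers the empty family. *)
Lemma directed_finite G (F : set (X -> R)) : directed_seminorms G -> seminorms G ->
  finite_set F -> F `<=` G -> exists2 r, G r & forall q x, F q -> q x <= r x.
Proof.
move=> [[g Gg] dir] sG /finite_seqP[s ->] {F}.
elim: s => [|p s IH] sG'.
  by exists g => // q x /=.
have [|r Gr rs] := IH.
  by move=> q /= qs; apply: sG'; rewrite /= inE qs orbT.
have [|r' Gr' r'P] := dir p r _ Gr; first by apply: sG'; rewrite /= mem_head.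
exists r' => // q x /=; rewrite inE => /orP[/eqP->|qs]; first exact: (r'P x).1.
by rewrite (le_trans (rs _ _ _))//; exact: (r'P x).2.
Qed.

Lemma seminorm_open_ball G q x (e : R) : seminorms G -> G q -> 0 < e ->
  opens (seminorm_topology G) [set y | q (y - x) < e].
Proof.
move=> sG Gq e0 y /= ye; exists [set q], (e - q (y - x)); split.
- exact: finite_set1.
- by move=> _ ->.
- by rewrite subr_gt0.
- move=> z /(_ q erefl); rewrite ltrBrDr; apply: le_lt_trans.
  exact/seminorm_triangle/sG.
Qed.

Lemma nbhs_seminormP G x (U : set X) : directed_seminorms G -> seminorms G ->
  nbhs (x : top_space (seminorm_topology G)) U <->
  exists q, exists2 e : R, G q /\ 0 < e & forall y, q (y - x) < e -> U y.
Proof.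
move=> dG sG; split=> [|[q [e [Gq e0] qU]]].
  rewrite nbhsE => -[V [oV Vx] VU].
  have [F [e [finF FG e0 FV]]] := oV _ Vx.
  have [r Gr Fr] := directed_finite dG sG finF FG.
  exists r, e => // y ye; apply: VU; apply: FV => q Fq.
  exact: le_lt_trans (Fr _ _ Fq) _.
rewrite nbhsE; exists [set y | q (y - x) < e] => //; split.
  exact: seminorm_open_ball.
by rewrite /= subrr seminorm0//; exact: sG.
Qed.

Lemma continuous_seminorm G q : directed_seminorms G -> seminorms G -> G q ->
  continuous (q : top_space (seminorm_topology G) -> R).
Proof.
move=> dG sG Gq x U /nbhs_ballP[e /= e0 eU]; apply/nbhs_seminormP => //.
exists q, e => // y ye; apply: eU; rewrite -ball_normE/= distrC.
by apply: le_lt_trans ye; exact/seminorm_dist/sG.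
Qed.

Lemma seminorm_topology_linear G : directed_seminorms G -> seminorms G ->
  linear_topology (seminorm_topology G).
Proof.
move=> dG sG; split=> [[x y]|[a x]] U /= /nbhs_seminormP-/(_ dG sG)[q [e [Gq e0] qU]].
  have B z : nbhs (z : top_space (seminorm_topology G)) [set z' | q (z' - z) < e / 2].
    by apply/nbhs_seminormP => //; exists q, (e / 2) => //; split => //; rewrite divr_gt0.
  exists ([set x' | q (x' - x) < e / 2], [set y' | q (y' - y) < e / 2]).
    by split; exact: B.
  move=> [x' y'] /= [xx yy]; apply: qU.
  rewrite opprD addrACA (le_lt_trans ((sG _ Gq).1 _ _))//.
  by rewrite [e](splitr e) ltrD.
have qs := sG _ Gq.
pose A := normR (a : R[i]^o); have A0 : 0 <= A by exact: normR_ge0.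
have qx0 := seminorm_ge0 x qs.
pose d := Num.min 1 (e / 2 / (q x + 1)).
have d0 : 0 < d by rewrite lt_min ltr01 !divr_gt0// ltr_wpDl.
pose r := e / 2 / (A + 1).
have r0 : 0 < r by rewrite !divr_gt0// ltr_wpDl.
exists ([set b : R[i]^o | normR (b - a) < d], [set y | q (y - x) < r]).
  split; first by apply/normR_nbhsP; exists d.
  by apply/nbhs_seminormP => //; exists q, r.
(* With [b y - a x = b (y - x) + (b - a) x] each term takes half of [e]; the bound 1 in [d] keeps
   the absolute value of [b] below [A + 1]. *)
move=> [b y] /= [ba yx]; apply: qU.
have -> : b *: y - a *: x = b *: (y - x) + (b - a) *: x.
  by rewrite scalerBr scalerBl addrA subrK.
have -> : e = (A + 1) * r + (q x + 1) * (e / 2 / (q x + 1)).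
  rewrite /r [(A + 1) * _]mulrC [(q x + 1) * _]mulrC !mulfVK -?splitr// gt_eqF// ltr_wpDl//.
rewrite (le_lt_trans (qs.1 _ _))// !qs.2 ltr_leD//.
  apply: (@le_lt_trans _ _ ((A + 1) * q (y - x))); last first.
    by rewrite ltr_pM2l// ltr_wpDl.
  rewrite ler_wpM2r ?seminorm_ge0//.
  rewrite -[b](subrK a) addrC (le_trans (normRD (a : R[i]^o) _))// lerD//.
  by rewrite ltW// (lt_le_trans ba)// ge_min lexx.
rewrite mulrC ler_pM//; first exact: (@normR_ge0 R R[i]^o).
  by rewrite lerDl.
by rewrite ltW// (lt_le_trans ba)// ge_min lexx orbT.
Qed.

(** The weights of [conv] are elements of [R[i]] between 0 and 1, hence real. *)
Lemma convE (Y : lmodType R[i]) (x y : convex_lmodType Y) (l : {i01 R[i]}) : exists t : R,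
  [/\ 0 <= t, t <= 1 & conv l x y = t%:C *: (x : Y) + (1 - t)%:C *: (y : Y)].
Proof.
have l0 : 0 <= l%:num by [].
have l1 : l%:num <= 1 by [].
exists (complex.Re l%:num).
have lE : l%:num = (complex.Re l%:num)%:C.
  by move: l0; rewrite lecE /= => /andP[/eqP + _]; case: (l%:num) => a b /= ->.
split; [by rewrite -lecR -lE|by rewrite -lecR -lE|].
by rewrite rmorphB /= -lE.
Qed.

Lemma seminorm_topology_locally_convex G : directed_seminorms G -> seminorms G ->
  locally_convex_topology (seminorm_topology G).
Proof.
move=> dG sG; split; first exact: seminorm_topology_linear.
exists [set b | exists x q (e : R), [/\ G q, 0 < e & b = [set y | q (y - x) < e]]].
  move=> b; rewrite inE => -[x [q [e [Gq e0 ->]]]] y z l.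
  rewrite !inE => yx zx.
  have [t [t0 t1 ->]] := @convE (top_space (seminorm_topology G)) y z l.
  change (q (t%:C *: (y : X) + (1 - t)%:C *: (z : X) - x) < e).
  have qs := sG _ Gq.
  have -> : t%:C *: (y : X) + (1 - t)%:C *: (z : X) - x =
      t%:C *: (y - x) + (1 - t)%:C *: (z - x) :> X.
    rewrite !scalerBr addrACA -opprD -scalerDl -rmorphD /=.
    by rewrite addrCA subrr addr0 scale1r.
  rewrite (le_lt_trans (qs.1 _ _))// !seminormZ// ger0_norm// ger0_norm ?subr_ge0//.
  have [->|t1'] := eqVneq t 1; first by rewrite subrr mul0r addr0 mul1r.
  have : (1 - t) * q (z - x) < (1 - t) * e.
    by rewrite ltr_pM2l// subr_gt0 lt_neqAle t1'.
  have : t * q (y - x) <= t * e by rewrite ler_wpM2l// ltW.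
  by move=> h1 h2; rewrite (lt_le_trans (ler_ltD h1 h2))// -mulrDl addrCA subrr addr0 mul1r.
split=> [_ [x [q [e [Gq e0 ->]]]]|x U].
  exact: (@seminorm_open_ball G q x e sG Gq e0).
move=> /nbhs_seminormP-/(_ dG sG)[q [e [Gq e0] qU]].
exists [set y | q (y - x) < e] => //; split; first by exists x, q, e.
by rewrite /= subrr seminorm0//; exact: sG.
Qed.

Lemma seminorm_topology_hausdorff G : directed_seminorms G -> seminorms G ->
  (forall x, (forall q, G q -> q x = 0) -> x = 0) ->
  hausdorff_space (top_space (seminorm_topology G)).
Proof.
move=> dG sG G0 x y xy; apply/eqP; rewrite -subr_eq0; apply/eqP.
apply: G0 => q Gq; apply/eqP; rewrite eq_le seminorm_ge0 ?andbT; last exact: sG.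
rewrite leNgt; apply/negP => r0.
have B z : nbhs (z : top_space (seminorm_topology G)) [set z' | q (z' - z) < q (x - y) / 2].
  by apply/nbhs_seminormP => //; exists q, (q (x - y) / 2) => //; split => //; rewrite divr_gt0.
have [z /= [zx zy]] := xy _ _ (B x) (B y).
have := seminorm_triangle z x y (sG _ Gq); rewrite (seminormB _ z); last exact: sG.
by rewrite leNgt [ltRHS](splitr (q _)) ltrD.
Qed.

Lemma seminorm_topology_le G G' : directed_seminorms G' -> seminorms G' ->
  directed_seminorms G -> seminorms G ->
  (forall q, G q -> exists2 p, G' p & forall e, 0 < e -> exists2 d, 0 < d &
     forall x, p x < d -> q x < e) ->
  opens (seminorm_topology G) `<=` opens (seminorm_topology G').
Proof.
move=> dG' sG' dG sG GG' U oU x Ux.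
have [F [e [finF FG e0 FU]]] := oU x Ux.
have [r Gr Fr] := directed_finite dG sG finF FG.
have [p Gp /(_ e e0)[d d0 pr]] := GG' _ Gr.
exists [set p], d; split => //; first by move=> _ ->.
move=> y py; apply: FU => q Fq; apply: le_lt_trans (Fr _ _ Fq) _.
by apply: pr; exact: py.
Qed.

End Seminorms.

(** * The mixed topology *)

Section InfimalConvolution.
Context {R : realType} {X : lmodType R[i]} (s : nat -> X -> R).
Hypothesis s_seminorm : forall k, seminorm (s k).

Definition decompositions (x : X) : set R :=
  [set c | exists (n : nat) (u : nat -> X),
    x = \sum_(k < n) u k /\ c = \sum_(k < n) s k (u k)].

(** The largest seminorm lying below every [s k]. *)
Definition infconv (x : X) : R := inf (decompositions x).

Lemma decompositions_ge0 x : lbound (decompositions x) 0.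
Proof.
by move=> _ [n [u [_ ->]]]; rewrite sumr_ge0// => i _; exact: seminorm_ge0.
Qed.

Lemma decompositions_single k x : decompositions x (s k x).
Proof.
exists k.+1, (fun j => if j == k then x else 0); split.
  by rewrite big_ord_recr/= eqxx big1 ?add0r// => i _; rewrite ltn_eqF.
rewrite big_ord_recr/= eqxx big1 ?add0r// => i _; rewrite ltn_eqF//.
exact: seminorm0.
Qed.

Lemma has_inf_decompositions x : has_inf (decompositions x).
Proof.
split; first by exists (s 0%N x); exact: decompositions_single.
by exists 0; exact: decompositions_ge0.
Qed.

(** Padding by zeros gives two decompositions a common length, so that they can be added
    termwise. *)
Lemma decompositions_pad x c : decompositions x c -> exists N, forall m, (N <= m)%N ->
  exists u : nat -> X, x = \sum_(k < m) u k /\ c = \sum_(k < m) s k (u k).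
Proof.
move=> [n [u [-> ->]]]; exists n => m nm.
exists (fun k => if (k < n)%N then u k else 0).
rewrite -(subnKC nm) !big_split_ord /=; split.
  rewrite [X in _ + X]big1 ?addr0 => [|i _]; last by rewrite ltnNge leq_addr.
  by apply: eq_bigr => i _; rewrite ltn_ord.
rewrite [X in _ + X]big1 ?addr0 => [|i _]; last by rewrite ltnNge leq_addr /= seminorm0.
by apply: eq_bigr => i _; rewrite ltn_ord.
Qed.

Lemma infconv_le k x : infconv x <= s k x.
Proof.
apply: ge_inf; last exact: decompositions_single.
by exists 0; exact: decompositions_ge0.
Qed.

Lemma infconv_lt x c : infconv x < c -> exists N, forall m, (N <= m)%N ->
  exists u : nat -> X, x = \sum_(k < m) u k /\ \sum_(k < m) s k (u k) < c.
Proof.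
move=> xc; have := inf_adherent (_ : 0 < c - infconv x) (has_inf_decompositions x).
rewrite subr_gt0 => /(_ xc)[a /decompositions_pad[N xN]].
rewrite /infconv addrC subrK => ac.
by exists N => m /xN[u [xu au]]; exists u; rewrite -au.
Qed.

Lemma infconv_seminorm : seminorm infconv.
Proof.
apply: seminorm_of_le => [x|x y|a x].
- apply: lb_le_inf; last exact: decompositions_ge0.
  exact: (has_inf_decompositions _).1.
- apply/ler_addgt0Pr => e e0.
  have [|N xN] := @infconv_lt x (infconv x + e / 2); first by rewrite ltrDl divr_gt0.
  have [|M yM] := @infconv_lt y (infconv y + e / 2); first by rewrite ltrDl divr_gt0.
  have [u [xu ue]] := xN _ (leq_maxl N M).
  have [w [yw we]] := yM _ (leq_maxr N M).
  rewrite [e]splitr addrACA; apply: le_trans (lerD (ltW ue) (ltW we)).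
  rewrite -big_split /=.
  apply: (@le_trans _ _ (\sum_(k < maxn N M) s k (u k + w k))).
    apply: ge_inf; first by exists 0; exact: decompositions_ge0.
    by exists (maxn N M), (fun k => u k + w k); rewrite big_split /= -xu -yw.
  by apply: ler_sum => i _; exact: (s_seminorm i).1.
- set b := normR _; have b0 : 0 <= b by exact: normR_ge0.
  apply/ler_addgt0Pr => e e0.
  have [c c0 cP] := small_multiple b e0.
  have [|N /(_ N (leqnn N))[u [xu ue]]] := @infconv_lt x (infconv x + c).
    by rewrite ltrDl.
  apply: (@le_trans _ _ (\sum_(k < N) s k (a *: u k))).
    apply: ge_inf; first by exists 0; exact: decompositions_ge0.
    by exists N, (fun k => a *: u k); rewrite xu scaler_sumr.
  have -> : \sum_(k < N) s k (a *: u k) = b * \sum_(k < N) s k (u k).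
    by rewrite mulr_sumr; apply: eq_bigr => i _; rewrite (s_seminorm i).2.
  by apply: le_trans (ler_wpM2l b0 (ltW ue)) _; rewrite mulrDr lerD2l ltW// cP// lexx ltW.
Qed.

End InfimalConvolution.

Section MixedTopology.
Context {R : realType} {X : lmodType R[i]}.
Variables (nm : X -> R) (Gamma : set (X -> R)).
Hypothesis nm_seminorm : seminorm nm.
Hypothesis sG : seminorms Gamma.
Hypothesis dG : directed_seminorms Gamma.
Hypothesis G_le : forall p x, Gamma p -> p x <= nm x.
Local Notation tau := (seminorm_topology Gamma).
Implicit Types (q r p : X -> R) (x y z : X).

(** These are the [tau]-continuous seminorms, in a form that refers to [Gamma] only. *)
Definition dominated q : Prop := seminorm q /\
  forall e : R, 0 < e -> exists p, exists2 d : R, Gamma p /\ 0 < d &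
    forall x, p x < d -> q x < e.

Definition mixed_seminorms : set (X -> R) := [set q | seminorm q /\
  forall M e : R, 0 < e -> exists p, exists2 d : R, Gamma p /\ 0 < d &
    forall x, nm x <= M -> p x < d -> q x < e].

Definition mixed_topology := seminorm_topology mixed_seminorms.

Lemma directed_ball p p' (d d' : R) : Gamma p -> Gamma p' -> 0 < d -> 0 < d' ->
  exists g, exists2 r : R, Gamma g /\ 0 < r & forall x, g x < r -> p x < d /\ p' x < d'.
Proof.
move=> Gp Gp' d0 d'0; have [g Gg gP] := dG.2 _ _ Gp Gp'.
exists g, (Num.min d d'); first by rewrite lt_min d0.
by move=> x; rewrite lt_min => /andP[]; split; apply: le_lt_trans (_ : _ <= g x) _ => //; have [] := gP x.
Qed.

Lemma dominated_max q r : dominated q -> dominated r ->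
  dominated (fun x => Num.max (q x) (r x)).
Proof.
move=> [qs qd] [rs rd]; split=> [|e e0]; first exact: seminorm_max.
have [p [d [Gp d0] pq]] := qd e e0; have [p' [d' [Gp' d'0] pr]] := rd e e0.
have [g [c Gg gP]] := directed_ball Gp Gp' d0 d'0; exists g, c => // x /gP[px p'x].
by rewrite gt_max pq ?pr.
Qed.

Lemma dominated_scale q (c : R) : 0 <= c -> dominated q -> dominated (fun x => c * q x).
Proof.
move=> c0 [qs qd]; split=> [|e e0]; first exact: seminorm_scale.
have [r r0 rP] := small_multiple c e0; have [p [d [Gp d0] pq]] := qd r r0.
by exists p, d => // x /pq qr; rewrite rP// seminorm_ge0//= ltW.
Qed.

Lemma dominated_Gamma p : Gamma p -> dominated p.
Proof. by move=> Gp; split=> [|e e0]; [exact: sG|exists p, e]. Qed.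

Lemma dominated_mixed q : dominated q -> mixed_seminorms q.
Proof.
move=> [qs qd]; split=> // M e /qd[p [d [Gp d0] pq]].
by exists p, d => // x _; exact: pq.
Qed.

Lemma mixed_seminormsP : seminorms mixed_seminorms.
Proof. by move=> q []. Qed.

Lemma mixed_directed : directed_seminorms mixed_seminorms.
Proof.
split.
  by have [p Gp] := dG.1; exists p; exact/dominated_mixed/dominated_Gamma.
move=> q r [qs qd] [rs rd]; exists (fun x => Num.max (q x) (r x)); last first.
  by move=> x; rewrite !le_max !lexx orbT.
split=> [|M e e0]; first exact: seminorm_max.
have [p [d [Gp d0] pq]] := qd M e e0; have [p' [d' [Gp' d'0] pr]] := rd M e e0.
have [g [c Gg gP]] := directed_ball Gp Gp' d0 d'0; exists g, c => // x xM /gP[px p'x].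
by rewrite gt_max pq ?pr.
Qed.

Lemma nbhs_mixedP x (U : set X) : nbhs (x : top_space mixed_topology) U <->
  exists q, exists2 e : R, mixed_seminorms q /\ 0 < e & forall y, q (y - x) < e -> U y.
Proof. exact: (nbhs_seminormP _ _ mixed_directed mixed_seminormsP). Qed.

Lemma tau_sub_mixed : opens tau `<=` opens mixed_topology.
Proof.
apply: seminorm_topology_le => //; first exact: mixed_directed.
  exact: mixed_seminormsP.
move=> q Gq; exists q; first exact/dominated_mixed/dominated_Gamma.
by move=> e e0; exists e.
Qed.

Lemma mixed_small_norm q e : mixed_seminorms q -> 0 < e ->
  exists2 d : R, 0 < d & forall x, nm x < d -> q x < e.
Proof.
move=> [qs /(_ 1 e)qd] e0; have [p [d [Gp d0] pq]] := qd e0.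
exists (Num.min 1 d); first by rewrite lt_min ltr01.
move=> x; rewrite lt_min => /andP[x1 xd]; apply: pq; first exact: ltW.
by rewrite (le_lt_trans (G_le _ Gp)).
Qed.

Lemma mixed_sub_norm : opens mixed_topology `<=` opens (norm_topology nm).
Proof.
apply: seminorm_topology_le => //.
- split; first by exists nm.
  by move=> p q -> ->; exists nm => // x; rewrite lexx.
- by move=> q ->.
- exact: mixed_directed.
- exact: mixed_seminormsP.
move=> q mq; exists nm => // e e0.
exact: mixed_small_norm.
Qed.

Lemma mixed_coincide : coincide_on_bounded nm tau mixed_topology.
Proof.
move=> B M BM; apply/seteqP; split; last first.
  by move=> _ [A oA <-]; exists A => //; exact: tau_sub_mixed.
move=> _ [A oA <-].
(* The union of all [tau]-balls whose trace on [B] lies in [A]; it remains to see that every point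
   of [A] in [B] has such a ball around it. *)
exists [set y | exists x p d, [/\ Gamma p, 0 < d, p (y - x) < d &
    forall z, p (z - x) < d -> B z -> A z]].
  move=> y [x [p [d [Gp d0 yx xA]]]]; exists [set p], (d - p (y - x)); split.
  - exact: finite_set1.
  - by move=> _ ->.
  - by rewrite subr_gt0.
  move=> z /(_ p erefl); rewrite ltrBrDr => zy; exists x, p, d; split=> //.
  by rewrite (le_lt_trans _ zy)//; exact/seminorm_triangle/sG.
apply/seteqP; split=> y [] => [[x [p [d [Gp d0 yx xA]]]] By|Ay By].
  by split => //; exact: xA.
split => //.
have : nbhs (y : top_space mixed_topology) A.
  by rewrite nbhsE; exists A.
move=> /nbhs_mixedP[q [e [[qs qd] e0] qA]].
(* Differences of two points of [B] have norm at most [M + M]. *)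
have [p [d [Gp d0] pq]] := qd (M + M) e e0.
exists y, p, d; split => //; first by rewrite subrr seminorm0//; exact: sG.
move=> z zy Bz; apply: qA; apply: pq => //.
by rewrite (le_trans (nm_seminorm.1 _ _))// seminormN// lerD// BM.
Qed.

Lemma mixed_mixed_candidate : mixed_candidate nm tau mixed_topology.
Proof.
split.
- exact: (seminorm_topology_linear mixed_directed mixed_seminormsP).
- exact: mixed_coincide.
- exact: tau_sub_mixed.
- exact: mixed_sub_norm.
Qed.

(* The seminorm form of the neighbourhoods sum_k (U_k cap (k + 1) B) of 0, where B is the unit ball. *)
Definition mixed_sum (r : nat -> X -> R) :=
  infconv (fun k x => Num.max (r k x) (nm x / k.+1%:R)).

Lemma mixed_sum_seminorms (r : nat -> X -> R) : (forall k, dominated (r k)) ->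
  forall k, seminorm (fun x => Num.max (r k x) (nm x / k.+1%:R)).
Proof.
move=> rd k; apply: seminorm_max; first exact: (rd k).1.
have -> : (fun x => nm x / k.+1%:R) = (fun x => k.+1%:R^-1 * nm x).
  by apply/funext => x; rewrite mulrC.
exact: seminorm_scale.
Qed.

(** The infimal convolution lies below each of its members, and on the ball of radius [M] a member
    with [M / k.+1 < e] is small as soon as [r k] is. *)
Lemma mixed_sum_mixed (r : nat -> X -> R) : (forall k, dominated (r k)) -> mixed_seminorms (mixed_sum r).
Proof.
move=> rd; have ss := mixed_sum_seminorms rd; split=> [|M e e0].
  exact: infconv_seminorm.
pose k := Num.bound (`|M| / e).
have kM : M / k.+1%:R < e.
  rewrite ltr_pdivrMr// mulrC -ltr_pdivrMr//.
  apply: (@le_lt_trans _ _ (`|M| / e)).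
    by rewrite ler_pM2r ?invr_gt0// ler_norm.
  apply: lt_trans (archi_boundP _) _; first by rewrite divr_ge0// ltW.
  by rewrite ltr_nat.
have [p [d [Gp d0] pr]] := (rd k).2 e e0; exists p, d => // x xM xd.
apply: le_lt_trans (infconv_le ss k x) _; rewrite gt_max pr//=.
by apply: le_lt_trans kM; rewrite ler_pM2r ?invr_gt0.
Qed.

(** Both entries of the maximum are used: [r k] puts [u k] into the k-th [tau]-neighbourhood, the
    other entry into the ball of radius [k.+1]. All large lengths are offered, so that the sum can
    be split at a prescribed index. *)
Lemma mixed_sum_lt (r : nat -> X -> R) x : (forall k, dominated (r k)) -> mixed_sum r x < 1 ->
  exists N, forall n, (N <= n)%N -> exists u : nat -> X,
    [/\ x = \sum_(k < n) u k, \sum_(k < n) r k (u k) < 1,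
       forall k, (k < n)%N -> r k (u k) < 1 &
       forall k, (k < n)%N -> nm (u k) < k.+1%:R].
Proof.
move=> rd; have ss := mixed_sum_seminorms rd.
move=> /(infconv_lt ss)[N xN]; exists N => n /xN[u [xu u1]]; exists u.
have le1 k : (k < n)%N -> Num.max (r k (u k)) (nm (u k) / k.+1%:R) < 1.
  move=> kn; apply: le_lt_trans u1; rewrite (bigD1 (Ordinal kn))//= lerDl.
  by apply: sumr_ge0 => i _; exact: (seminorm_ge0 _ (ss i)).
split => //.
- by apply: le_lt_trans u1; apply: ler_sum => i _; rewrite le_max lexx.
- by move=> k /le1; rewrite gt_max => /andP[].
- by move=> k /le1; rewrite gt_max ltr_pdivrMr// mul1r => /andP[].
Qed.

End MixedTopology.

(** * Universal property, Cauchy filters and C-sequentiality of the mixed topology *)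

Section MixedUniversal.
Context {R : realType} {X : lmodType R[i]}.
Variables (nm : X -> R) (Gamma : set (X -> R)).
Hypothesis nm_seminorm : seminorm nm.
Hypothesis sG : seminorms Gamma.
Hypothesis dG : directed_seminorms Gamma.
Hypothesis G_le : forall p x, Gamma p -> p x <= nm x.
Local Notation tau := (seminorm_topology Gamma).
Local Notation mixed := (mixed_topology nm Gamma).
Implicit Types (q r p : X -> R) (x y z : X).

Lemma dominated_ball p (d : R) : Gamma p -> 0 < d ->
  exists2 r, dominated Gamma r & forall x, r x < 1 -> p x < d.
Proof.
move=> Gp d0; exists (fun x => d^-1 * p x).
  by apply: dominated_scale => //; [rewrite invr_ge0 ltW|exact: dominated_Gamma].
by move=> x; rewrite mulrC ltr_pdivrMr// mul1r.
Qed.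

Section CandidateNbhs.
Variables (sigma : topology X) (V : nat -> set X).
Hypothesis sigma_linear : linear_topology sigma.

Lemma linear_topology_half (W : set X) : nbhs (0 : top_space sigma) W ->
  exists2 W' : set X, nbhs (0 : top_space sigma) W' & forall x y, W' x -> W' y -> W (x + y).
Proof.
move=> W0; have := sigma_linear.1 (0, 0) W; rewrite /= addr0 => /(_ W0).
move=> [[A B] /= [A0 B0] AB]; exists (A `&` B); first exact: filterI.
by move=> x y [Ax _] [_ By]; exact: (AB (x, y)).
Qed.

(** Without its first term the sum has the same shape with [m] raised by one, so it lies in
    [V m.+1], and one halving absorbs the first term. *)
Lemma sum_of_halves (u : nat -> X) n m :
  (forall k, V k 0) ->
  (forall k x y, V k.+1 x -> V k.+1 y -> V k (x + y)) ->
  (forall k, (k < n)%N -> V (m + k).+1 (u k)) ->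
  V m (\sum_(k < n) u k).
Proof.
move=> V0 VD; elim: n m u => [|n IH] m u uV; first by rewrite big_ord0.
rewrite big_ord_recl; apply: VD.
  by have := uV 0%N isT; rewrite addn0.
apply: (IH m.+1 (fun k => u k.+1)) => k kn; have := uV k.+1; rewrite addnS -addSn; exact.
Qed.

End CandidateNbhs.

(** Halving the translate of [U] by [x] gives the sets [V k]. On the ball of radius [k.+1] the
    candidate agrees with [tau], so some [r k] forces membership in [V k.+1] there. Decompositions
    of small [mixed_sum] then consist of terms in the sets [V k.+1], and their sums stay in
    [V 0]. *)
Lemma mixed_finest sigma : mixed_candidate nm tau sigma -> opens sigma `<=` opens mixed.
Proof.
move=> [slin scoi _ _] U oU x Ux.
(* Choice needs a total function; on sets that are not neighbourhoods of 0 the value of [half] is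
   irrelevant. *)
have /choice[half halfP] (W : set X) : exists W' : set X, nbhs (0 : top_space sigma) W ->
    nbhs (0 : top_space sigma) W' /\ forall x y, W' x -> W' y -> W (x + y).
  have [W0|W0] := pselect (nbhs (0 : top_space sigma) W); last by exists W.
  by have [W' ? ?] := linear_topology_half slin W0; exists W'.
pose V n := iter n half [set y | U (x + y)].
have V_nbhs n : nbhs (0 : top_space sigma) (V n).
  elim: n => [|n IH]; last exact: (halfP _ IH).1.
  have := slin.1 (x, 0) U; rewrite /= addr0.
  have Unbhs : nbhs (x : top_space sigma) U by rewrite nbhsE; exists U.
  move=> /(_ Unbhs)[[A B] /= [Ax B0] AB]; apply: filterS B0 => y By.
  by apply: (AB (x, y)); split => //; exact: nbhs_singleton Ax.
have VD n y z : V n.+1 y -> V n.+1 z -> V n (y + z) by exact: (halfP _ (V_nbhs n)).2.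
have /choice[r rP] (k : nat) : exists r, dominated Gamma r /\
    forall y, nm y <= k.+1%:R -> r y < 1 -> V k.+1 y.
  have := V_nbhs k.+1; rewrite nbhsE => -[W [oW W0] WV].
  (* The traces on this ball coincide, so the [sigma]-open set [W] can be traded for a [tau]-open
     [A]. *)
  pose B : set X := [set y | nm y <= k.+1%:R].
  have : [set A `&` B | A in opens sigma] (W `&` B) by exists W.
  rewrite (scoi B k.+1%:R)// => -[A oA AB].
  have A0 : A 0.
    suff : (A `&` B) 0 by case.
    by rewrite AB; split => //; rewrite /B /= seminorm0.
  have : nbhs (0 : top_space tau) A by rewrite nbhsE; exists A.
  move=> /(nbhs_seminormP _ _ dG sG)[p [d [Gp d0] pA]].
  have [r rd rp] := dominated_ball Gp d0; exists r; split=> // y yk ry.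
  apply: WV; suff : (W `&` B) y by case.
  by rewrite -AB; split=> //; apply: pA; rewrite subr0; exact: rp.
have rd k := (rP k).1.
exists [set mixed_sum nm r], 1; split => //.
  move=> _ ->; exact: (mixed_sum_mixed nm_seminorm rd).
move=> y /(_ _ erefl) /(mixed_sum_lt nm_seminorm rd)[N /(_ N (leqnn N))[u [yu _ u1 uk]]].
suff : V 0%N (y - x) by rewrite /V /= addrC subrK.
rewrite yu; apply: sum_of_halves => //.
  by move=> k; exact: nbhs_singleton (V_nbhs k).
move=> k kN; rewrite add0n; apply: (rP k).2; last exact: u1.
exact/ltW/uk.
Qed.

Lemma mixed_topologyP : is_mixed_topology nm tau mixed.
Proof.
split; first exact: mixed_mixed_candidate.
by move=> sigma; exact: mixed_finest.
Qed.

(* The mixed topology has a basis of tau-closed neighbourhoods of 0. *)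
Lemma mixed_cauchy_cvg (F : set_system X) (x : X) : ProperFilter F ->
  (forall U : set (top_space mixed), nbhs (0 : top_space mixed) U ->
      exists2 A, F A & forall x y, A x -> A y -> U (x - y)) ->
  (F : set_system (top_space tau)) --> (x : top_space tau) ->
  (F : set_system (top_space mixed)) --> (x : top_space mixed).
Proof.
move=> FF cF Fx U /(nbhs_mixedP nm sG dG)[q [e [mq e0] qU]].
have [qs qd] := mq.
(* [c m] is made to bound the norm of the remainder below: [m] accounts for [g - x] and [m * m.+1]
   for the first m terms of the decomposition. *)
pose c (k : nat) : R := k%:R + k%:R * k.+1%:R + 1.
have epos (k : nat) : 0 < e / 2 ^+ k.+1 by rewrite divr_gt0// exprn_gt0.
have /choice[p pP] (k : nat) : exists r, dominated Gamma r /\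
    forall y, nm y <= c k + k.+1%:R -> r y < 2 -> q y < e / 2 ^+ k.+1.
  have [p [d [Gp d0] pq]] := qd (c k + k.+1%:R) _ (epos k).
  have [|r rd rp] := @dominated_ball p (d / 2) Gp; first by rewrite divr_gt0.
  exists r; split=> // y yc r2; apply: pq => //.
  have : r ((2^-1 : R)%:C *: y) < 1.
    rewrite seminormZ; last exact: rd.1.
    by rewrite ger0_norm ?invr_ge0// mulrC ltr_pdivrMr// mul1r.
  move=> /rp; rewrite seminormZ; last exact: sG.
  by rewrite ger0_norm ?invr_ge0// mulrC ltr_pM2r ?invr_gt0.
(* Running maxima: in an increasing sequence, [r m] controls every term of index at least [m]. *)
pose r := fix r k := if k is j.+1 then (fun y => Num.max (r j y) (p k y)) else p 0%N.
have rd k : dominated Gamma (r k).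
  elim: k => [|k IH]; first exact: (pP 0%N).1.
  by apply: dominated_max => //; exact: (pP k.+1).1.
have pr k y : p k y <= r k y by case: k => // k /=; rewrite le_max lexx orbT.
have r_mono k j y : (k <= j)%N -> r k y <= r j y.
  move=> kj; rewrite -(subnKC kj); elim: (j - k)%N => [|i IH]; first by rewrite addn0.
  by rewrite addnS /= le_max IH.
have rq k y : nm y <= c k + k.+1%:R -> r k y < 2 -> q y < e / 2 ^+ k.+1.
  by move=> yc ry; apply: (pP k).2 => //; exact: le_lt_trans (pr _ _) ry.
have mQ := mixed_sum_mixed nm_seminorm rd.
have : nbhs (0 : top_space mixed) [set y | mixed_sum nm r y < 1].
  apply/(nbhs_mixedP nm sG dG); exists (mixed_sum nm r), 1 => //.
  by move=> y; rewrite subr0.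
(* The whole of [A] lies in [U]: for [g] in [A], first [m] is chosen from the norm of [g - x], then
   [h] in [A] with [r m (h - x) < 1]. The decomposition of [g - h] is split at [m]. *)
move=> /cF[A FA AP]; apply: (filterS _ FA) => g Ag; apply: qU.
pose m := Num.bound (nm (g - x)).
have gm : nm (g - x) < m%:R by apply: archi_boundP; exact: seminorm_ge0.
clearbody m.
have : nbhs (x : top_space tau) [set y | r m (y - x) < 1].
  have [p' [d [Gp' d0] p'r]] := (rd m).2 1 ltr01.
  apply/(nbhs_seminormP _ _ dG sG); exists p', d => // z zd.
  exact: p'r.
move=> /Fx Fr; have [h [Ah hx]] := filter_ex (filterI FA Fr).
have [N /(_ _ (leq_maxl N m))] := mixed_sum_lt nm_seminorm rd (AP _ _ Ag Ah).
rewrite -(subnKC (leq_maxr N m)); set j := (_ - m)%N => -[u [ghu u1 uk nmu]].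
move: ghu u1; rewrite !big_split_ord /=.
set s1 := \sum_(i < m) u i; set s2 := \sum_(i < j) _.
set t1 := \sum_(i < m) _; set t2 := \sum_(i < j) _ => ghu t12.
have t1_ge0 : 0 <= t1 by apply: sumr_ge0 => i _; exact: (seminorm_ge0 _ (rd i).1).
have gx : g - x = s1 + (s2 + (h - x)) by rewrite addrA -ghu addrA subrK.
have rest_r : r m (s2 + (h - x)) < 2.
  rewrite (le_lt_trans ((rd m).1.1 _ _))// -[2](@natrD R 1 1) ltrD//.
  apply: (@le_lt_trans _ _ t2); last by apply: le_lt_trans t12; rewrite lerDr.
  rewrite (le_trans (seminorm_sum j (fun i => u (m + i)%N) (rd m).1))//.
  by apply: ler_sum => i _; apply: r_mono; rewrite leq_addr.
have s1_nm : nm s1 <= m%:R * m.+1%:R.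
  rewrite (le_trans (seminorm_sum _ _ nm_seminorm))//.
  apply: (@le_trans _ _ (\sum_(i < m) m.+1%:R)); last first.
    by rewrite sumr_const card_ord mulr_natl.
  apply: ler_sum => i _; apply: ltW; apply: lt_le_trans (nmu i _) _.
    by rewrite (leq_trans (ltn_ord i))// leq_addr.
  by rewrite ler_nat ltnS ltnW.
(* The norm of [h - x] is not controlled; the remainder is bounded as the difference of [g - x] and
   [s1]. *)
have rest_nm : nm (s2 + (h - x)) <= c m + m.+1%:R.
  have -> : s2 + (h - x) = (g - x) - s1 by rewrite gx addrAC subrr add0r.
  rewrite (le_trans (nm_seminorm.1 _ _))// seminormN// /c.
  have : 0 <= m.+1%:R :> R by [].
  move: (ltW gm) s1_nm; set a := nm _; set b := nm _; set d := m%:R * _; set f := m%:R; set f' := m.+1%:R; lra.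
have s1_q : q s1 <= e * (1 - 2^-1 ^+ m).
  rewrite (le_trans (seminorm_sum _ _ qs))//.
  apply: (@le_trans _ _ (\sum_(i < m) e / 2 ^+ i.+1)).
    apply: ler_sum => i _; apply: ltW; apply: rq.
      have im : (i < m + j)%N by rewrite (leq_trans (ltn_ord i))// leq_addr.
      by rewrite (le_trans (ltW (nmu i im)))// lerDr /c !addr_ge0// mulr_ge0.
    have im : (i < m + j)%N by rewrite (leq_trans (ltn_ord i))// leq_addr.
    by rewrite (lt_trans (uk i im))// ltr1n.
  elim: (m) => [|k IH]; first by rewrite big_ord0 expr0 subrr mulr0.
  rewrite big_ord_recr/= (le_trans (lerD IH (lexx _)))// -exprVn exprS.
  by set a := _ ^+ k; rewrite le_eqVlt; apply/orP; left; apply/eqP; field.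
have := rq m _ rest_nm rest_r; rewrite gx => rest_q.
rewrite (le_lt_trans (qs.1 _ _))// (le_lt_trans (lerD s1_q (ltW rest_q)))//.
rewrite -[2 ^- _]exprVn exprS.
have : 0 < e * 2^-1 ^+ m by rewrite mulr_gt0// exprn_gt0// invr_gt0.
rewrite mulrBr mulr1 mulrCA; set a := e * _; lra.
Qed.

(** On each ball a neighbourhood can be tested by sequences, since [p] is cofinal and bounded
    [tau]-null sequences are null for the mixed topology. Convexity then glues the pieces: a sum is
    read as a convex combination with weights [2^-(k+1)] of terms enlarged by [2 ^+ k.+1]. *)
Lemma mixed_C_sequential (p : nat -> X -> R) :
  (forall n, Gamma (p n)) ->
  (forall q, Gamma q -> exists N, forall n x, (N <= n)%N -> q x <= p n x) ->
  C_sequential_topology mixed.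
Proof.
move=> Gp p_cof V V_convex V_seq.
rewrite openE => x Vx; rewrite /interior.
pose V0 : set X := [set y | V (x + y)].
have V00 : V0 0 by rewrite /V0 /= addr0.
have V0_convex (t : R) y z : 0 <= t -> t <= 1 -> V0 y -> V0 z ->
    V0 (t%:C *: y + (1 - t)%:C *: z).
  move=> t0 t1 Vy Vz.
  have t0' : 0 <= t%:C :> R[i] by rewrite ler0c.
  have t1' : t%:C <= 1 :> R[i] by rewrite -(rmorph1 (real_complex R)) lecR.
  have := V_convex (x + y) (x + z) (Itv01 t0' t1') (mem_set Vy) (mem_set Vz).
  rewrite inE; rewrite /V0 /=.
  have -> // : conv (Itv01 t0' t1') (x + y : convex_lmodType (top_space mixed)) (x + z)
      = x + (t%:C *: y + (1 - t)%:C *: z).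
  change (t%:C *: (x + y) + (1 - t%:C) *: (x + z) = x + (t%:C *: y + (1 - t)%:C *: z)).
  by rewrite rmorphB rmorph1 !scalerDr addrACA -scalerDl [t%:C + _]addrCA subrr addr0 scale1r.
(* The k-th term has norm at most [k.+1] and is going to be multiplied by [2 ^+ k.+1]. *)
pose c (k : nat) : R := k.+1%:R * 2 ^+ k.+1.
have /choice[r rP] (k : nat) : exists r, dominated Gamma r /\
    forall y, nm y <= c k -> r y < 1 -> V0 y.
  apply: contrapT => nr.
  have /choice[y yP] (n : nat) : exists y, [/\ nm y <= c k, p n y < n.+1%:R^-1 & ~ V0 y].
    apply: contrapT => ny; apply: nr.
    have [|r rd rp] := @dominated_ball (p n) n.+1%:R^-1 (Gp n); first by rewrite invr_gt0.
    exists r; split => // y yc ry; apply: contrapT => Vy; apply: ny.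
    by exists y; split => //; exact: rp.
  have : (fun n => x + y n : top_space mixed) @ \oo --> (x : top_space mixed).
    move=> U /(nbhs_mixedP nm sG dG)[q [e [[qs qd] e0] qU]].
    have [g [d [Gg d0] gq]] := qd (c k) e e0.
    have [N gN] := p_cof g Gg.
    have : \forall n \near \oo, (n.+1%:R^-1 : R) < d.
      have := @cvg_harmonic R => /cvgrPdist_lt/(_ d d0).
      by apply: filterS => n; rewrite /= sub0r normrN ger0_norm// invr_ge0.
    apply: filterS2 (nbhs_infty_ge N) => n nN nd; apply: qU.
    rewrite addrC addKr; have [yc yp _] := yP n; apply: gq => //.
    by rewrite (le_lt_trans (gN _ _ nN))// (lt_trans yp).
  move=> /(V_seq _ x Vx)[N _ /(_ N (leqnn N))].
  by have [_ _] := yP N.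
pose r' k y := 2 ^+ k.+1 * r k y.
have r'd k : dominated Gamma (r' k).
  by apply: dominated_scale; [exact: exprn_ge0|exact: (rP k).1].
have mQ := mixed_sum_mixed nm_seminorm r'd.
apply/(nbhs_mixedP nm sG dG); exists (mixed_sum nm r'), 1; first by split.
move=> y /(mixed_sum_lt nm_seminorm r'd)[N /(_ N (leqnn N))[u [yu _ u1 nmu]]].
suff : V0 (y - x) by rewrite /V0 /= addrC subrK.
rewrite yu.
have V0w k : (k < N)%N -> V0 ((2 ^+ k.+1 : R)%:C *: u k).
  move=> kN; apply: (rP k).2.
    rewrite seminormZ// ger0_norm ?exprn_ge0// /c mulrC ler_pM2r ?exprn_gt0//.
    exact/ltW/nmu.
  by rewrite seminormZ ?(rP k).1.1// ?ger0_norm ?exprn_ge0//; [exact: u1|exact: (rP k).1.1].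
(* The weights sum to [1 - 2^-n]; the missing weight sits on 0, which belongs to [V0]. *)
have comb n (w : nat -> X) : (forall k, (k < n)%N -> V0 (w k)) ->
    V0 (\sum_(k < n) (2^-1 ^+ k.+1 : R)%:C *: w k).
  elim: n w => [|n IH] w Vw; first by rewrite big_ord0.
  have h2 : (1 - 2^-1 : R) = 2^-1 by field.
  have := @V0_convex 2^-1 (w 0%N) (\sum_(k < n) (2^-1 ^+ k.+1 : R)%:C *: w k.+1).
  have h0 : 0 <= 2^-1 :> R by rewrite invr_ge0.
  have h1 : 2^-1 <= 1 :> R by rewrite invf_le1// ler1n.
  rewrite h2 => /(_ h0 h1 (Vw 0%N isT)).
  rewrite big_ord_recl expr1 scaler_sumr.
  have -> : \sum_(i < n) (2^-1 : R)%:C *: ((2^-1 ^+ i.+1 : R)%:C *: w i.+1) =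
      \sum_(i < n) (2^-1 ^+ (lift ord0 i).+1 : R)%:C *: w (lift ord0 i).
    by apply: eq_bigr => i _; rewrite scalerA -rmorphM -exprS.
  by apply; apply: (IH (fun k => w k.+1)) => k kn; exact: Vw.
have -> : \sum_(k < N) u k = \sum_(k < N) (2^-1 ^+ k.+1 : R)%:C *: ((2 ^+ k.+1 : R)%:C *: u k).
  apply: eq_bigr => k _; rewrite scalerA -rmorphM /= exprVn mulVf ?expf_neq0//.
  by rewrite scale1r.
by apply: (comb N (fun k => (2 ^+ k.+1 : R)%:C *: u k)).
Qed.

End MixedUniversal.

(** * The submixed topology *)

Section Submixed.
Context {R : realType} {X : lmodType R[i]}.
Variables (nm : X -> R) (Gamma Gs : set (X -> R)).
Hypothesis nm_seminorm : seminorm nm.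
Hypothesis sG : seminorms Gamma.
Hypothesis dG : directed_seminorms Gamma.
Hypothesis G_le : forall p x, Gamma p -> p x <= nm x.
Hypothesis Gs_dominated : forall q, Gs q -> dominated Gamma q.
Hypothesis dGs : directed_seminorms Gs.
Hypothesis nm_sup : forall x, ((nm x)%:E = ereal_sup [set (q x)%:E | q in Gs])%E.
Local Notation tau := (seminorm_topology Gamma).
Local Notation mixed := (mixed_topology nm Gamma).
Implicit Types (q r p : X -> R) (x y z : X).

Lemma Gs_le q x : Gs q -> q x <= nm x.
Proof. by move=> Gq; rewrite -lee_fin nm_sup; apply: ereal_sup_ubound; exists q. Qed.

Lemma nm_gt (c : R) x : c < nm x -> exists2 q, Gs q & c < q x.
Proof.
rewrite -lte_fin nm_sup => /ereal_sup_gt[_ [q Gq <-]]; rewrite lte_fin => cq.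
by exists q.
Qed.

Section SubmixedSeminorm.
Variables (q : nat -> X -> R) (a : nat -> R).
Hypothesis Gq : forall n, Gs (q n).
Hypothesis a_ge0 : forall n, 0 <= a n.
Hypothesis a0 : a @ \oo --> (0 : R).
Let p x := sup (range (fun n => q n x * a n)).
Let qs n : seminorm (q n) := (Gs_dominated (Gq n)).1.

Lemma submixed_has_sup x : has_sup (range (fun n => q n x * a n)).
Proof.
split; first by exists (q 0%N x * a 0%N), 0%N.
have [_ [A Aa]] := cvg_has_sup (cvgP _ a0).
exists (nm x * `|A|) => _ [n _ <-]; rewrite ler_pM ?seminorm_ge0 ?Gs_le//.
by rewrite (le_trans (Aa _ _)) ?ler_norm//; exists n.
Qed.

Lemma submixed_ge n x : q n x * a n <= p x.
Proof. by apply: sup_upper_bound; [exact: submixed_has_sup|exists n]. Qed.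

Lemma submixed_le (c : R) x : (forall n, q n x * a n <= c) -> p x <= c.
Proof.
move=> H; apply: sup_le_ub; first exact: (submixed_has_sup x).1.
by move=> _ [n _ <-].
Qed.

Lemma submixed_seminorm : seminorm p.
Proof.
apply: seminorm_of_le => [x|x y|b x].
- apply: le_trans (submixed_ge 0 x); rewrite mulr_ge0//; exact/seminorm_ge0.
- apply: submixed_le => n; apply: le_trans (lerD (submixed_ge n x) (submixed_ge n y)).
  by rewrite -mulrDl ler_wpM2r//; exact: (qs n).1.
- apply: submixed_le => n; rewrite (qs n).2 -mulrA ler_wpM2l ?submixed_ge//.
  exact: (@normR_ge0 R R[i]^o).
Qed.

(** On the ball of radius [M] the terms with large index are at most [a n * |M|], hence uniformly
    small; the finitely many others have a dominated maximum. *)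
Lemma submixed_mixed : mixed_seminorms nm Gamma p.
Proof.
split; first exact: submixed_seminorm.
move=> M e e0.
have e2 : 0 < e / 2 by rewrite divr_gt0.
have [N aN] : exists N, forall n, (N <= n)%N -> a n * `|M| <= e / 2.
  have [c c0 cP] := small_multiple `|M| e2.
  have /cvgrPdist_lt/(_ c c0)[N _ aN] := a0; exists N => n /aN /=.
  by rewrite sub0r normrN ger0_norm// => ac; rewrite mulrC ltW// cP// a_ge0 ltW.
have [r rd rP] : exists2 r, dominated Gamma r &
    forall n x, (n < N)%N -> q n x * a n <= r x.
  elim: (N) => [|k [r rd rP]].
    by have [g Gg] := dG.1; exists g => //; exact: dominated_Gamma.
  exists (fun x => Num.max (r x) (a k * q k x)).
    by apply: dominated_max => //; apply: dominated_scale => //; exact: Gs_dominated.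
  move=> n x; rewrite ltnS leq_eqVlt => /orP[/eqP->|nk].
    by rewrite mulrC le_max lexx orbT.
  by rewrite le_max rP.
have [g [d [Gg d0] gr]] := rd.2 _ e2; exists g, d => // x xM xd.
apply: (@le_lt_trans _ _ (e / 2)); last exact: half_ltr.
apply: submixed_le => n; have [nN|Nn] := ltnP n N.
  by rewrite (le_trans (rP _ _ nN))// ltW// gr.
apply: le_trans (aN _ Nn); rewrite mulrC ler_wpM2l//.
by rewrite (le_trans (Gs_le _ (Gq n)))// (le_trans xM)// ler_norm.
Qed.

End SubmixedSeminorm.

Lemma submixed_sub_mixed :
  opens (seminorm_topology (submixed_seminorms Gs)) `<=` opens mixed.
Proof.
move=> U oU x Ux; have [F [e [finF FG e0 FU]]] := oU x Ux.
exists F, e; split => // p /FG[q [a [Gq a_ge0 a0 ->]]].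
exact: submixed_mixed.
Qed.

Section CompactBalls.
Hypothesis ball_compact : forall M : R,
  compact ([set x | nm x <= M] : set (top_space tau)).

Lemma dominated_closed q (c : R) : dominated Gamma q ->
  closed ([set x | q x <= c] : set (top_space tau)).
Proof.
move=> [qs qd] x cx /=; apply/ler_addgt0Pr => e e0.
have [p [d [Gp d0] pq]] := qd e e0.
have : nbhs (x : top_space tau) [set y | p (y - x) < d].
  by apply/(nbhs_seminormP _ _ dG sG); exists p, d.
move=> /cx[y [/= yc yx]].
rewrite -(subrK y x) addrC (le_trans (qs.1 _ _))// lerD//.
by rewrite ltW// seminormB// pq.
Qed.

(** If every [q] failed, the sets [A q] would form a filter base on the compact ball of radius [M'].
    A cluster point [x] satisfies [q x <= M] for all [q] in [Gs], so its norm is at most [M] and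
    [Q x < 1]; but on bounded sets [Q] is [tau]-continuous at [x], against [1 <= Q] on the base. *)
Lemma compact_step Q (C : set X) (M M' : R) : mixed_seminorms nm Gamma Q ->
  closed (C : set (top_space tau)) ->
  (forall x, C x -> nm x <= M -> Q x < 1) ->
  exists q, Gs q /\ forall x, C x -> q x <= M -> nm x <= M' -> Q x < 1.
Proof.
move=> [Qs Qd] C_closed CQ; apply: contrapT => nq.
have A_ex q : Gs q -> exists x, [/\ C x, q x <= M, nm x <= M' & 1 <= Q x].
  move=> Gq; apply: contrapT => nx; apply: nq; exists q; split => // x Cx qx xM'.
  by rewrite ltNge; apply/negP => Q1; apply: nx; exists x.
pose A q : set X := [set x | [/\ C x, q x <= M, nm x <= M' & 1 <= Q x]].
pose F : set_system (top_space tau) := filter_from Gs A.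
have FF : ProperFilter F.
  apply: filter_from_proper; last by move=> q /A_ex.
  apply: filter_from_filter; first exact: dGs.1.
  move=> q r Gq Gr; have [g Gg gP] := dGs.2 _ _ Gq Gr; exists g => //.
  move=> x [Cx gx xM' Q1]; have [qg rg] := gP x.
  by split; split => //; [exact: le_trans qg gx|exact: le_trans rg gx].
have [q0 Gq0] := dGs.1.
have [|x [/= xM' xF]] := ball_compact (M := M') FF.
  by exists q0 => // x [].
have Cx : C x.
  by apply: C_closed => U xU; apply: xF => //; exists q0 => // y [].
have Qx : Q x < 1.
  apply: CQ => //; rewrite leNgt; apply/negP => /nm_gt[q Gq].
  rewrite ltNge => /negP; apply.
  have := dominated_closed (c := M) (Gs_dominated Gq); apply.
  by move=> U xU; apply: xF => //; exists q => // y [].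
have [p [d [Gp d0] pQ]] := Qd (M' + M') (1 - Q x) (eqbRL (subr_gt0 _ _) Qx).
have : nbhs (x : top_space tau) [set y | p (y - x) < d].
  by apply/(nbhs_seminormP _ _ dG sG); exists p, d.
have FA : F (A q0) by exists q0.
move=> /(xF _ _ FA)[y [[Cy _ yM' Q1] yx]].
have := pQ (y - x) _ yx; rewrite (le_trans (nm_seminorm.1 _ _)) ?seminormN ?lerD//.
move=> /(_ isT); rewrite ltrBrDr => H.
have := le_lt_trans (Qs.1 (y - x) x) H.
by rewrite subrK ltNge Q1.
Qed.

(* Compactness yields, one index at a time, q n such that the inequalities [q n x <= M n] force [Q x < 1]. *)
Lemma mixed_sub_submixed :
  opens mixed `<=` opens (seminorm_topology (submixed_seminorms Gs)).
Proof.
move=> U oU x Ux.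
have : nbhs (x : top_space mixed) U by rewrite nbhsE; exists U.
move=> /(nbhs_mixedP nm sG dG)[Q0 [e [mQ0 e0] QU]].
pose Q y := e^-1 * Q0 y.
have mQ : mixed_seminorms nm Gamma Q.
  split; first by apply: seminorm_scale; [rewrite invr_ge0 ltW|exact: mQ0.1].
  move=> M r r0; have [p [d pd pQ]] := mQ0.2 M (e * r) (mulr_gt0 e0 r0).
  by exists p, d => // y yM /(pQ _ yM); rewrite /Q ltr_pdivrMl.
have {}QU y : Q (y - x) < 1 -> U y.
  by rewrite /Q mulrC ltr_pdivrMr// mul1r; exact: QU.
have [d d0 dQ] := mixed_small_norm G_le mQ ltr01.
(* The start [d / 2] makes the ball of radius [M 0] lie in [Q < 1] with no constraint; the growth to
   infinity makes the weights [(M n)^-1] a null sequence and the balls exhaust the space. *)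
pose M (n : nat) : R := d / 2 + n%:R.
have M_gt0 n : 0 < M n by rewrite ltr_pwDl// divr_gt0.
(* The choice is made for all pairs at once, with an arbitrary seminorm where the induction
   hypothesis fails, so that [C] can be defined by recursion before its properties are known. *)
have /choice[step stepP] (nC : nat * set X) : exists q, Gs q /\
    (closed (nC.2 : set (top_space tau)) ->
     (forall x, nC.2 x -> nm x <= M nC.1 -> Q x < 1) ->
     forall x, nC.2 x -> q x <= M nC.1 -> nm x <= M nC.1.+1 -> Q x < 1).
  have [[C_closed CQ]|nC'] := pselect (closed (nC.2 : set (top_space tau)) /\
     (forall x, nC.2 x -> nm x <= M nC.1 -> Q x < 1)).
    by have [q [Gq qP]] := @compact_step Q nC.2 (M nC.1) (M nC.1.+1) mQ C_closed CQ; exists q.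
  have [g Gg] := dGs.1; exists g; split => // C_closed CQ; exfalso; exact: nC'.
pose C := fix C n := if n is k.+1 then C k `&` [set x | step (k, C k) x <= M k] else setT.
have CP n : closed (C n : set (top_space tau)) /\ (forall x, C n x -> nm x <= M n -> Q x < 1).
  elim: n => [|n [cC CQ]]; split.
  - exact: closedT.
  - move=> y _ yM; apply: dQ; apply: le_lt_trans yM _.
    by rewrite /M addr0 half_ltr.
  - apply: closedI => //; apply: dominated_closed.
    exact/Gs_dominated/(stepP _).1.
  - by move=> y [Cy qy] yM; exact: (stepP (n, C n)).2.
pose q n := step (n, C n); pose a n := (M n)^-1.
have Gq n : Gs (q n) by exact: (stepP _).1.
have a_ge0 n : 0 <= a n by rewrite invr_ge0 ltW.
have a0 : a @ \oo --> (0 : R).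
  apply/cvgrPdist_lt => r r0; near=> n.
  rewrite sub0r normrN ger0_norm// /a invf_plt ?posrE//.
  apply: (@lt_le_trans _ _ n%:R); last by rewrite lerDr divr_ge0// ltW.
  near: n; exact: nbhs_infty_gtr.
exists [set fun y => sup (range (fun n => q n y * a n))], 1; split => //.
  by move=> _ ->; exists q, a.
move=> y /(_ _ erefl) y1; apply: QU.
have qM n : q n (y - x) <= M n.
  have := le_lt_trans (submixed_ge Gq a_ge0 a0 n (y - x)) y1.
  by rewrite ltr_pdivrMr// mul1r => /ltW.
have Cn n : C n (y - x) by elim: n => [//|n IH]; split => //; exact: qM.
apply: (CP (Num.bound (nm (y - x)))).2; first exact: Cn.
have := archi_boundP (seminorm_ge0 (y - x) nm_seminorm).
by rewrite /M => /ltW/le_trans; apply; rewrite lerDr divr_ge0// ltW.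
Unshelve. all: by end_near. Qed.

Lemma submixed_eq_mixed : opens mixed = opens (seminorm_topology (submixed_seminorms Gs)).
Proof. by apply/seteqP; split; [exact: mixed_sub_submixed|exact: submixed_sub_mixed]. Qed.

Lemma mixed_ball_compact (M : R) : compact ([set x | nm x <= M] : set (top_space mixed)).
Proof.
move=> F FF FM; have [x [xM xF]] := ball_compact (M := M) (FF : ProperFilter (F : set_system (top_space tau))) FM.
exists x; split => // A B FA /(nbhs_mixedP nm sG dG)[q [e [[qs qd] e0] qB]].
have [p [d [Gp d0] pq]] := qd (M + M) e e0.
have : nbhs (x : top_space tau) [set y | p (y - x) < d].
  by apply/(nbhs_seminormP _ _ dG sG); exists p, d.
move=> /(xF _ _ (filterI FA FM))[y [[Ay yM] yx]]; exists y; split => //.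
apply: qB; apply: pq => //.
by rewrite (le_trans (nm_seminorm.1 _ _))// seminormN// lerD.
Qed.

(** Points of an unbounded set with [q n] above [(n + 1)^2] defeat the submixed seminorm with
    weights [1 / (n + 1)], which is continuous for the mixed topology and therefore bounded on
    [B]. *)
Lemma mixed_bounded (B : set (top_space mixed)) : bounded_in B ->
  exists M : R, forall x, B x -> nm x <= M.
Proof.
move=> bB; apply: contrapT => nM.
have /choice[xq xqP] (n : nat) : exists xq : X * (X -> R),
    [/\ B xq.1, Gs xq.2 & n.+1%:R ^+ 2 < xq.2 xq.1].
  apply: contrapT => nx; apply: nM; exists (n.+1%:R ^+ 2) => x Bx.
  rewrite leNgt; apply/negP => /nm_gt[q Gq qx].
  by apply: nx; exists (x, q).
pose q n := (xq n).2; pose a n : R := n.+1%:R^-1.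
have Gq n : Gs (q n) by have [] := xqP n.
have a_ge0 n : 0 <= a n by rewrite invr_ge0.
have a0 : a @ \oo --> (0 : R) by exact: cvg_harmonic.
pose p := fun y => sup (range (fun n => q n y * a n)).
have : nbhs (0 : top_space mixed) [set y | p y < 1].
  apply/(nbhs_mixedP nm sG dG); exists p, 1.
    by split => //; exact: submixed_mixed.
  by move=> y; rewrite subr0.
move=> /bB[r r0 Br].
pose n := Num.bound r.
have [Bx _ qx] := xqP n; have [y /= y1 yx] := Br _ Bx.
have := submixed_ge Gq a_ge0 a0 n (xq n).1; rewrite -yx -/p.
rewrite (seminormZ _ _ (submixed_seminorm Gq a_ge0 a0)) gtr0_norm// leNgt => /negP; apply.
apply: (@lt_trans _ _ r); first by rewrite gtr_pMr.
rewrite ltr_pdivlMr// [X in _ < q n X]yx; apply: lt_trans qx.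
rewrite expr2 ltr_pM2r// (lt_trans (archi_boundP (ltW r0)))//.
by rewrite ltr_nat.
Qed.

Lemma mixed_semi_montel : (forall x, nm x = 0 -> x = 0) -> semi_montel_topology mixed.
Proof.
move=> nm0.
have mh : hausdorff_space (top_space mixed).
  apply: seminorm_topology_hausdorff.
  - exact: mixed_directed.
  - exact: mixed_seminormsP.
  move=> x xG; apply: nm0; apply/eqP; rewrite eq_le seminorm_ge0// andbT.
  rewrite leNgt; apply/negP => /nm_gt[q Gq].
  by rewrite xG ?ltxx//; exact/dominated_mixed/Gs_dominated.
split => //.
  apply: seminorm_topology_locally_convex; [exact: mixed_directed|exact: mixed_seminormsP].
move=> B /mixed_bounded[M BM]; exists [set x | nm x <= M]; first exact: BM.
split; first exact: mixed_ball_compact.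
exact: (compact_closed mh (@mixed_ball_compact M)).
Qed.

End CompactBalls.
End Submixed.

(** * Partial derivatives *)

(** Continuity is asked at the points of [K] only, because many functions below are controlled only
    on an open set containing it. *)
Lemma compact_near_bounded {R : realType} {T : topologicalType} (K : set T) (f : T -> R) :
  compact K -> (forall x, K x -> {for x, continuous f}) ->
  exists M : R, forall x, K x -> f x <= M.
Proof.
move=> /compact_near_coveringP cK cf.
have : \forall M \near +oo, K `<=` (fun x => f x <= M).
  apply: (cK R (pinfty_nbhs R) (fun M x => f x <= M)) => x Kx.
  exists ([set y | f y < f x + 1], [set M | f x + 1 < M]) => /=.
    split; last by exists (f x + 1); split => //; exact: num_real.
    have /(cf x Kx) : nbhs (f x) [set z | z < f x + 1].
      by apply: open_nbhs_nbhs; split; [exact: open_lt|rewrite /= ltrDl].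
    by [].
  by move=> [y M] /= [yx xM]; rewrite ltW// (lt_trans yx).
move=> [M [_ /(_ (M + 1))]]; rewrite ltrDl => /(_ ltr01) KM; by exists (M + 1).
Qed.

Section RowVectors.
Context {R : realType} {d : nat}.
Implicit Types (x y : 'rV[R]_d) (i : 'I_d).

Lemma rV_norm_coord x i : `|x 0 i| <= `|x|.
Proof.
have -> : `|x| = mx_norm x by [].
rewrite mx_normrE; apply/bigmax_geP; right => /=.
by exists (0, i).
Qed.

Lemma rV_norm_le x (c : R) : 0 <= c -> (forall i, `|x 0 i| <= c) -> `|x| <= c.
Proof.
move=> c0 xc; have -> : `|x| = mx_norm x by [].
rewrite mx_normrE; apply/bigmax_leP; split=> // -[k i] _ /=.
by rewrite ord1.
Qed.

Lemma rV_norm_lt x (c : R) : 0 < c -> (forall i, `|x 0 i| < c) -> `|x| < c.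
Proof.
move=> c0 xc; have -> : `|x| = mx_norm x by [].
rewrite mx_normrE; apply/bigmax_ltP; split=> // -[k i] _ /=.
by rewrite ord1.
Qed.

Lemma rV_line_norm i (h : R) : `|h *: (delta_mx 0 i : 'rV[R]_d)| <= `|h|.
Proof.
apply: rV_norm_le => // j; rewrite !mxE /= normrM.
by case: (j == i); rewrite ?normr1 ?mulr1// normr0 mulr0.
Qed.

Lemma rV_nbhsP x (U : set 'rV[R]_d) :
  nbhs x U <-> exists2 e : R, 0 < e & forall y, `|y - x| < e -> U y.
Proof.
split=> [/nbhs_ballP[e e0 eU]|[e e0 eU]].
  by exists e => // y yx; apply: eU; rewrite -ball_normE/= distrC.
by apply/nbhs_ballP; exists e => // y; rewrite -ball_normE/= distrC => /eU.
Qed.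

Lemma rV_closed_ball_compact x (r : R) : compact [set y : 'rV[R]_d | `|y - x| <= r].
Proof.
apply: bounded_closed_compact.
  exists (r + `|x|); split; first exact: num_real.
  move=> M rM y /= yr; rewrite -[y](subrK x) (le_trans (ler_normD _ _))//.
  by rewrite (le_trans _ (ltW rM))// lerD2r.
have -> : [set y : 'rV[R]_d | `|y - x| <= r] =
  (fun y : 'rV[R]_d => `|y - x|) @^-1` [set r' | r' <= r] by [].
apply: preimage_closed => [y _|]; last exact: closed_le.
exact: (cvg_norm (cvgB (@cvg_id _ (nbhs y)) (cvg_cst x))).
Qed.

Lemma closed_ball_sub (O : set 'rV[R]_d) x : open O -> O x -> exists2 r : R, 0 < r & [set y | `|y - x| <= r] `<=` O.
Proof.
move=> oO Ox; have /rV_nbhsP[r r0 rO] : nbhs x O by exact: open_nbhs_nbhs.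
exists (r / 2); first by rewrite divr_gt0.
by move=> y /= yr; apply: rO; rewrite (le_lt_trans yr)// half_ltr.
Qed.

Lemma continuous_at_local (T : topologicalType) (O : set 'rV[R]_d) (f g : 'rV[R]_d -> T) x :
  open O -> O x -> (forall y, O y -> f y = g y) ->
  {for x, continuous f} -> {for x, continuous g}.
Proof.
move=> oO Ox fg cf.
have E1 : \forall y \near nbhs x, f y = g y.
  by apply: filterS (open_nbhs_nbhs (conj oO Ox)).
rewrite /prop_for /continuous_at -fg//.
exact: cvg_trans (near_eq_cvg E1) cf.
Qed.

End RowVectors.

Section PartialDerivatives.
Context {R : realType} {d : nat} {E : normedModType R[i]}.
Implicit Types (f g : 'rV[R]_d -> E) (x y : 'rV[R]_d) (i j : 'I_d) (s : seq 'I_d).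
Local Notation e_ i := (delta_mx 0 i : 'rV[R]_d).

Lemma pderivableP i f x : pderivable i f x ->
  diff_quotient i f x @ 0^' --> pderiv i f x.
Proof. by []. Qed.

Lemma pderiv_unique i f x (l : E) : diff_quotient i f x @ 0^' --> l ->
  pderivable i f x /\ pderiv i f x = l.
Proof.
by move=> fl; split; [apply/cvg_ex; exists l|exact: cvg_lim fl].
Qed.

Lemma pderiv_local (O : set 'rV[R]_d) i f g x : open O -> O x ->
  (forall y, O y -> f y = g y) -> pderivable i f x ->
  pderivable i g x /\ pderiv i g x = pderiv i f x.
Proof.
move=> oO Ox fg df; apply: pderiv_unique.
apply: cvg_trans (pderivableP df); apply: near_eq_cvg.
by apply: (diff_quotient_near_eq i oO Ox) => y; rewrite inE => /fg.
Qed.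

Lemma pderivs_local (O : set 'rV[R]_d) f g s : open O ->
  (forall y, O y -> f y = g y) -> smooth O f ->
  forall y, O y -> pderivs s g y = pderivs s f y.
Proof.
move=> oO fg sf; elim: s => [|i s IH] y Oy; first by rewrite /= fg.
rewrite /=; apply: (pderiv_local oO Oy (fun z Oz => esym (IH z Oz)) _).2.
exact: (sf s y Oy).2.
Qed.

Lemma smooth_local (O : set 'rV[R]_d) f g : open O ->
  (forall y, O y -> f y = g y) -> smooth O f -> smooth O g.
Proof.
move=> oO fg sf s x Ox.
have sE y : O y -> pderivs s f y = pderivs s g y.
  by move=> Oy; rewrite (pderivs_local s oO fg sf).
split=> [|i]; last exact: (pderiv_local oO Ox sE ((sf s x Ox).2 i)).1.
exact: (continuous_at_local oO Ox sE (sf s x Ox).1).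
Qed.

Lemma pderivs_eq0 (O : set 'rV[R]_d) f s : open O -> (forall y, O y -> f y = 0) ->
  forall y, O y -> pderivs s f y = 0.
Proof.
move=> oO f0 y Oy.
by rewrite (@pderivs_local O 0 f s oO _ (@smooth0 R d E O) y Oy) ?pderivs0// => z /f0.
Qed.

Lemma smooth_pderivs (O : set 'rV[R]_d) f s : smooth O f -> smooth O (pderivs s f).
Proof.
have cat t : pderivs t (pderivs s f) = pderivs (t ++ s) f.
  by rewrite /pderivs foldr_cat.
by move=> sf t x Ox; rewrite cat; exact: sf.
Qed.

Lemma smooth_sub (O O' : set 'rV[R]_d) f : O' `<=` O -> smooth O f -> smooth O' f.
Proof. by move=> OO sf s x /OO; exact: sf. Qed.

(** A coinduction principle: a class of functions that is closed under partial derivatives on [O]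
    needs to be checked for first-order regularity only. It serves products, flat functions,
    constants and weakly smooth functions. *)
Lemma smooth_class (O : set 'rV[R]_d) (C : set ('rV[R]_d -> E)) : open O ->
  (forall f, C f -> forall x, O x -> {for x, continuous f} /\ forall i, pderivable i f x) ->
  (forall f i, C f -> exists2 g, C g & forall x, O x -> pderiv i f x = g x) ->
  forall f, C f -> smooth O f.
Proof.
move=> oO C1 C2 f Cf s.
have [g Cg sg] : exists2 g, C g & forall x, O x -> pderivs s f x = g x.
  elim: s => [|i s [g Cg gP]]; first by exists f.
  have [g' Cg' gP'] := C2 g i Cg; exists g' => // x Ox; rewrite /= -gP'//.
  by apply: (pderiv_local oO Ox _ _).2 => [y /gP //|]; exact: (C1 g Cg x Ox).2.
move=> x Ox; have [cg dg] := C1 g Cg x Ox; split=> [|i]; last first.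
  exact: (pderiv_local oO Ox (fun y Oy => esym (sg y Oy)) (dg i)).1.
by apply: (continuous_at_local oO Ox _ cg) => y /sg.
Qed.

Lemma pderiv_lin_at i (a : R[i]) f g x : pderivable i f x -> pderivable i g x ->
  pderivable i (fun y => a *: f y + g y) x /\
  pderiv i (fun y => a *: f y + g y) x = a *: pderiv i f x + pderiv i g x.
Proof. by move=> df dg; exact: (@pderiv_lin _ _ _ setT i a f g _ x openT). Qed.

Lemma pderiv_shift i f (v x : 'rV[R]_d) : pderivable i f (x + v) ->
  pderivable i (fun y => f (y + v)) x /\ pderiv i (fun y => f (y + v)) x = pderiv i f (x + v).
Proof.
have dqE : diff_quotient i (fun y => f (y + v)) x = diff_quotient i f (x + v).
  by apply/funext => h; rewrite /diff_quotient addrAC.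
by rewrite /pderivable /pderiv dqE.
Qed.

End PartialDerivatives.

Section CompLinear.
Context {R : realType} {d : nat} {E F : normedModType R[i]}.
Variables (e : {linear E -> F}) (ce : continuous e).
Implicit Types (f : 'rV[R]_d -> E) (x : 'rV[R]_d) (i : 'I_d) (s : seq 'I_d).

Lemma pderiv_comp_linear i f x :
  pderivable i f x ->
  diff_quotient i (e \o f) x @ 0^' --> e (pderiv i f x).
Proof.
move=> df.
have -> : diff_quotient i (e \o f) x = e \o diff_quotient i f x.
  by apply/funext => h; rewrite /diff_quotient /= linearZ [e (_ - _)]linearB.
have dq := pderivableP df; have ce' : e @ nbhs (pderiv i f x) --> e (pderiv i f x) by exact: ce.
exact: (cvg_comp _ _ dq ce').
Qed.

Lemma pderivs_comp_linear (O : set 'rV[R]_d) f s :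
  open O -> smooth O f ->
  forall x, O x -> pderivs s (e \o f) x = e (pderivs s f x).
Proof.
move=> oO sf; elim: s => [//|i s IH] x Ox /=.
have [de pe] := pderiv_unique (pderiv_comp_linear ((sf s x Ox).2 i)).
by rewrite -pe; apply: (pderiv_local oO Ox (fun y Oy => esym (IH y Oy)) de).2.
Qed.

Lemma smooth_comp_linear (O : set 'rV[R]_d) f :
  open O -> smooth O f -> smooth O (e \o f).
Proof.
move=> oO sf s x Ox.
have sE y (Oy : O y) : (e \o pderivs s f) y = pderivs s (e \o f) y.
  by rewrite (pderivs_comp_linear s oO sf).
split=> [|i].
  apply: (continuous_at_local oO Ox sE).
  by apply: continuous_comp; [exact: (sf s x Ox).1|exact: ce].
apply: (pderiv_local oO Ox sE _).1.
exact: (pderiv_unique (pderiv_comp_linear ((sf s x Ox).2 i))).1.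
Qed.

End CompLinear.

(** * Mean value inequalities and symmetry of second derivatives *)

Section MeanValue.
Context {R : realType} {d : nat}.
Implicit Types (f g : 'rV[R]_d -> R[i]^o) (x y : 'rV[R]_d) (i j : 'I_d) (s : seq 'I_d).
Local Notation e_ i := (delta_mx 0 i : 'rV[R]_d).
Local Notation absC := (@normR R R[i]^o).

(* [L] is the real or the imaginary part *)
Lemma mean_value_part (L : R[i]^o -> R) i f x (h : R) (c : R[i]^o) (C : R) :
  (forall a b, L (a + b) = L a + L b) -> (forall (r : R) a, L (r%:C * a) = r * L a) ->
  (forall a, `|L a| <= absC a) ->
  (forall t, `|t| <= `|h| -> pderivable i f (x + t *: e_ i) /\
     absC (pderiv i f (x + t *: e_ i) - c) <= C) ->
  `|L (f (x + h *: e_ i) - f x - h%:C * c)| <= C * `|h|.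
Proof.
move=> LD LZ Lle fh.
have LN a : L (- a) = - L a.
  by rewrite -mulN1r -(rmorphN1 (real_complex R)) LZ mulN1r.
have Lcont : continuous L.
  by apply: (@normR_lipschitz_continuous _ R[i]^o) => a b; rewrite -LN -LD.
pose phi (t : R) := L (f (x + t *: e_ i)).
pose phi' (t : R) := L (pderiv i f (x + t *: e_ i)).
have dphi t : `|t| <= `|h| -> is_derive t (1 : R) phi (phi' t).
  move=> /fh[df _].
  have E1 : (fun k : R => k^-1 *: ((phi \o shift t) (k *: (1 : R)) - phi t)) =
      L \o diff_quotient i f (x + t *: e_ i).
    apply/funext => k; rewrite /diff_quotient /phi /= LZ LD LN.
    congr (_ * (L (f _) - _)).
    by rewrite -addrA; congr (x + _); rewrite [k *: 1]mulr1 scalerDl addrC.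
  have cvgL : (fun k : R => k^-1 *: ((phi \o shift t) (k *: (1 : R)) - phi t)) @ 0^' --> phi' t.
    rewrite E1; exact: (cvg_comp _ _ (pderivableP df) (Lcont _)).
  by apply: DeriveDef; [apply/cvg_ex; exists (phi' t)|exact: cvg_lim cvgL].
have cphi t : `|t| <= `|h| -> {for t, continuous phi}.
  by move=> /dphi[dp _]; apply/differentiable_continuous/derivable1_diffP.
have bound t : `|t| <= `|h| -> `|phi' t - L c| <= C.
  by move=> /fh[_]; apply: le_trans; rewrite -LN -LD.
(* The real mean value theorem on the segment between 0 and [h], whose orientation depends on the
   sign of [h]. *)
have main : exists2 t, `|t| <= `|h| & phi h - phi 0 = phi' t * h.
  have [h0|h0|<-] := ltgtP 0 h; last by exists 0; rewrite ?mulr0 ?subrr.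
  - have [||t + ->] := @MVT_segment R phi phi' 0 h (ltW h0).
    + move=> t; rewrite in_itv/= => /andP[t0 th]; apply: dphi.
      by rewrite !gtr0_norm// ltW.
    + apply: continuous_in_subspaceT => t; rewrite inE/= in_itv/= => /andP[t0 th].
      by apply: cphi; rewrite !ger0_norm// (le_trans t0 th).
    + rewrite in_itv/= => /andP[t0 th]; exists t; last by rewrite subr0.
      by rewrite !ger0_norm// (le_trans t0 th).
  - have [||t +] := @MVT_segment R phi phi' h 0 (ltW h0).
    + move=> t; rewrite in_itv/= => /andP[t0 th]; apply: dphi.
      by rewrite !ltr0_norm// lerN2 ltW.
    + apply: continuous_in_subspaceT => t; rewrite inE/= in_itv/= => /andP[t0 th].
      by apply: cphi; rewrite !ler0_norm// ?lerN2// (le_trans t0 th).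
    + rewrite in_itv/= => /andP[t0 th]; move=> H; exists t; last by rewrite -opprB H sub0r mulrN opprK.
      by rewrite !ler0_norm// ?lerN2// (le_trans t0 th).
have [t th phiE] := main.
have -> : L (f (x + h *: e_ i) - f x - h%:C * c) = (phi' t - L c) * h.
  rewrite LD LN LZ LD LN mulrBl -phiE /phi scale0r addr0 [h * _]mulrC.
  by [].
by rewrite normrM ler_wpM2r ?bound.
Qed.

(** Real and imaginary part have different intermediate points, hence the factor 2. The free
    constant [c] lets the lemma measure how far the increment is from a prescribed linear one. *)
Lemma mean_value i f x (h : R) (c : R[i]^o) (C : R) :
  (forall t, `|t| <= `|h| -> pderivable i f (x + t *: e_ i) /\
     absC (pderiv i f (x + t *: e_ i) - c) <= C) ->
  absC (f (x + h *: e_ i) - f x - h%:C * c) <= 2 * C * `|h|.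
Proof.
move=> fh; rewrite (le_trans (absC_le _))// -mulrA mulr2n mulrDl mul1r lerD//.
  apply: mean_value_part fh; [exact: cReD| |exact: absC_Re].
  by move=> r a; rewrite cReM /= mul0r subr0.
apply: mean_value_part fh; [exact: cImD| |exact: absC_Im].
by move=> r a; rewrite cImM /= mul0r addr0.
Qed.

(** Only derivatives along the axes are at hand, so the way from [x] to [y] changes one coordinate
    at a time, with one mean value estimate per coordinate. *)
Lemma smooth_lipschitz (O : set 'rV[R]_d) f x : open O -> smooth O f -> O x ->
  exists r : R, exists2 C : R, 0 < r /\ 0 <= C &
    forall y, `|y - x| < r -> O y /\ absC (f y - f x) <= C * `|y - x|.
Proof.
move=> oO sf Ox.
have /rV_nbhsP[r0 r0_gt0 rO] : nbhs x O by apply: open_nbhs_nbhs.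
have [r [r_gt0 rr0 rP]] : exists r : R, [/\ 0 < r, r <= r0 &
    forall i y, `|y - x| < r -> absC (pderiv i f y - pderiv i f x) < 1].
  have H (i : 'I_d) : exists2 r : R, 0 < r & forall y, `|y - x| < r ->
      absC (pderiv i f y - pderiv i f x) < 1.
    apply/rV_nbhsP.
    have /(_ [set z | absC (z - pderiv i f x) < 1]) := (sf [:: i] x Ox).1; apply.
    by apply/normR_nbhsP; exists 1.
  have /choice[r rP] (i : 'I_d) : exists r : R, 0 < r /\ forall y, `|y - x| < r ->
      absC (pderiv i f y - pderiv i f x) < 1.
    by have [r r1 r2] := H i; exists r.
  exists (\big[Num.min/r0]_i r i); split.
  - by elim/big_ind : _ => // [a b a0 b0|i _]; [rewrite lt_min a0|exact: (rP i).1].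
  - exact: bigmin_le_id.
  move=> i y yx; apply: (rP i).2; apply: lt_le_trans yx _.
  exact: bigmin_le_cond.
pose C := \sum_(i < d) (absC (pderiv i f x) + 1).
have C0 : 0 <= C by apply: sumr_ge0 => i _; rewrite addr_ge0// normR_ge0.
exists r, (2 * C); first by rewrite mulr_ge0.
move=> y yx; split; first by apply: rO; exact: lt_le_trans rr0.
(* The intermediate points; for the maximum norm none of them is farther from [x] than [y] is. *)
pose z k : 'rV[R]_d := \row_j (if (j < k)%N then y 0 j else x 0 j).
have z0 : z 0%N = x by apply/rowP => j; rewrite mxE ltn0.
have zd : z d = y by apply/rowP => j; rewrite mxE ltn_ord.
have zS (k : 'I_d) : z k.+1 = z k + (y 0 k - x 0 k) *: e_ k.
  apply/rowP => j; rewrite !mxE /= ltnS leq_eqVlt.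
  have [jk|jk] := eqVneq (j : nat) k.
    have -> : j = k by apply/val_inj.
    by rewrite ltnn eqxx /= mulr1 addrC subrK.
  have -> : (j == k) = false by apply/negP => /eqP jk'; rewrite jk' eqxx in jk.
  by rewrite /= mulr0 addr0.
have step (k : 'I_d) : absC (f (z k.+1) - f (z k)) <=
    2 * (absC (pderiv k f x) + 1) * `|y - x|.
  have := @mean_value k f (z k) (y 0 k - x 0 k) 0 (absC (pderiv k f x) + 1).
  rewrite -zS mulr0 subr0 => /(_ _)/le_trans; apply; last first.
    rewrite ler_wpM2l ?mulr_ge0 ?addr_ge0 ?normR_ge0//.
    by have := rV_norm_coord (y - x) k; rewrite !mxE.
  move=> t ht; have tx : `|z k + t *: e_ k - x| < r.
    apply: le_lt_trans yx; apply: rV_norm_le => // j; rewrite !mxE.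
    have [jk|jk] := eqVneq j k.
      rewrite jk ltnn /= mulr1 addrAC subrr add0r (le_trans ht)//.
      by have := rV_norm_coord (y - x) k; rewrite !mxE.
    rewrite /= mulr0 addr0; case: ifP => _; last by rewrite subrr normr0.
    by have := rV_norm_coord (y - x) j; rewrite !mxE.
  split; first exact: (sf [::] _ (rO _ (lt_le_trans tx rr0))).2.
  rewrite subr0 -[pderiv _ _ _](subrK (pderiv k f x)) addrC (le_trans (normRD _ _))// lerD//.
  exact/ltW/rP.
rewrite -zd -z0.
have -> : f (z d) - f (z 0%N) = \sum_(k < d) (f (z k.+1) - f (z k)).
  by rewrite -(big_mkord predT (fun k => f (z k.+1) - f (z k))) telescope_sumr.
rewrite (le_trans (normR_sum _ _ _))// /C mulr_sumr mulr_suml.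
by apply: ler_sum => k _; rewrite (le_trans (step k))// zd z0.
Qed.

(** Near [x] the local estimate applies; at distance at least [s] the quotient is at most the bound
    of the increments on the compact ball divided by [s]. *)
Lemma smooth_lipschitz_ball (O : set 'rV[R]_d) f x (r : R) : open O -> smooth O f -> 0 < r ->
  [set y | `|y - x| <= r] `<=` O ->
  exists2 C : R, 0 <= C & forall y, `|y - x| <= r -> absC (f y - f x) <= C * `|y - x|.
Proof.
move=> oO sf r0 rO; have Ox : O x by apply: rO; rewrite /= subrr normr0 ltW.
have [s [B [s0 B0] sB]] := smooth_lipschitz oO sf Ox.
have [|M0 MP0] := compact_near_bounded (f := fun y => absC (f y)) (@rV_closed_ball_compact R d x r).
  by move=> y /rO Oy; exact: (cvg_comp _ _ (sf [::] y Oy).1 (@normR_continuous R R[i]^o (f y))).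
pose M := M0 + absC (f x).
have MP y : `|y - x| <= r -> absC (f y - f x) <= M.
  by move=> /MP0 fy; apply: le_trans (normRB _ _) _; rewrite lerD2r.
exists (Num.max B (M / s)) => [|y yr]; first by rewrite le_max B0.
have [ys|ys] := ltP `|y - x| s.
  by have [_ h] := sB y ys; apply: le_trans h _; rewrite ler_wpM2r// le_max lexx.
have h := MP y yr; have M_ge0 : 0 <= M by apply: le_trans h; exact: normR_ge0.
apply: le_trans h _; rewrite -[leLHS](divfK (lt0r_neq0 s0)).
by apply: ler_pM => //; [rewrite divr_ge0// ltW|exact: ltW|rewrite le_max lexx orbT].
Qed.

(** [mean_value] is used twice, for [pderiv i f] and then for [f], each time with its factor 2. *)
Lemma pderiv_second_order i f x (h M : R) :
  (forall t, `|t| <= `|h| -> pderivable i f (x + t *: e_ i) /\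
     pderivable i (pderiv i f) (x + t *: e_ i) /\
     absC (pderiv i (pderiv i f) (x + t *: e_ i)) <= M) ->
  absC (f (x + h *: e_ i) - f x - h%:C * pderiv i f x) <= 4%:R * M * h ^+ 2.
Proof.
move=> fh.
have -> : 4%:R * M * h ^+ 2 = 2 * (2 * M * `|h|) * `|h|.
  have -> : h ^+ 2 = `|h| * `|h| by rewrite -normrM -expr2 ger0_norm// sqr_ge0.
  by ring.
have M0 : 0 <= M.
  have /fh[_ [_]] : `|0 : R| <= `|h| by rewrite normr0.
  by apply: le_trans; exact: normR_ge0.
apply: mean_value => t th; split; first exact: (fh t th).1.
have := @mean_value i (pderiv i f) x t 0 M.
rewrite mulr0 subr0 => /(_ _)/le_trans; apply; last first.
  by rewrite ler_wpM2l// mulr_ge0.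
move=> u ut; rewrite subr0; have [_ [? ?]] := fh u (le_trans ut th).
by split.
Qed.

(** The double difference of [f] over a square of side [h] is symmetric in [i] and [j]. Two uses of
    [mean_value] place it within [4 e h^2] of [h^2 a], and by symmetry of [h^2 b]. The side is a
    quarter of the radius, so that two steps stay inside the ball. *)
Lemma schwarz (O : set 'rV[R]_d) f i j : open O -> smooth O f ->
  forall x, O x -> pderiv i (pderiv j f) x = pderiv j (pderiv i f) x.
Proof.
move=> oO sf x Ox.
set a := pderiv i (pderiv j f) x; set b := pderiv j (pderiv i f) x.
suff le e : 0 < e -> absC (a - b) <= 8%:R * e.
  apply/eqP; rewrite -subr_eq0; apply/eqP/normR0_eq0.
  apply/eqP; rewrite eq_le normR_ge0 andbT; apply/ler_addgt0Pr => e e0.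
  rewrite add0r; have := le (e / 8%:R); rewrite divr_gt0// => /(_ isT).
  by rewrite mulrC mulfVK.
move=> e0.
have near s : exists2 r : R, 0 < r & forall y, `|y - x| < r ->
    O y /\ absC (pderivs s f y - pderivs s f x) < e.
  apply/rV_nbhsP; apply: filterI; first exact: open_nbhs_nbhs.
  have /(_ [set z | absC (z - pderivs s f x) < e]) := (sf s x Ox).1; apply.
  by apply/normR_nbhsP; exists e.
have [r1 r1_gt0 r1P] := near [:: i; j]; have [r2 r2_gt0 r2P] := near [:: j; i].
pose h := Num.min r1 r2 / 4%:R.
have r0 : 0 < Num.min r1 r2 by rewrite lt_min r1_gt0.
have h0 : 0 < h by rewrite divr_gt0.
have half k l (w : R[i]^o) : (forall y, `|y - x| < Num.min r1 r2 ->
      O y /\ absC (pderiv l (pderiv k f) y - w) <= e) ->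
    absC (f (x + h *: e_ k + h *: e_ l) - f (x + h *: e_ k) - (f (x + h *: e_ l) - f x)
      - h%:C * (h%:C * w)) <= 4%:R * e * h ^+ 2.
  move=> kl; pose g y : R[i]^o := (-1) *: f y + f (y + h *: e_ l).
  have small t u : `|t| <= `|h| -> `|u| <= `|h| ->
      `|x + t *: e_ k + u *: e_ l - x| < Num.min r1 r2.
    move=> th uh; rewrite addrC addrA addrA [- x + x]addrC subrr add0r.
    rewrite (le_lt_trans (ler_normD _ _))//.
    apply: (@le_lt_trans _ _ (h + h)).
      by rewrite lerD// (le_trans (rV_line_norm _ _))// -(gtr0_norm h0).
    rewrite /h; set m := Num.min r1 r2 in r0 *; lra.
  have := @mean_value k g x h (h%:C * w) (2 * e * h).
  have -> : g (x + h *: e_ k) - g x =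
      f (x + h *: e_ k + h *: e_ l) - f (x + h *: e_ k) - (f (x + h *: e_ l) - f x).
    rewrite /g !scaleN1r opprD opprK [- f _ + _]addrC [- (_ - _)]opprB.
    by congr (_ + _); rewrite addrC.
  have -> : 4%:R * e * h ^+ 2 = 2 * (2 * e * h) * `|h| by rewrite gtr0_norm//; ring.
  apply => t th.
  have O1 : O (x + t *: e_ k).
    by have := (kl _ (small t 0 th _)).1; rewrite scale0r addr0 normr0; apply.
  have O2 : O (x + t *: e_ k + h *: e_ l) by exact: (kl _ (small t h th _)).1.
  have [d2 p2] := pderiv_shift ((sf [::] _ O2).2 k).
  have [d1 p1] := pderiv_lin_at (-1) ((sf [::] _ O1).2 k) d2.
  split; first exact: d1.
  rewrite p1 p2 scaleN1r [- _ + _]addrC /=.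
  have := @mean_value l (pderiv k f) (x + t *: e_ k) h w e.
  rewrite (gtr0_norm h0); apply => u uh; rewrite -{1}(gtr0_norm h0) in uh.
  have [Ou wu] := kl _ (small t u th uh).
  by split; [exact: (sf [:: k] _ Ou).2|exact: wu].
have h1 : absC (f (x + h *: e_ j + h *: e_ i) - f (x + h *: e_ j) - (f (x + h *: e_ i) - f x)
      - h%:C * (h%:C * a)) <= 4%:R * e * h ^+ 2.
  apply: half => y; rewrite lt_min => /andP[y1 _]; have [Oy ye] := r1P y y1.
  by split; [exact: Oy|exact: ltW].
have h2 : absC (f (x + h *: e_ i + h *: e_ j) - f (x + h *: e_ i) - (f (x + h *: e_ j) - f x)
      - h%:C * (h%:C * b)) <= 4%:R * e * h ^+ 2.
  apply: half => y; rewrite lt_min => /andP[_ y2]; have [Oy ye] := r2P y y2.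
  by split; [exact: Oy|exact: ltW].
move: h1 h2; have -> : x + h *: e_ j + h *: e_ i = x + h *: e_ i + h *: e_ j by rewrite addrAC.
set u := f _; set v := f (x + h *: e_ j); set w := f (x + h *: e_ i); set z := f x => h1 h2.
have : absC (h%:C * (h%:C * (a - b))) <= 8%:R * e * h ^+ 2.
  have -> : h%:C * (h%:C * (a - b)) =
    (u - w - (v - z) - h%:C * (h%:C * b)) - (u - v - (w - z) - h%:C * (h%:C * a)).
    by ring.
  rewrite (le_trans (normRB _ _))// (le_trans (lerD h2 h1))//.
  by rewrite le_eqVlt; apply/orP; left; apply/eqP; ring.
rewrite !absCM !absC_real gtr0_norm// mulrA -expr2 mulrC ler_pM2r//.
by rewrite exprn_gt0.
Qed.

Lemma pderivs_rcons (O : set 'rV[R]_d) f s i : open O -> smooth O f ->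
  forall x, O x -> pderivs (rcons s i) f x = pderivs (i :: s) f x.
Proof.
move=> oO sf; elim: s => [//|j s IH] x Ox /=.
have sIH := smooth_pderivs (rcons s i) sf.
have -> : pderiv j (pderivs (rcons s i) f) x = pderiv j (pderivs (i :: s) f) x.
  symmetry; apply: (pderiv_local oO Ox IH _).2; exact: (sIH [::] x Ox).2.
exact: (schwarz j i oO (smooth_pderivs s sf)).
Qed.

(** Repeated integration by parts hands over the derivatives in reverse order; this restores the
    order. *)
Lemma pderivs_rev (O : set 'rV[R]_d) f s : open O -> smooth O f ->
  forall x, O x -> pderivs (rev s) f x = pderivs s f x.
Proof.
move=> oO sf; elim: s => [//|i s IH] x Ox.
rewrite rev_cons (pderivs_rcons (rev s) i oO sf Ox).
have sr := smooth_pderivs (rev s) sf.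
by symmetry; apply: (pderiv_local oO Ox IH _).2; exact: (sr [::] x Ox).2.
Qed.

Lemma pderivable_cvg i f x : pderivable i f x ->
  (fun h : R => f (x + h *: e_ i)) @ 0^' --> f x.
Proof.
move=> df; have H : (fun h : R => h%:C *: diff_quotient i f x h + f x) @ 0^' --> (f x : R[i]^o).
  rewrite -[X in _ --> X]add0r -[X in X + _](scale0r (pderiv i f x)).
  apply: cvgD; last exact: cvg_cst.
  apply: cvgZ; last exact: pderivableP.
  apply/cvg_normRP => e e0; apply: cvg_within; apply/nbhs_ballP; exists e => // h.
  by rewrite -ball_normE/= sub0r normrN subr0 absC_real.
apply: cvg_trans H; apply: near_eq_cvg; near=> h.
rewrite /diff_quotient scalerA -rmorphM /= mulfV; last by near: h; exact: nbhs_dnbhs_neq.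
by rewrite scale1r subrK.
Unshelve. all: by end_near. Qed.

Lemma cvg_mulC {T : Type} {F : set_system T} {FF : Filter F} (u v : T -> R[i]^o) (a b : R[i]^o) :
  u @ F --> a -> v @ F --> b -> (fun t => u t * v t : R[i]^o) @ F --> (a * b : R[i]^o).
Proof. exact: (@cvgZ _ R[i]^o). Qed.

Lemma pderivM i f g x : pderivable i f x -> pderivable i g x ->
  pderivable i (fun y => f y * g y : R[i]^o) x /\
  pderiv i (fun y => f y * g y : R[i]^o) x = pderiv i f x * g x + f x * pderiv i g x.
Proof.
move=> df dg; apply: pderiv_unique.
have -> : diff_quotient i (fun y => f y * g y : R[i]^o) x =
    fun h => diff_quotient i f x h * g (x + h *: e_ i) + f x * diff_quotient i g x h.
  apply/funext => h; rewrite /diff_quotient /GRing.scale /=.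
  by ring.
apply: (@cvgD _ R[i]^o).
  exact: (cvg_mulC (pderivableP df) (pderivable_cvg dg)).
exact: (cvg_mulC (cvg_cst (f x)) (pderivableP dg)).
Qed.

End MeanValue.

(** * Integrals of functions with compact support *)

Section IntegralLine.
Context {R : realType}.
Notation mu := (@lebesgue_measure R).
Implicit Types (f g : R -> R) (A c : R).

Definition csupp1 A f := continuous f /\ forall t, A < `|t| -> f t = 0.

Lemma csupp1_restrict A f : csupp1 A f -> f \_ `[- A, A] = f.
Proof.
move=> [_ f0]; apply/funext => t; rewrite patchE; case: ifPn => // tA.
rewrite f0// ltNge; apply: contra tA; rewrite ler_norml => tA.
by rewrite inE/= in_itv.
Qed.

Lemma csupp1_integrable A f : csupp1 A f -> mu.-integrable setT (EFin \o f).
Proof.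
move=> fA; have [cf _] := fA; rewrite -(csupp1_restrict fA) -restrict_EFin.
apply: (integrable_mkcond _ _).1 => //.
by apply: continuous_compact_integrable; [exact: segment_compact|exact: continuous_subspaceT].
Qed.

Lemma integral_line_restrict A f : csupp1 A f ->
  \int[mu]_(t in setT) f t = \int[mu]_(t in `[- A, A]) f t.
Proof. by move=> fA; rewrite [RHS]Rintegral_mkcond (csupp1_restrict fA). Qed.

Lemma integral_line_lin A f g c : csupp1 A f -> csupp1 A g ->
  \int[mu]_(t in setT) (f t + c * g t) =
  \int[mu]_(t in setT) f t + c * \int[mu]_(t in setT) g t.
Proof.
move=> fA gA; have [cg g0] := gA.
have cgA : csupp1 A (fun t => c * g t).
  split; last by move=> t /g0 ->; rewrite mulr0.
  by move=> t; apply: cvgM; [exact: cvg_cst|exact: cg].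
have If := csupp1_integrable fA; have Ig := csupp1_integrable gA.
by rewrite RintegralD ?RintegralZl//; exact: csupp1_integrable cgA.
Qed.

Lemma integral_line_le A f c : 0 <= A -> csupp1 A f -> (forall t, `|f t| <= c) ->
  `|\int[mu]_(t in setT) f t| <= 2 * A * c.
Proof.
move=> A0 fA fc; rewrite (integral_line_restrict fA).
have If : mu.-integrable `[- A, A] (EFin \o f).
  by apply: integrableS (csupp1_integrable fA).
apply: le_trans (le_normr_Rintegral _ _) _ => //.
have -> : 2 * A * c = \int[mu]_(t in `[- A, A]) c.
  rewrite Rintegral_cst//= lebesgue_measure_itv/= lte_fin.
  case: ifPn => [_|]; first by rewrite EFinN /= opprK mulrC mulr2n mulrDl mul1r.
  rewrite -leNgt => AA; have -> : A = 0 by apply/eqP; rewrite eq_le A0 andbT; lra.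
  by rewrite mulr0 mul0r mulr0.
apply: le_Rintegral => //.
  by have := integrable_norm If.
apply: continuous_compact_integrable; first exact: segment_compact.
by apply: continuous_subspaceT => x; exact: cvg_cst.
Qed.

Lemma integral_line_gt0 A f t0 : csupp1 A f -> (forall t, 0 <= f t) -> 0 < f t0 ->
  0 < \int[mu]_(t in setT) f t.
Proof.
move=> fA f0 ft0; have [cf _] := fA.
have /cf : nbhs (f t0) [set z | f t0 / 2 < z].
  by apply: open_nbhs_nbhs; split; [exact: open_gt|exact: half_ltr].
move=> /nbhs_ballP[e /= e0 eP].
pose I : set R := [set` `[t0 - e / 2, t0 + e / 2]].
have IP t : I t -> f t0 / 2 < f t.
  rewrite /I /= in_itv/= => /andP[t1 t2]; apply: eP; rewrite -ball_normE/=.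
  rewrite ltr_norml; apply/andP; split; lra.
have e2 : t0 - e / 2 < t0 + e / 2 by lra.
apply: (@lt_le_trans _ _ (\int[mu]_(t in I) (f t0 / 2))).
  rewrite /I Rintegral_cst//= lebesgue_measure_itv/= lte_fin e2 /=.
  rewrite mulr_gt0// ?divr_gt0//; lra.
rewrite Rintegral_mkcond; apply: le_Rintegral => //.
- rewrite -restrict_EFin; apply: (integrable_mkcond _ _).1.
    exact: measurable_itv.
  apply: continuous_compact_integrable; first exact: segment_compact.
  by apply: continuous_subspaceT => x; exact: cvg_cst.
- exact: csupp1_integrable fA.
move=> t _; rewrite patchE; case: ifPn => [|_]; last exact: f0.
by rewrite inE => /IP /ltW.
Qed.

Lemma integral_line_derive A f F : 0 <= A -> csupp1 A f ->
  (forall t, is_derive t (1 : R) F (f t)) -> (forall t, A < `|t| -> F t = 0) ->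
  \int[mu]_(t in setT) f t = 0.
Proof.
move=> A0 [cf f0] dF F0.
(* [F] is known to vanish only strictly outside [[-A, A]], so the fundamental theorem is applied on
   the larger interval. *)
have fA1 : csupp1 (A + 1) f by split => // t tA; apply: f0; lra.
rewrite (integral_line_restrict fA1) /Rintegral.
have cF t : {for t, continuous F}.
  by have [dFt _] := dF t; apply/differentiable_continuous/derivable1_diffP.
rewrite (@continuous_FTC2 _ f F).
- have A1 : 0 < A + 1 by lra.
  rewrite !F0 ?normrN ?gtr0_norm// ?subee//; lra.
- lra.
- exact: continuous_subspaceT.
- split.
  + by move=> t _; have [] := dF t.
  + by apply: cvg_at_right_filter; exact: cF.
  + by apply: cvg_at_left_filter; exact: cF.
- by move=> t _; rewrite derive1E; have [_] := dF t.
Qed.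

End IntegralLine.

Section IteratedIntegral.
Context {R : realType}.

Definition csupp d (A : R) (f : 'rV[R]_d -> R) :=
  continuous f /\ forall x, A < `|x| -> f x = 0.

Definition slice d (f : 'rV[R]_d.+1 -> R) (t : R) (y : 'rV[R]_d) : R :=
  f (row_mx (const_mx t : 'rV_1) y).

Local Notation cons t y := (row_mx (const_mx t : 'rV_1) y).

Lemma consE0 d t (y : 'rV[R]_d) : cons t y 0 (lshift d ord0) = t.
Proof. by rewrite row_mxEl mxE. Qed.

Lemma cons_norm_head d t (y : 'rV[R]_d) : `|t| <= `|cons t y : 'rV[R]_(1 + d)|.
Proof. by have := rV_norm_coord (cons t y) (lshift d ord0); rewrite consE0. Qed.

Lemma cons_norm_tail d t (y : 'rV[R]_d) : `|y| <= `|cons t y : 'rV[R]_(1 + d)|.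
Proof.
apply: rV_norm_le => // j.
by have := rV_norm_coord (cons t y) (rshift 1 j); rewrite row_mxEr.
Qed.

Lemma cons_norm_le d t (y : 'rV[R]_d) (c : R) : `|t| <= c -> `|y| <= c ->
  `|cons t y : 'rV[R]_(1 + d)| <= c.
Proof.
move=> tc yc; have c0 : 0 <= c by exact: le_trans tc.
apply: rV_norm_le => // j; rewrite mxE; case: splitP => k _; first by rewrite mxE.
by rewrite (le_trans _ yc)// rV_norm_coord.
Qed.

Lemma consB d t s (y z : 'rV[R]_d) : cons t y - cons s z = cons (t - s) (y - z).
Proof.
rewrite opp_row_mx add_row_mx; congr row_mx.
by apply/matrixP => i j; rewrite !mxE.
Qed.

Lemma rV_cons d (x : 'rV[R]_(1 + d)) : exists t y, x = cons t y.
Proof.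
exists (x 0 (lshift d ord0)), (rsubmx x); rewrite -[LHS]hsubmxK; congr row_mx.
by apply/matrixP => i j; rewrite !mxE !ord1.
Qed.

Lemma slice_csupp d A f t : csupp A f -> csupp A (slice f t : 'rV[R]_d -> R).
Proof.
move=> [cf f0]; split; last first.
  by move=> y yA; apply: f0; exact: lt_le_trans yA (cons_norm_tail t y).
move=> y U /(cf (cons t y)) /rV_nbhsP[e e0 eU].
apply/rV_nbhsP; exists e => // z zy; apply: eU.
apply: le_lt_trans zy; rewrite consB subrr; apply: cons_norm_le => //.
by rewrite normr0.
Qed.

(** Continuity controls [slice f s z] for [s] near [t] and [z] near a given [y]. Compactness of the
    cube of radius [A] makes the neighbourhood of [t] uniform, and outside the cube both slices
    vanish. *)
Lemma slice_uniform d A (f : 'rV[R]_d.+1 -> R) t (e : R) : csupp A f -> 0 < e ->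
  \forall s \near t, forall y, `|slice f s y - slice f t y| <= e.
Proof.
move=> [cf f0] e0.
pose K : set 'rV[R]_d := [set y | `|y - 0| <= A].
have cK : compact K by exact: rV_closed_ball_compact.
have : \forall s \near t, K `<=` (fun y => `|slice f s y - slice f t y| <= e).
  move: cK => /compact_near_coveringP cK.
  apply: (cK R (nbhs t) (fun s y => `|slice f s y - slice f t y| <= e)) => y Ky.
  have /(cf (cons t y)) : nbhs (f (cons t y)) [set z | `|z - f (cons t y)| < e / 2].
    apply/nbhs_ballP; exists (e / 2); first by rewrite /= divr_gt0.
    by move=> z; rewrite -ball_normE/= distrC.
  move=> /rV_nbhsP[r r0 rP].
  exists ([set z : 'rV[R]_d | `|z - y| < r], [set s | `|s - t| < r / 2]) => /=.
    split; first by apply/rV_nbhsP; exists r.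
    apply/nbhs_ballP; exists (r / 2); first by rewrite /= divr_gt0.
    by move=> s; rewrite -ball_normE/= distrC.
  move=> [z s] /= [zy st]; rewrite [e](splitr e).
  have h1 : `|f (cons s z) - f (cons t y)| < e / 2.
    apply: rP; rewrite consB.
    have : `|cons (s - t) (z - y) : 'rV[R]_(1 + d)| <= Num.max (r / 2) `|z - y|.
      by apply: cons_norm_le; rewrite le_max ?lexx ?orbT// (ltW st).
    by move=> /le_lt_trans; apply; rewrite gt_max zy andbT half_ltr.
  have h2 : `|f (cons t z) - f (cons t y)| < e / 2.
    apply: rP; rewrite consB subrr.
    have : `|cons 0 (z - y) : 'rV[R]_(1 + d)| <= `|z - y|.
      by apply: cons_norm_le; rewrite ?normr0.
    by move=> /le_lt_trans; apply.
  rewrite /slice -[_ - _](subrKA (f (cons t y))).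
  by rewrite (le_trans (ler_normD _ _))// lerD// ltW// distrC.
apply: filterS => s sP y; have [yA|yA] := leP `|y| A; first by apply: sP; rewrite /K /= subr0.
rewrite /slice !f0 ?subrr ?normr0 ?ltW//.
  exact: lt_le_trans yA (cons_norm_tail t y).
exact: lt_le_trans yA (cons_norm_tail s y).
Qed.

Lemma csuppD d A f g (c : R) : csupp A f -> csupp A g ->
  csupp A (fun x : 'rV[R]_d => f x + c * g x).
Proof.
move=> [cf f0] [cg g0]; split; last first.
  by move=> x xA; rewrite f0// g0// mulr0 addr0.
by move=> x; exact: (cvgD (cf x) (cvgM (cvg_cst c) (cg x))).
Qed.

(** Linearity and the bound in dimension [d] are hypotheses because the lemma is applied inside the
    induction that proves them. The bound for a difference of slices gives continuity in [t]. *)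
Lemma slice_int_csupp1 d (A : R) (f : 'rV[R]_d.+1 -> R) : 0 <= A ->
  (forall (f g : 'rV[R]_d -> R) c, csupp A f -> csupp A g ->
     lebesgue_int (fun x => f x + c * g x) = lebesgue_int f + c * lebesgue_int g) ->
  (forall (f : 'rV[R]_d -> R) c, csupp A f -> (forall x, `|f x| <= c) ->
     `|lebesgue_int f| <= (2 * A) ^+ d * c) ->
  csupp A f -> csupp1 A (fun t => lebesgue_int (slice f t)).
Proof.
move=> A0 lin bnd fA.
split=> [t|t tA].
  apply/cvgrPdist_le => e e0.
  have [c c0 cP] := small_multiple ((2 * A) ^+ d) e0.
  have := slice_uniform t fA c0; apply: filterS => s sP.
  have -> : lebesgue_int (slice f t) - lebesgue_int (slice f s) =
      lebesgue_int (fun y => slice f t y + (- 1) * slice f s y).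
    by rewrite lin ?mulN1r//; exact: slice_csupp.
  apply: (@le_trans _ _ ((2 * A) ^+ d * c)); last by rewrite ltW// cP// lexx ltW.
  apply: bnd => [|y]; last by rewrite mulN1r distrC.
  by apply: csuppD; exact: slice_csupp.
have -> : slice f t = fun y => 0 + 0 * slice f t y.
  apply/funext => y; rewrite mul0r addr0 /slice fA.2//.
  exact: lt_le_trans tA (cons_norm_head t y).
apply/eqP; rewrite -normr_le0.
rewrite -[leRHS](mulr0 ((2 * A) ^+ d)).
have sf := slice_csupp t fA.
apply: bnd => [|y]; last by rewrite mul0r addr0 normr0.
apply: csuppD => //; split; last by [].
exact: cst_continuous.
Qed.

(** The properties go through one induction: linearity and the bound in dimension [d] are what makes
    the inner integral continuous with compact support, hence integrable over the line. *)
Lemma lebesgue_int_props d (A : R) : 0 <= A ->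
  [/\ forall (f g : 'rV[R]_d -> R) c, csupp A f -> csupp A g ->
        lebesgue_int (fun x => f x + c * g x) = lebesgue_int f + c * lebesgue_int g,
      forall (f : 'rV[R]_d -> R) c, csupp A f -> (forall x, `|f x| <= c) ->
        `|lebesgue_int f| <= (2 * A) ^+ d * c,
      forall (f : 'rV[R]_d -> R), csupp A f -> (forall x, 0 <= f x) -> 0 <= lebesgue_int f &
      forall (f : 'rV[R]_d -> R) x0, csupp A f -> (forall x, 0 <= f x) -> 0 < f x0 ->
        0 < lebesgue_int f].
Proof.
move=> A0; elim: d => [|d [lin bnd nonneg pos]].
  split=> //= [f c _ fc|f x0 _ _].
    by rewrite expr0 mul1r.
  by rewrite (_ : x0 = 0)//; apply/rowP => -[].
have slice_supp f fA := @slice_int_csupp1 d A f A0 lin bnd fA.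
split.
- move=> f g c fA gA /=.
  rewrite -(integral_line_lin c (slice_supp f fA) (slice_supp g gA)).
  congr Rintegral; apply/funext => t.
  by rewrite -lin//; exact: slice_csupp.
- move=> f c fA fc /=; rewrite exprS -mulrA.
  apply: integral_line_le => //; first exact: slice_supp.
  by move=> t; apply: bnd; [exact: slice_csupp|move=> y; exact: fc].
- move=> f fA f0 /=; apply: Rintegral_ge0 => // t _.
  by apply: nonneg; [exact: slice_csupp|move=> y; exact: f0].
- move=> f x0 fA f0 fx0 /=.
  have [t0 [y0 x0E]] := rV_cons x0.
  apply: (integral_line_gt0 (slice_supp f fA) (t0 := t0)) => [t|].
    by apply: nonneg; [exact: slice_csupp|move=> y; exact: f0].
  apply: (pos _ y0); first exact: slice_csupp.
    by move=> y; exact: f0.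
  by rewrite /slice -x0E.
Qed.

Lemma csupp1_lebesgue_int d (A : R) (f : 'rV[R]_d.+1 -> R) : 0 <= A -> csupp A f ->
  csupp1 A (fun t => lebesgue_int (slice f t)).
Proof.
move=> A0; have [lin bnd _ _] := @lebesgue_int_props d A A0.
exact: slice_int_csupp1.
Qed.

End IteratedIntegral.

(** * Integrals of derivatives vanish *)

Section IntegralDerivative.
Context {R : realType}.

(** A quadratic remainder can be integrated over the other variables, which makes it a convenient
    substitute for differentiation under the integral. *)
Lemma is_derive_quadratic (F : R -> R) (t l C : R) :
  (forall h, `|h| <= 1 -> `|F (t + h) - F t - h * l| <= C * h ^+ 2) ->
  is_derive t (1 : R) F l.
Proof.
move=> FC.
have cvgF : (fun h : R => h^-1 *: ((F \o shift t) (h *: (1 : R)) - F t)) @ 0^' --> l.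
  apply/cvgrPdist_lt => e e0; have [c c0 cP] := small_multiple C e0; near=> h.
  have h0 : h != 0 by near: h; exact: nbhs_dnbhs_neq.
  have h1 : `|h| < Num.min 1 c.
    by near: h; apply: dnbhs0_lt; rewrite lt_min ltr01.
  move: h1; rewrite lt_min => /andP[h1 he].
  have -> : l - h^-1 *: ((F \o shift t) (h *: (1 : R)) - F t) =
      - h^-1 * (F (t + h) - F t - h * l).
    rewrite /= /GRing.scale /= mulr1 [h + t]addrC.
    by field.
  rewrite normrM normrN normfV mulrC ltr_pdivrMr ?normr_gt0//.
  apply: le_lt_trans (FC h (ltW h1)) _.
  have -> : h ^+ 2 = `|h| * `|h| by rewrite -normrM -expr2 ger0_norm// sqr_ge0.
  rewrite mulrA ltr_pM2r ?normr_gt0//.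
  by rewrite cP// normr_ge0 ltW.
by apply: DeriveDef; [apply/cvg_ex; exists l|exact: cvg_lim cvgF].
Unshelve. all: by end_near. Qed.

Local Notation cons t y := (row_mx (const_mx t : 'rV_1) y).

Lemma cons_delta_head d (t h : R) (y : 'rV[R]_d) :
  cons (t + h) y = cons t y + h *: (delta_mx 0 (lshift d ord0) : 'rV[R]_(1 + d)).
Proof.
apply/rowP => j; rewrite !mxE; case: splitP => k jk; rewrite ?mxE.
  have -> : (j == lshift d ord0) by apply/eqP/val_inj; rewrite /= jk ord1.
  by rewrite mulr1.
have -> : (j == lshift d ord0) = false by apply/negbTE/eqP => jE; rewrite jE in jk.
by rewrite mulr0 addr0.
Qed.

Lemma cons_delta_tail d (t h : R) (y : 'rV[R]_d) (i : 'I_d) :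
  cons t (y + h *: delta_mx 0 i) =
  cons t y + h *: (delta_mx 0 (rshift 1 i) : 'rV[R]_(1 + d)).
Proof.
apply/rowP => j; rewrite !mxE; case: splitP => k jk; rewrite ?mxE.
  have -> : (j == rshift 1 i) = false.
    by apply/negbTE/eqP => jE; move: jk; rewrite jE /= ord1.
  by rewrite mulr0 addr0.
have -> : j = rshift 1 k by exact/val_inj.
by rewrite eq_rshift.
Qed.

(** The uniform remainder estimate passes to slices. In the first direction the outer integrand is
    the derivative of the inner integral of [f]; in any other direction the inner integral is
    already 0 by induction. *)
Lemma lebesgue_int_derive d (A : R) (i : 'I_d) (f g : 'rV[R]_d -> R) (C : R) :
  0 <= A -> csupp A f -> csupp A g ->
  (forall x h, `|f (x + h *: delta_mx 0 i) - f x - h * g x| <= C * h ^+ 2) ->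
  lebesgue_int g = 0.
Proof.
move=> A0; elim: d i f g => [[]//|d IH] i f g fA gA fg.
have [lin bnd _ _] := @lebesgue_int_props R d A A0.
rewrite /=; have [j ij|j ij] := splitP (i : 'I_(1 + d)).
  have iE : (i : 'I_(1 + d)) = lshift d (ord0 : 'I_1) by apply/val_inj; rewrite /= ij ord1.
  apply: (@integral_line_derive _ A _ (fun t => lebesgue_int (slice f t)) A0).
  - exact: csupp1_lebesgue_int.
  - move=> t; apply: (@is_derive_quadratic _ _ _ ((2 * A) ^+ d * C)) => h _.
    have sf s := slice_csupp s fA; have sg := slice_csupp t gA.
    have -> : lebesgue_int (slice f (t + h)) - lebesgue_int (slice f t) - h * lebesgue_int (slice g t)
        = lebesgue_int (fun y => (slice f (t + h) y + (-1) * slice f t y) + (- h) * slice g t y).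
      by rewrite lin// ?lin// ?mulN1r ?mulNr//; exact: csuppD.
    rewrite -mulrA; apply: bnd => [|y]; first by apply: csuppD => //; exact: csuppD.
    by rewrite mulN1r mulNr /slice cons_delta_head -iE.
  - move=> t tA; have [_] := csupp1_lebesgue_int A0 fA; exact.
have iE : (i : 'I_(1 + d)) = rshift 1 j by apply/val_inj; rewrite /= ij.
have -> : (fun t => lebesgue_int (fun y : 'rV[R]_d => g (row_mx (const_mx t : 'rV_1) y))) = fun=> 0.
  apply/funext => t; apply: (IH j (slice f t) (slice g t)).
  - exact: slice_csupp.
  - exact: slice_csupp.
  - by move=> y h; rewrite /slice cons_delta_tail -iE.
by rewrite /Rintegral integral0.
Qed.

End IntegralDerivative.

Section ComplexIntegral.
Context {R : realType} {d : nat}.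
Implicit Types (phi psi : 'rV[R]_d -> R[i]^o) (A c : R).
Local Notation absC := (@normR R R[i]^o).

Definition ccsupp A phi := continuous phi /\ forall x, A < `|x| -> phi x = 0.

Lemma ccsupp_Re A phi : ccsupp A phi -> csupp A (fun x => complex.Re (phi x)).
Proof.
move=> [cphi phi0]; split=> [x|x xA]; last by rewrite phi0.
exact: (cvg_comp _ _ (cphi x) (@Re_continuous R (phi x))).
Qed.

Lemma ccsupp_Im A phi : ccsupp A phi -> csupp A (fun x => complex.Im (phi x)).
Proof.
move=> [cphi phi0]; split=> [x|x xA]; last by rewrite phi0.
exact: (cvg_comp _ _ (cphi x) (@Im_continuous R (phi x))).
Qed.

Lemma ccsupp_lin A (a : R[i]) phi psi : ccsupp A phi -> ccsupp A psi ->
  ccsupp A (fun x => a *: phi x + psi x).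
Proof.
move=> [cphi phi0] [cpsi psi0]; split=> [x|x xA].
  exact: (@cvg_lin R R[i]^o _ (nbhs x) _ a phi psi _ _ (cphi x) (cpsi x)).
by rewrite phi0// psi0// scaler0 addr0.
Qed.

Lemma complex_int_lin A (a : R[i]) phi psi : 0 <= A -> ccsupp A phi -> ccsupp A psi ->
  complex_int (fun x => a *: phi x + psi x) = a * complex_int phi + complex_int psi.
Proof.
move=> A0 phiA psiA; have [lin _ _ _] := @lebesgue_int_props R d A A0.
have pR := ccsupp_Re phiA; have pI := ccsupp_Im phiA.
have qR := ccsupp_Re psiA; have qI := ccsupp_Im psiA.
have E1 : (fun x => complex.Re (a *: phi x + psi x)) =
    fun x => (complex.Re (psi x) + (complex.Re a) * complex.Re (phi x)) +
      (- complex.Im a) * complex.Im (phi x).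
  by apply/funext => x; rewrite cReD cReM; ring.
have E2 : (fun x => complex.Im (a *: phi x + psi x)) =
    fun x => (complex.Im (psi x) + (complex.Re a) * complex.Im (phi x)) +
      (complex.Im a) * complex.Re (phi x).
  by apply/funext => x; rewrite cImD cImM; ring.
rewrite /complex_int E1 E2 !lin//; try exact: csuppD.
case: a {E1 E2} => ar ai /=; apply/eqP; rewrite eq_complex /=.
by apply/andP; split; apply/eqP; ring.
Qed.

Lemma complex_int_le A phi c : 0 <= A -> ccsupp A phi -> (forall x, absC (phi x) <= c) ->
  absC (complex_int phi) <= 2 * (2 * A) ^+ d * c.
Proof.
move=> A0 phiA phic; have [_ bnd _ _] := @lebesgue_int_props R d A A0.
rewrite (le_trans (absC_le _))// -mulrA mulr2n mulrDl mul1r lerD//.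
  by apply: bnd => [|x]; [exact: ccsupp_Re|rewrite (le_trans (absC_Re _))].
by apply: bnd => [|x]; [exact: ccsupp_Im|rewrite (le_trans (absC_Im _))].
Qed.

Lemma ccsupp_bounded A phi : ccsupp A phi -> exists M, forall x, absC (phi x) <= M.
Proof.
move=> [cphi phi0].
have [|M MP] := compact_near_bounded (f := fun x => absC (phi x)) (@rV_closed_ball_compact R d 0 A).
  by move=> x _; exact: (cvg_comp _ _ (cphi x) (@normR_continuous R R[i]^o (phi x))).
exists (Num.max M 0) => x; have [xA|xA] := leP `|x| A.
  by rewrite le_max MP//= subr0.
by rewrite phi0// normR0 le_max lexx orbT.
Qed.

Lemma pderivs_ccsupp A phi s : smooth setT phi -> ccsupp A phi -> ccsupp A (pderivs s phi).
Proof.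
move=> sphi [cphi phi0]; split=> [x|x xA]; first exact: (sphi s x I).1.
have oA : open [set x : 'rV[R]_d | A < `|x|].
  have -> : [set x : 'rV[R]_d | A < `|x|] = (fun y : 'rV[R]_d => `|y|) @^-1` [set r | A < r] by [].
  apply: open_comp => [y _|]; last exact: open_gt.
  exact: norm_continuous.
exact: (pderivs_eq0 s oA phi0).
Qed.

Lemma complex_int_pderiv A i phi : 0 <= A -> smooth setT phi -> ccsupp A phi ->
  complex_int (pderiv i phi) = 0.
Proof.
move=> A0 sphi phiA.
have dA := pderivs_ccsupp [:: i] sphi phiA.
have [M MP] := ccsupp_bounded (pderivs_ccsupp [:: i; i] sphi phiA).
have H x h : absC (phi (x + h *: delta_mx 0 i) - phi x - h%:C * pderiv i phi x) <=
    4%:R * M * h ^+ 2.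
  apply: pderiv_second_order => t _; split; first exact: (sphi [::] _ I).2.
  by split; [exact: (sphi [:: i] _ I).2|exact: MP].
rewrite /complex_int; congr Complex.
  apply: (lebesgue_int_derive (i := i) A0 (ccsupp_Re phiA) (ccsupp_Re dA) (C := 4%:R * M)).
  move=> x h; apply: le_trans (H x h); apply: le_trans (absC_Re _).
  by rewrite !cReB cReM /= mul0r subr0.
apply: (lebesgue_int_derive (i := i) A0 (ccsupp_Im phiA) (ccsupp_Im dA) (C := 4%:R * M)).
move=> x h; apply: le_trans (H x h); apply: le_trans (absC_Im _).
by rewrite !cImB cImM /= mul0r addr0.
Qed.

End ComplexIntegral.

(** * Bump functions *)

Section FlatFunctions.
Context {R : realType}.
Implicit Types (t h : R) (n : nat).

(* The functions t^-n e^(-1/t), extended by 0 to t <= 0: their span is closed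
   under differentiation. *)
Definition flat n t : R := if 0 < t then t ^- n * expR (- t^-1) else 0.

Lemma flat_le0 n t : t <= 0 -> flat n t = 0.
Proof. by rewrite /flat leNgt => /negbTE ->. Qed.

Lemma flat_ge0 n t : 0 <= flat n t.
Proof.
by rewrite /flat; case: ifP => // t0; rewrite mulr_ge0 ?expR_ge0// invr_ge0 exprn_ge0// ltW.
Qed.

Lemma flat_gt0 n t : 0 < t -> 0 < flat n t.
Proof. by move=> t0; rewrite /flat t0 mulr_gt0 ?expR_gt0// invr_gt0 exprn_gt0. Qed.

(** One term of the exponential series at [t^-1], of degree [n + 2], absorbs the pole and leaves
    [t ^+ 2]: enough for derivative 0 at the origin. *)
Lemma flat_quadratic n t : flat n t <= (n.+2)`!%:R * t ^+ 2.
Proof.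
have [t0|t0] := ltP 0 t; last by rewrite flat_le0// mulr_ge0 ?sqr_ge0.
rewrite /flat t0 expRN.
have tn : 0 < t ^+ n by rewrite exprn_gt0.
have t2 : 0 < t ^+ n.+2 by rewrite exprn_gt0.
have t1 : 0 <= t^-1 by rewrite invr_ge0 ltW.
have f0 : 0 < (n.+2)`!%:R :> R by rewrite ltr0n fact_gt0.
have key : (expR t^-1)^-1 <= (n.+2)`!%:R * t ^+ n.+2.
  rewrite invf_ple ?posrE ?expR_gt0 ?(mulr_gt0 f0 t2)//.
  have := @expR_ge1Dxn _ _ n.+1 t1.
  have -> : t^-1 ^+ n.+2 / (n.+2)`!%:R = ((n.+2)`!%:R * t ^+ n.+2)^-1.
    by rewrite invfM exprVn mulrC.
  by move=> /(le_trans _); apply; rewrite lerDr.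
rewrite ler_pdivrMl//; apply: le_trans key _.
by rewrite [leRHS]mulrCA -exprD addn2.
Qed.

Lemma is_derive_flat n t :
  is_derive t (1 : R) (flat n) (flat n.+2 t - n%:R * flat n.+1 t).
Proof.
have [t0|t0|->] := ltgtP t 0.
- rewrite !flat_le0 ?ltW// mulr0 subrr.
  have E1 : \forall s \near t, (fun _ : R => 0 : R) s = flat n s.
    have : nbhs t [set s : R | s < 0] by apply: open_nbhs_nbhs; split; [exact: open_lt|].
    by apply: filterS => s s0; rewrite flat_le0// ltW.
  exact: (near_eq_is_derive E1).
- have E1 : \forall s \near t, (fun s : R => s ^- n * expR (- s^-1)) s = flat n s.
    have : nbhs t [set s : R | 0 < s] by apply: open_nbhs_nbhs; split; [exact: open_gt|].
    by apply: filterS => s /= s0; rewrite /flat s0.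
  apply: (near_eq_is_derive E1).
  have tn0 : t != 0 by rewrite gt_eqF.
  have dv : is_derive t (1 : R) (fun s : R => s^-1) (- t ^- 2 *: 1).
    exact: (is_deriveV (f := id) tn0).
  have dX := is_deriveX n dv.
  have dE := @is_derive1_comp R expR (- (fun s : R => s^-1)) t _ _ (is_derive_expR _) (is_deriveN dv).
  have -> : (fun s : R => s ^- n * expR (- s^-1)) =
      ((fun s : R => s^-1) ^+ n) * (expR \o (- (fun s : R => s^-1))).
    by apply/funext => s; rewrite !fctE /= exprVn.
  apply: is_derive_eq (is_deriveM dX dE) _.
  rewrite /flat t0 !fctE /GRing.scale /=.
  case: n {dX E1} => [|n]; rewrite ?expr0 /=.
    rewrite !mul0r !mulr0 !mulr1 addr0 subr0 mul1r; field; exact: tn0.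
  have a0 : t ^+ n != 0 by rewrite expf_neq0.
  rewrite !exprVn !exprS; move: a0; set a := t ^+ n => a0; field; exact/andP.
- rewrite !flat_le0// mulr0 subrr.
  apply: (@is_derive_quadratic _ _ _ _ (n.+2)`!%:R) => h _.
  rewrite add0r (flat_le0 n (lexx 0)) mulr0 !subr0 ger0_norm ?flat_ge0//.
  exact: flat_quadratic.
Qed.

Inductive flats : (R -> R) -> Prop :=
| Flats_scale n a : flats (fun t => a * flat n t)
| Flats_add F G : flats F -> flats G -> flats (fun t => F t + G t).

Lemma flats_derive F : flats F -> exists2 F', flats F' & forall t, is_derive t (1 : R) F (F' t).
Proof.
elim=> [n a|{}F G _ [F' fF' dF] _ [G' fG' dG]].
  exists (fun t => a * flat n.+2 t + - (a * n%:R) * flat n.+1 t).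
    by apply: Flats_add; exact: Flats_scale.
  move=> t; apply: is_derive_eq (is_deriveZ a (is_derive_flat n t)) _.
  by rewrite /GRing.scale /=; ring.
exists (fun t => F' t + G' t); first exact: Flats_add.
by move=> t; exact: is_deriveD (dF t) (dG t).
Qed.

End FlatFunctions.

Section SmoothProducts.
Context {R : realType} {d : nat}.
Implicit Types (f g h k : 'rV[R]_d -> R[i]^o) (x y : 'rV[R]_d) (i j : 'I_d) (s t : seq 'I_d).
Local Notation absC := (@normR R R[i]^o).
Local Notation e_ i := (delta_mx 0 i : 'rV[R]_d).

Lemma continuous_mulC f g x : {for x, continuous f} -> {for x, continuous g} ->
  {for x, continuous (fun y => f y * g y : R[i]^o)}.
Proof. by move=> cf cg; exact: (@cvg_mulC R _ (nbhs x) _ f g _ _ cf cg). Qed.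

Lemma continuous_addC f g x : {for x, continuous f} -> {for x, continuous g} ->
  {for x, continuous (fun y => f y + g y : R[i]^o)}.
Proof. by move=> cf cg; exact: (@cvgD _ R[i]^o _ (nbhs x) _ f g _ _ cf cg). Qed.

Lemma continuous_realC (g : 'rV[R]_d -> R) x : {for x, continuous g} ->
  {for x, continuous (fun y => (g y)%:C : R[i]^o)}.
Proof.
move=> cg U /normR_nbhsP[e e0 eU].
have /cg : nbhs (g x) [set z | `|z - g x| < e].
  by apply/nbhs_ballP; exists e => // z; rewrite -ball_normE/= distrC.
apply: (@filterS _ (nbhs x)) => y /= yx; apply: eU.
by rewrite -rmorphB absC_real.
Qed.

Lemma pderivD_at i f g x : pderivable i f x -> pderivable i g x ->
  pderivable i (fun y => f y + g y : R[i]^o) x /\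
  pderiv i (fun y => f y + g y : R[i]^o) x = pderiv i f x + pderiv i g x.
Proof.
move=> df dg; have := pderiv_lin_at 1 df dg.
have -> : (fun y => 1 *: f y + g y : R[i]^o) = (fun y => f y + g y).
  by apply/funext => y; rewrite scale1r.
by rewrite scale1r.
Qed.

(** The product rule keeps this class closed under differentiation, which avoids the binomial
    formula for higher derivatives. *)
Inductive leibniz f g : ('rV[R]_d -> R[i]^o) -> Prop :=
| Leibniz_prod s t : leibniz f g (fun x => pderivs s f x * pderivs t g x)
| Leibniz_add h k : leibniz f g h -> leibniz f g k -> leibniz f g (fun x => h x + k x).

Lemma smoothM (O : set 'rV[R]_d) f g : open O -> smooth O f -> smooth O g ->
  smooth O (fun x => f x * g x).
Proof.
move=> oO sf sg.
have C1 h : leibniz f g h -> forall x, O x ->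
    {for x, continuous h} /\ forall i, pderivable i h x.
  elim=> [s t|{}h k _ IHh _ IHk] x Ox.
    split=> [|i]; first exact: continuous_mulC (sf s x Ox).1 (sg t x Ox).1.
    exact: (pderivM ((sf s x Ox).2 i) ((sg t x Ox).2 i)).1.
  have [ch dh] := IHh x Ox; have [ck dk] := IHk x Ox.
  split=> [|i]; first exact: continuous_addC ch ck.
  exact: (pderivD_at (dh i) (dk i)).1.
apply: (@smooth_class _ _ _ O (leibniz f g) oO C1 _); last exact: (Leibniz_prod f g [::] [::]).
move=> h i; elim=> [s t|{}h k Lh [h' Lh' hh'] Lk [k' Lk' kk']].
  exists (fun x => pderivs (i :: s) f x * pderivs t g x + pderivs s f x * pderivs (i :: t) g x).
    by apply: Leibniz_add; exact: Leibniz_prod.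
  by move=> x Ox; exact: (pderivM ((sf s x Ox).2 i) ((sg t x Ox).2 i)).2.
exists (fun x => h' x + k' x); first exact: Leibniz_add.
move=> x Ox; rewrite -(hh' x Ox) -(kk' x Ox).
exact: (pderivD_at ((C1 _ Lh x Ox).2 i) ((C1 _ Lk x Ox).2 i)).2.
Qed.

Lemma pderiv_coord (F : R -> R) (l : R) i j (c r : R) x :
  is_derive (c + r * x 0 i) (1 : R) F l ->
  pderivable j (fun y : 'rV[R]_d => (F (c + r * y 0 i))%:C : R[i]^o) x /\
  pderiv j (fun y : 'rV[R]_d => (F (c + r * y 0 i))%:C : R[i]^o) x =
   ((j == i)%:R * r * l)%:C.
Proof.
move=> dF; apply: pderiv_unique; set a : R := (j == i)%:R * r.
have E1 : diff_quotient j (fun y : 'rV[R]_d => (F (c + r * y 0 i))%:C : R[i]^o) x =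
    fun h : R => (h^-1 * (F (c + r * x 0 i + h * a) - F (c + r * x 0 i)))%:C.
  apply/funext => h; rewrite /diff_quotient /GRing.scale /= -rmorphB -rmorphM /=.
  congr ((_ * (F _ - _))%:C); rewrite !mxE eqxx /= /a [i == j]eq_sym; ring.
rewrite E1.
suff : (fun h : R => h^-1 * (F (c + r * x 0 i + h * a) - F (c + r * x 0 i))) @ 0^' --> a * l.
  move=> /cvgrPdist_lt H; apply/cvg_normRP => e /H; apply: filterS => h.
  by rewrite -rmorphB absC_real distrC.
have [a0|a0] := eqVneq a 0.
  rewrite a0 mul0r; have -> : (fun h : R => h^-1 * (F (c + r * x 0 i + h * 0) - F (c + r * x 0 i))) = fun=> 0.
    by apply/funext => h; rewrite mulr0 addr0 subrr mulr0.
  exact: cvg_cst.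
have dG : is_derive (0 : R) (1 : R) (fun h : R => F (c + r * x 0 i + h * a)) (l * a).
  have dlin : is_derive (0 : R) (1 : R) (fun h : R => c + r * x 0 i + h * a) a.
    apply: (@is_derive_quadratic _ _ _ _ 0) => h _.
    by rewrite (_ : _ - _ - _ = 0) ?normr0 ?mul0r//; ring.
  have df : is_derive ((fun h : R => c + r * x 0 i + h * a) 0) (1 : R) F l.
    by rewrite mul0r addr0.
  exact: (@is_derive1_comp R F (fun h : R => c + r * x 0 i + h * a) 0 l a df dlin).
have [dG1 dG2] := dG.
have : (fun h : R => h^-1 *: (((fun h : R => F (c + r * x 0 i + h * a)) \o shift 0) (h *: (1 : R)) - F (c + r * x 0 i + 0 * a))) @ 0^' --> l * a.
  by rewrite -dG2; exact: dG1.
rewrite [a * l]mulrC => H; rewrite (_ : (fun h : R => h^-1 * _) = fun h : R =>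
  h^-1 *: (((fun h : R => F (c + r * x 0 i + h * a)) \o shift 0) (h *: (1 : R)) -
    F (c + r * x 0 i + 0 * a))); first exact: H.
by apply/funext => h; rewrite /= /GRing.scale /= mulr1 !addr0 mul0r addr0.
Qed.

Lemma flats_smooth F i (c r : R) : flats F ->
  smooth setT (fun x : 'rV[R]_d => (F (c + r * x 0 i))%:C : R[i]^o).
Proof.
move=> fF; pose C := [set f : 'rV[R]_d -> R[i]^o | exists2 G, flats G &
  exists a, f = fun x => (a * G (c + r * x 0 i))%:C].
have dC (G : R -> R) a : flats G -> exists2 G', flats G' &
    forall u : R, is_derive u (1 : R) (fun u => a * G u) (a * G' u).
  by move=> /flats_derive[G' fG' dG]; exists G' => // u; exact: is_deriveZ.
apply: (@smooth_class _ _ _ setT C openT) => [_ [G fG [a ->]] x _|_ j [G fG [a ->]]|].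
- have [G' _ dG] := dC G a fG; split=> [|j]; last exact: (pderiv_coord j (dG _)).1.
  have cG : {for c + r * x 0 i, continuous (fun u => a * G u)}.
    by have [dGx _] := dG (c + r * x 0 i); exact/differentiable_continuous/derivable1_diffP.
  have cl : {for x, continuous (fun y : 'rV[R]_d => c + r * y 0 i)}.
    exact: (cvgD (cvg_cst c) (cvgM (cvg_cst r) (@coord_continuous R 1 d 0 i x))).
  apply: continuous_realC.
  exact: (@continuous_comp _ _ _ (fun y : 'rV[R]_d => c + r * y 0 i) (fun u => a * G u) x cl cG).
- have [G' fG' dG] := dC G a fG.
  exists (fun x => ((j == i)%:R * r * a * G' (c + r * x 0 i))%:C).
    by exists G' => //; exists ((j == i)%:R * r * a).
  by move=> x _; rewrite (pderiv_coord j (dG _)).2 mulrA.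
- exists F => //; exists 1; apply/funext => x.
  by rewrite mul1r.
Qed.

Lemma smooth_cst (a : R[i]^o) : smooth setT (fun _ : 'rV[R]_d => a).
Proof.
have dq b i x : diff_quotient i (fun _ : 'rV[R]_d => b : R[i]^o) x = fun=> 0.
  by apply/funext => h; rewrite /diff_quotient subrr scaler0.
apply: (@smooth_class _ _ _ setT [set f | exists b, f = fun=> b] openT) => [_ [b ->] x _|_ i [b ->]|].
- split=> [|i]; first exact: cst_continuous.
  by rewrite /pderivable dq; exact: is_cvg_cst.
- exists (fun=> 0) => [|x _]; first by exists 0.
  by apply: (pderiv_unique _).2; rewrite dq; exact: cvg_cst.
- by exists a.
Qed.

Lemma bump_exists (x0 : 'rV[R]_d) (r : R) : 0 < r ->
  exists b : 'rV[R]_d -> R, [/\ smooth setT (fun x => (b x)%:C : R[i]^o),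
    forall x, 0 <= b x, 0 < b x0 & forall x, r < `|x - x0| -> b x = 0].
Proof.
move=> r0.
(* Positive exactly when the i-th coordinates of [x] and [x0] differ by less than [r]; the product
   lives on a ball of the maximum norm. *)
pose b1 i (x : 'rV[R]_d) : R := flat 0 ((r - x0 0 i) + 1 * x 0 i) * flat 0 ((r + x0 0 i) + (-1) * x 0 i).
exists (fun x => \prod_(i < d) b1 i x); split.
- have -> : (fun x => (\prod_(i < d) b1 i x)%:C : R[i]^o) =
      fun x => \prod_(i <- enum 'I_d) (b1 i x)%:C.
    by apply/funext => x; rewrite rmorph_prod /= big_enum.
  have sflat i (c s : R) : smooth setT (fun x : 'rV[R]_d => (flat 0 (c + s * x 0 i))%:C : R[i]^o).
    have -> : (fun x : 'rV[R]_d => (flat 0 (c + s * x 0 i))%:C : R[i]^o) =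
        fun x => (1 * flat 0 (c + s * x 0 i))%:C by apply/funext => x; rewrite mul1r.
    exact: flats_smooth (Flats_scale 0 1).
  elim: (enum 'I_d) => [|i s IH].
    rewrite (_ : (fun x => _) = fun=> 1); first exact: smooth_cst.
    by apply/funext => x; rewrite big_nil.
  rewrite (_ : (fun x => _) = fun x => (b1 i x)%:C * \prod_(j <- s) (b1 j x)%:C); last first.
    by apply/funext => x; rewrite big_cons.
  apply: (smoothM openT _ IH); rewrite (_ : (fun x => _) = fun x =>
    (flat 0 ((r - x0 0 i) + 1 * x 0 i))%:C * (flat 0 ((r + x0 0 i) + (-1) * x 0 i))%:C).
    exact: (smoothM openT (sflat _ _ _) (sflat _ _ _)).
  by apply/funext => x; rewrite /b1 rmorphM.
- by move=> x; apply: prodr_ge0 => i _; rewrite mulr_ge0// flat_ge0.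
- apply: prodr_gt0 => i _; rewrite mulr_gt0// flat_gt0//.
    by rewrite mul1r subrK.
  by rewrite mulN1r addrK.
move=> x xr; have [i ix] : exists i, r <= `|(x - x0) 0 i|.
  apply: contrapT => /forallNP ni; move: xr; rewrite ltNge => /negP; apply.
  apply/ltW/rV_norm_lt => // i; rewrite ltNge; exact/negP/ni.
rewrite (bigD1 i)//= /b1.
suff [->|->] : flat 0 (r - x0 0 i + 1 * x 0 i) = 0 \/ flat 0 (r + x0 0 i + (-1) * x 0 i) = 0.
- by rewrite !mul0r.
- by rewrite mulr0 mul0r.
move: ix; rewrite !mxE; set a : R := x 0 i; set a0 : R := x0 0 i.
by have [h|h] := ler0P (a - a0) => ix; [left|right]; apply: flat_le0; lra.
Qed.

End SmoothProducts.

(** * Limits of solutions of hypoelliptic equations *)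

Section TestFunctions.
Context {R : realType} {d : nat}.
Implicit Types (f g F phi : 'rV[R]_d -> R[i]^o) (x y : 'rV[R]_d) (i : 'I_d) (s : seq 'I_d)
  (Omega K : set 'rV[R]_d).
Local Notation absC := (@normR R R[i]^o).

Lemma rV_compact_bounded K : compact K -> exists2 A : R, 0 <= A & forall x, K x -> `|x| <= A.
Proof.
move=> cK; have [|M MP] := @compact_near_bounded R _ K (fun x => `|x|) cK.
  by move=> x _; exact: norm_continuous.
exists (Num.max M 0); first by rewrite le_max lexx orbT.
by move=> x /MP xM; rewrite le_max xM.
Qed.

Lemma rV_compact_closed K : compact K -> closed K.
Proof. exact: compact_closed (@norm_hausdorff _ _). Qed.

Lemma ccsupp0 A : ccsupp A (fun _ : 'rV[R]_d => 0 : R[i]^o).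
Proof. by split => //; exact: cst_continuous. Qed.

Lemma complex_int0 : complex_int (fun _ : 'rV[R]_d => 0 : R[i]^o) = 0.
Proof.
apply: (@normR0_eq0 R R[i]^o); apply/eqP; rewrite eq_le normR_ge0 andbT.
have := complex_int_le (c := 0) (lexx 0) (ccsupp0 0); rewrite mulr0; apply => x.
by rewrite normR0.
Qed.

Section OnCompact.
Variables (Omega K : set 'rV[R]_d).
Hypothesis oOmega : open Omega.
Hypothesis cK : compact K.
Hypothesis KOmega : K `<=` Omega.

Let oKC : open (~` K).
Proof. by apply: closed_openC; exact: rV_compact_closed. Qed.

Lemma test_pderivs phi s : test_function_on K phi -> forall x, ~ K x -> pderivs s phi x = 0.
Proof.
by move=> [_ phi0] x; exact: (pderivs_eq0 s oKC phi0).
Qed.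

Lemma test_function_pderivs phi s : test_function_on K phi -> test_function_on K (pderivs s phi).
Proof.
move=> tphi; split; first by apply: smooth_pderivs; exact: tphi.1.
exact: test_pderivs.
Qed.

Lemma mul_test_ccsupp A F phi : (forall x, K x -> `|x| <= A) ->
  (forall x, Omega x -> {for x, continuous F}) -> test_function_on K phi ->
  ccsupp A (fun x => F x * phi x).
Proof.
move=> KA cF [sphi phi0]; split=> [x|x xA]; last first.
  by rewrite phi0 ?mulr0// => /KA; rewrite leNgt xA.
have [Kx|Kx] := pselect (K x).
  by apply: continuous_mulC; [exact/cF/KOmega|exact: (sphi [::] x I).1].
apply: (@continuous_at_local _ _ R[i]^o (~` K) (fun=> 0)) => //; last exact: cst_continuous.
by move=> y Ky; rewrite phi0// mulr0.
Qed.

(** [F] is arbitrary outside [Omega], but there the product is locally 0, the complement of [K]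
    being open. *)
Lemma mul_test_smooth F phi : smooth Omega F -> test_function_on K phi ->
  smooth setT (fun x => F x * phi x).
Proof.
move=> sF [sphi phi0] s x _; have [Kx|Kx] := pselect (K x).
  have sphi' : smooth Omega phi by apply: smooth_sub sphi.
  exact: (smoothM oOmega sF sphi' s (KOmega Kx)).
apply: (@smooth_local R d R[i]^o (~` K) (fun=> 0)) => //; last exact: (@smooth0 R d R[i]^o).
by move=> y Ky; rewrite phi0// mulr0.
Qed.

Lemma integration_by_parts_test F phi i : smooth Omega F -> test_function_on K phi ->
  complex_int (fun x => F x * pderiv i phi x) = - complex_int (fun x => pderiv i F x * phi x).
Proof.
move=> sF tphi; have [A A0 KA] := rV_compact_bounded cK.
have cF s x : Omega x -> {for x, continuous (pderivs s F)} by move=> Ox; exact: (sF s x Ox).1.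
have c1 := mul_test_ccsupp KA (cF [:: i]) tphi.
have c2 := mul_test_ccsupp KA (cF [::]) (test_function_pderivs [:: i] tphi).
have := complex_int_pderiv i A0 (mul_test_smooth sF tphi) (mul_test_ccsupp KA (cF [::]) tphi).
have -> : pderiv i (fun x => F x * phi x) = fun x => 1 *: (F x * pderiv i phi x) + pderiv i F x * phi x.
  apply/funext => x; rewrite scale1r; have [Kx|Kx] := pselect (K x).
    have dphi := (tphi.1 [::] x I).2 i.
    by rewrite (pderivM ((sF [::] x (KOmega Kx)).2 i) dphi).2 addrC.
  have H0 y : (~` K) y -> F y * phi y = 0 by move=> Ky; rewrite tphi.2 ?mulr0.
  have /= -> := pderivs_eq0 [:: i] oKC H0 Kx.
  have /= -> := test_pderivs [:: i] tphi Kx.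
  by rewrite tphi.2// !mulr0 addr0.
rewrite (complex_int_lin 1 A0 c2 c1) mul1r => /eqP; rewrite addr_eq0 => /eqP.
exact.
Qed.

Lemma integration_by_parts_seq F phi s : smooth Omega F -> test_function_on K phi ->
  complex_int (fun x => F x * pderivs s phi x) =
  (-1) ^+ size s * complex_int (fun x => pderivs s F x * phi x).
Proof.
move=> sF tphi.
(* The induction peels derivatives off [phi] from the outside and puts them on [F] in the opposite
   order. *)
have -> : complex_int (fun x => pderivs s F x * phi x) =
    complex_int (fun x => pderivs (rev s) F x * phi x).
  rewrite /complex_int; congr Complex; congr lebesgue_int; apply/funext => x;
    (have [Kx|Kx] := pselect (K x); last by rewrite tphi.2// !mulr0);
    by rewrite (pderivs_rev s oOmega sF)//; exact: KOmega.
elim: s F sF => [|i s IH] F sF; first by rewrite expr0 mul1r.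
rewrite /= (@integration_by_parts_test F (pderivs s phi) i sF (test_function_pderivs s tphi)).
rewrite (IH (pderiv i F)); last exact: (smooth_pderivs [:: i] sF).
rewrite exprS mulN1r mulNr; congr (- (_ * complex_int _)); apply/funext => x.
by rewrite rev_cons -cats1 /pderivs foldr_cat.
Qed.

Lemma complex_int_sum (T : Type) (l : seq T) (a : T -> R[i]) (h : T -> 'rV[R]_d -> R[i]^o) A :
  0 <= A -> (forall b, ccsupp A (h b)) ->
  ccsupp A (fun x => \sum_(b <- l) a b *: h b x) /\
  complex_int (fun x => \sum_(b <- l) a b *: h b x) = \sum_(b <- l) a b * complex_int (h b).
Proof.
move=> A0 hA; elim: l => [|b l [IHc IH]].
  have -> : (fun x => \sum_(b <- [::]) a b *: h b x) = fun=> 0 by apply/funext => x; rewrite big_nil.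
  by split; [exact: ccsupp0|rewrite big_nil complex_int0].
have -> : (fun x => \sum_(b <- b :: l) a b *: h b x) = fun x => a b *: h b x + \sum_(b <- l) a b *: h b x.
  by apply/funext => x; rewrite big_cons.
split; first exact: ccsupp_lin.
by rewrite (complex_int_lin (a b) A0 (hA b) IHc) IH big_cons.
Qed.

Lemma size_pderivm_seq (b : mpoly.multinom d) :
  size (flatten [seq nseq (mpoly.fun_of_multinom b i) i | i <- enum 'I_d]) = mpoly.mdeg b.
Proof.
rewrite size_flatten /shape -map_comp sumnE big_map mpoly.mdegE big_enum.
by apply: eq_bigr => i _; rewrite /= size_nseq.
Qed.

Lemma transpose_op_integral (P : mpoly.mpoly d R[i]) F phi : smooth Omega F ->
  test_function_on K phi ->
  complex_int (fun x => F x * transpose_op P phi x) =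
  complex_int (fun x => diff_op P F x * phi x).
Proof.
move=> sF tphi; have [A A0 KA] := rV_compact_bounded cK.
have cF s x : Omega x -> {for x, continuous (pderivs s F)} by move=> Ox; exact: (sF s x Ox).1.
have c1 b : ccsupp A (fun x => F x * pderivm b phi x).
  exact: (mul_test_ccsupp KA (cF [::]) (test_function_pderivs _ tphi)).
have c2 b : ccsupp A (fun x => pderivm b F x * phi x).
  exact: (mul_test_ccsupp KA (cF _) tphi).
have -> : (fun x => F x * transpose_op P phi x) = fun x =>
    \sum_(b <- mpoly.msupp P) ((-1) ^+ mpoly.mdeg b * mpoly.mcoeff b P) *: (F x * pderivm b phi x).
  apply/funext => x; rewrite /transpose_op mulr_sumr; apply: eq_bigr => b _.
  by rewrite /GRing.scale /= mulrCA.
have -> : (fun x => diff_op P F x * phi x) = fun x =>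
    \sum_(b <- mpoly.msupp P) (mpoly.mcoeff b P) *: (pderivm b F x * phi x).
  apply/funext => x; rewrite /diff_op mulr_suml; apply: eq_bigr => b _.
  by rewrite /GRing.scale /= mulrA.
rewrite (complex_int_sum _ _ A0 c1).2 (complex_int_sum _ _ A0 c2).2.
apply: eq_bigr => b _; rewrite /pderivm integration_by_parts_seq// size_pderivm_seq.
rewrite mulrA; congr (_ * _); rewrite mulrAC -expr2 sqrr_sign mul1r.
by [].
Qed.

End OnCompact.

(** Multiplied by the conjugate of [h x0], the function has positive real part near [x0], so its
    integral against a bump function there cannot vanish. *)
Lemma fundamental_lemma Omega (h : 'rV[R]_d -> R[i]^o) : open Omega ->
  (forall x, Omega x -> {for x, continuous h}) ->
  (forall phi, test_function Omega phi -> complex_int (fun x => h x * phi x) = 0) ->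
  forall x, Omega x -> h x = 0.
Proof.
move=> oO ch hphi x0 Ox0; apply: contrapT => /eqP hx0.
have conj_gt0 : 0 < complex.Re (((h x0 : R[i])^*)%C * h x0).
  move: hx0; case: (h x0) => a b; rewrite eq_complex /= negb_and => ab.
  have -> : a * a - - b * b = a ^+ 2 + b ^+ 2 by ring.
  case/orP: ab => ?.
    by rewrite ltr_pwDl ?sqr_ge0// lt_neqAle eq_sym sqrf_eq0 sqr_ge0 andbT.
  by rewrite ltr_wpDl ?sqr_ge0// lt_neqAle eq_sym sqrf_eq0 sqr_ge0 andbT.
set w : R[i] := ((h x0 : R[i])^*)%C in conj_gt0.
pose rho x := complex.Re (w * h x).
have crho : {for x0, continuous rho}.
  have cw : {for x0, continuous (fun x => w * h x : R[i]^o)}.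
    by apply: continuous_mulC; [exact: cst_continuous|exact: ch].
  exact: (cvg_comp _ _ cw (@Re_continuous R (w * h x0))).
have [r r0 rP] : exists2 r : R, 0 < r & forall x, `|x - x0| < r -> Omega x /\ 0 < rho x.
  apply/rV_nbhsP; apply: filterI; first exact: open_nbhs_nbhs.
  have /crho : nbhs (rho x0) [set z | 0 < z] by apply: open_nbhs_nbhs; split; [exact: open_gt|].
  by [].
have r2 : 0 < r / 2 by rewrite divr_gt0.
have rr := half_ltr r0.
have [b [sb b0 bx0 bsupp]] := bump_exists x0 r2.
pose K := [set x : 'rV[R]_d | `|x - x0| <= r / 2].
have KO : K `<=` Omega by move=> x xK; apply: (rP x _).1; exact: le_lt_trans rr.
have cK : compact K by exact: rV_closed_ball_compact.
pose phi x : R[i]^o := (b x)%:C.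
have tphi : test_function_on K phi.
  by split => // x /= xK; rewrite /phi bsupp// ltNge; exact/negP.
have [A A0 KA] := rV_compact_bounded cK.
have hc := mul_test_ccsupp cK KO KA ch tphi.
have := complex_int_lin w A0 hc (ccsupp0 A).
rewrite hphi; last by exists K.
rewrite mulr0 add0r => E1.
have E2 : lebesgue_int (fun x => complex.Re (w *: (h x * phi x) + 0)) = 0.
  have : complex.Re (complex_int (fun x => w *: (h x * phi x) + 0)) = 0.
    by rewrite E1 complex_int0.
  by [].
have [_ _ _ pos] := @lebesgue_int_props R d A A0.
have kE : (fun x => complex.Re (w *: (h x * phi x) + 0)) = fun x => rho x * b x.
  apply/funext => x; rewrite addr0 /GRing.scale /= mulrA [in LHS]cReM /=.
  by rewrite mulr0 subr0.
have crb : csupp A (fun x => rho x * b x).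
  by rewrite -kE; exact: ccsupp_Re (ccsupp_lin w hc (ccsupp0 A)).
suff : 0 < lebesgue_int (fun x => rho x * b x) by rewrite -kE E2 ltxx.
apply: (pos _ x0 crb).
- move=> x; have [xK|xK] := leP `|x - x0| (r / 2).
    by rewrite mulr_ge0// ltW// (rP x _).2// (le_lt_trans xK).
  by rewrite bsupp// mulr0.
by rewrite mulr_gt0.
Qed.

Lemma approximable_continuous Omega f : open Omega ->
  (forall K (e : R), compact K -> K `<=` Omega -> 0 < e ->
     exists2 F, smooth Omega F & forall x, K x -> absC (f x - F x) <= e) ->
  forall x, Omega x -> {for x, continuous f}.
Proof.
move=> oO fF x Ox U /normR_nbhsP[e e0 eU].
have [r r0 KO] := closed_ball_sub oO Ox.
pose K := [set y : 'rV[R]_d | `|y - x| <= r].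
have cK : compact K by exact: rV_closed_ball_compact.
have e3 : 0 < e / 4%:R by rewrite divr_gt0.
have [F sF FK] := fF K _ cK KO e3.
have /(_ [set z | absC (z - F x) < e / 4%:R]) := (sF [::] x Ox).1.
have nF : nbhs (F x) [set z | absC (z - F x) < e / 4%:R] by apply/normR_nbhsP; exists (e / 4%:R).
move=> /(_ nF) /rV_nbhsP[r' r'0 r'P].
apply/rV_nbhsP; exists (Num.min r r'); first by rewrite lt_min r'0 r0.
move=> y; rewrite lt_min => /andP[y1 y2]; apply: eU.
have h1 := FK y (ltW y1); have h2 := r'P y y2.
have h3 : absC (f x - F x) <= e / 4%:R by apply: FK; rewrite /K /= subrr normr0 ltW.
have := normR_distD (F y) (f y) (f x); have := normR_distD (F x) (F y) (f x).
rewrite [normR (F x - f x)]normRBC; move: h1 h2 h3 => /=.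
set a1 := normR _; set a2 := normR _; set a3 := normR _; set a4 := normR _; set a5 := normR _.
move=> *; lra.
Qed.

(* The distribution induced by f is a weak limit of solutions, hence a solution. *)
Lemma weak_limit_smooth Omega (P : mpoly.mpoly d R[i]) f : open Omega -> hypoelliptic P ->
  (forall K (e : R), compact K -> K `<=` Omega -> 0 < e ->
     exists F, [/\ smooth Omega F, forall x, Omega x -> diff_op P F x = 0 &
       forall x, K x -> absC (f x - F x) <= e]) ->
  smooth Omega f /\ forall x, Omega x -> diff_op P f x = 0.
Proof.
move=> oO hP fF.
have cf : forall x, Omega x -> {for x, continuous f}.
  apply: approximable_continuous => // K e cK KO e0.
  by have [F [sF _ FK]] := fF K e cK KO e0; exists F.
have lin a g (phi psi : 'rV[R]_d -> R[i]^o) :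
    (forall x, Omega x -> {for x, continuous g}) ->
    test_function Omega phi -> test_function Omega psi ->
    complex_int (fun x => g x * (a *: phi + psi) x) =
    a * complex_int (fun x => g x * phi x) + complex_int (fun x => g x * psi x).
  move=> cg [K [cK KO tphi]] [L [cL LO tpsi]].
  have [A A0 KA] := rV_compact_bounded cK; have [B B0 LB] := rV_compact_bounded cL.
  pose M := Num.max A B.
  have M0 : 0 <= M by rewrite le_max A0.
  have c1 : ccsupp M (fun x => g x * phi x).
    by apply: (mul_test_ccsupp cK KO) => // x /KA xA; rewrite le_max xA.
  have c2 : ccsupp M (fun x => g x * psi x).
    by apply: (mul_test_ccsupp cL LO) => // x /LB xB; rewrite le_max xB orbT.
  rewrite -(complex_int_lin a M0 c1 c2); congr complex_int; apply/funext => x.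
  by rewrite !fctE mulrDr /GRing.scale /= mulrCA.
pose u phi : R[i]^o := complex_int (fun x => f x * phi x).
have du : Defs.distribution Omega u.
  split=> [a phi psi tphi tpsi|K cK KO]; first exact: lin.
  have [A A0 KA] := rV_compact_bounded cK.
  have [|C CP] := @compact_near_bounded R _ K (fun x => absC (f x)) cK.
    move=> x /KO Ox; exact: (cvg_comp _ _ (cf x Ox) (@normR_continuous R R[i]^o (f x))).
  (* A distribution of order 0: the constant is the volume of a cube around [K] times a bound of [f]
     on [K], with 2 from real and imaginary part. *)
  exists (2 * (2 * A) ^+ d * `|C|), 0%N => phi tphi M MP.
  have phiM x : absC (phi x) <= M.
    have := MP mpoly.mnm0 x; rewrite mpoly.mdeg0 => /(_ isT).
    rewrite /pderivm; have -> : flatten [seq nseq (mpoly.fun_of_multinom mpoly.mnm0 i) i | i <- enum 'I_d] = [::].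
      by apply/size0nil; rewrite size_pderivm_seq mpoly.mdeg0.
    by [].
  have M0 : 0 <= M by apply: le_trans (phiM 0); exact: normR_ge0.
  rewrite -[leRHS]mulrA; apply: complex_int_le A0 (mul_test_ccsupp cK KO KA cf tphi) _ => x.
  rewrite absCM; have [Kx|Kx] := pselect (K x); last by rewrite tphi.2// normR0 mulr0 mulr_ge0.
  by rewrite ler_pM ?normR_ge0// (le_trans (CP x Kx))// ler_norm.
have Pf0 phi : test_function Omega phi -> complex_int (fun x => f x * transpose_op P phi x) = 0.
  move=> [K [cK KO tphi]]; have [A A0 KA] := rV_compact_bounded cK.
  have ctr F : (forall x, Omega x -> {for x, continuous F}) -> ccsupp A (fun x => F x * transpose_op P phi x).
    move=> cF.
    have -> : (fun x => F x * transpose_op P phi x) = fun x =>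
      \sum_(b <- mpoly.msupp P) ((-1) ^+ mpoly.mdeg b * mpoly.mcoeff b P) *: (F x * pderivm b phi x).
      apply/funext => x; rewrite /transpose_op mulr_sumr; apply: eq_bigr => b _.
      by rewrite /GRing.scale /= mulrCA.
    apply: (complex_int_sum _ _ A0 _).1 => b.
    exact: (mul_test_ccsupp cK KO KA cF (test_function_pderivs cK _ tphi)).
  have c1 : ccsupp A (transpose_op P phi).
    have := ctr (fun=> 1) (fun x _ => @cst_continuous _ _ _ x).
    by congr ccsupp; apply/funext => x; rewrite mul1r.
  have [M MP] := ccsupp_bounded c1.
  apply: (@normR0_eq0 R R[i]^o); apply/eqP; rewrite eq_le normR_ge0 andbT.
  apply/ler_addgt0Pr => e e0; rewrite add0r.
  have M0 : 0 <= M by apply: le_trans (MP 0); exact: normR_ge0.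
  have [c c0 cP] := small_multiple (2 * (2 * A) ^+ d * M) e0.
  have [F [sF PF FK]] := fF K _ cK KO c0.
  have cF x : Omega x -> {for x, continuous F} by move=> Ox; exact: (sF [::] x Ox).1.
  (* The solution [F] pairs to 0, so the pairing of [f] equals that of [f - F] and is at most a
     multiple of [c]. *)
  have F0 : complex_int (fun x => F x * transpose_op P phi x) = 0.
    rewrite (transpose_op_integral oO cK KO P sF tphi).
    have -> : (fun x => diff_op P F x * phi x) = fun=> 0.
      apply/funext => x; have [Kx|Kx] := pselect (K x); last by rewrite tphi.2// mulr0.
      by rewrite PF ?mul0r//; exact: KO.
    exact: complex_int0.
  have := complex_int_lin (-1) A0 (ctr F cF) (ctr f cf).
  rewrite F0 mulr0 add0r => <-.
  apply: (@le_trans _ _ (2 * (2 * A) ^+ d * M * c)); last by rewrite ltW// cP// lexx ltW.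
  rewrite -[leRHS]mulrA; apply: complex_int_le A0 (ccsupp_lin (-1) (ctr F cF) (ctr f cf)) _ => x.
  have -> : (-1) *: (F x * transpose_op P phi x) + f x * transpose_op P phi x =
      (f x - F x) * transpose_op P phi x.
    by rewrite scaleN1r mulrBl addrC.
  rewrite absCM mulrC; have [Kx|Kx] := pselect (K x).
    by rewrite ler_pM ?normR_ge0//; exact: FK.
  have -> : transpose_op P phi x = 0.
    rewrite /transpose_op big1// => b _.
    by rewrite /pderivm (test_pderivs cK _ tphi Kx) scaler0.
  by rewrite normR0 mul0r mulr_ge0// ltW.
have [|g sg gP] := hP Omega u oO du.
  exists 0; first exact: (@smooth0 R d R[i]^o).
  move=> phi tphi; rewrite /dist_op /u Pf0//.
  rewrite -complex_int0; congr complex_int; apply/funext => x.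
  by rewrite mul0r.
have cg x : Omega x -> {for x, continuous g} by move=> Ox; exact: (sg [::] x Ox).1.
(* Both functions are continuous and induce the same distribution. *)
have fg x : Omega x -> g x = f x.
  move=> Ox; apply/eqP; rewrite -subr_eq0; apply/eqP.
  have ch y : Omega y -> {for y, continuous (fun x => (-1) *: f x + g x : R[i]^o)}.
    move=> Oy; exact: (@cvg_lin R R[i]^o _ (nbhs y) _ (-1) f g _ _ (cf y Oy) (cg y Oy)).
  have := fundamental_lemma oO ch _ Ox; rewrite scaleN1r addrC; apply => phi tphi.
  have [K [cK KO tphi']] := tphi; have [A A0 KA] := rV_compact_bounded cK.
  have := complex_int_lin (-1) A0 (mul_test_ccsupp cK KO KA cf tphi') (mul_test_ccsupp cK KO KA cg tphi').
  rewrite -gP// /u mulN1r addNr => <-; congr complex_int; apply/funext => y.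
  by rewrite mulrDl -scalerAl.
have sf : smooth Omega f by exact: smooth_local oO fg sg.
(* Hypoellipticity gives smoothness alone; the equation follows by moving [P] back from the test
   functions to the now smooth [f]. *)
split; [exact: sf|apply: (fundamental_lemma oO) => [x Ox|phi tphi]].
  rewrite /diff_op; elim: (mpoly.msupp P) => [|b l IH].
    have -> : (fun x => \sum_(b <- [::]) mpoly.mcoeff b P *: pderivm b f x) = fun=> 0.
      by apply/funext => y; rewrite big_nil.
    exact: cst_continuous.
  have -> : (fun x => \sum_(b <- b :: l) mpoly.mcoeff b P *: pderivm b f x) =
      fun x => mpoly.mcoeff b P *: pderivm b f x + \sum_(b <- l) mpoly.mcoeff b P *: pderivm b f x.
    by apply/funext => y; rewrite big_cons.
  exact: (@cvg_lin R R[i]^o _ (nbhs x) _ (mpoly.mcoeff b P) (pderivm b f) _ _ _ (sf _ x Ox).1 IH).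
have [K [cK KO tphi']] := tphi.
by rewrite -(transpose_op_integral oO cK KO P sf tphi') Pf0.
Qed.

End TestFunctions.

(** * Weighted spaces of solutions *)

Section OpenSubtype.
Context {R : realType} {d : nat} {Omega : set 'rV[R]_d} {E : normedModType R[i]}.
Implicit Types (f : Omega -> E) (x y : Omega) (K : set Omega).

Lemma ext0_val f x : ext0 f (\val x) = f x.
Proof. by rewrite /ext0 /valL_ /= oinv_set_val valK. Qed.

Lemma ext0_out f (z : 'rV[R]_d) : ~ Omega z -> ext0 f z = 0.
Proof.
by move=> Oz; rewrite /ext0 /valL_ /= oinv_set_val insubN//; apply/negP => /set_mem.
Qed.

Lemma ext0_in f (z : 'rV[R]_d) (Oz : Omega z) : ext0 f z = f (SigSub (mem_set Oz)).
Proof. by rewrite -ext0_val. Qed.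

Lemma set_type_nbhsP x (U : set Omega) :
  nbhs x U <-> exists2 e : R, 0 < e & forall y, `|\val y - \val x| < e -> U y.
Proof.
split=> [|[e e0 eU]].
  rewrite nbhsE => -[B [[W oW <-] /= Wx] BU].
  have /rV_nbhsP[e e0 eW] : nbhs (\val x) W by exact: open_nbhs_nbhs.
  by exists e => // y /eW /BU.
have := @initial_continuous _ _ (set_val : Omega -> 'rV[R]_d) x [set z | `|z - \val x| < e].
have ne : nbhs (\val x) [set z | `|z - \val x| < e] by apply/rV_nbhsP; exists e.
by move=> /(_ ne) H; apply: (@filterS _ (nbhs x) _ _ U _ H) => y; exact: eU.
Qed.

Lemma compact_preimage_val (L : set 'rV[R]_d) : compact L -> L `<=` Omega ->
  compact ((\val : Omega -> 'rV[R]_d) @^-1` L).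
Proof.
move=> cL LO F PF FL.
have [z [Lz clz]] : L `&` cluster ((\val : Omega -> 'rV[R]_d) @ F) !=set0.
  by apply: cL; exact: FL.
exists (SigSub (mem_set (LO z Lz))); split=> // A B FA /set_type_nbhsP[e e0 eB].
have FvA : F (\val @^-1` (\val @` A)) by apply: (@filterS _ F _ A) => // t At; exists t.
have /clz : ((\val : Omega -> 'rV[R]_d) @ F) (\val @` A) by exact: FvA.
move=> /(_ [set w | `|w - z| < e])[|_ [[t At <-] tz]]; first by apply/rV_nbhsP; exists e.
by exists t; split=> //; apply: eB.
Qed.

Lemma compact_exhaustion : open Omega -> exists L : nat -> set Omega,
  (forall n, compact (L n)) /\
  forall K, compact K -> exists N, forall n, (N <= n)%N -> K `<=` L n.
Proof.
move=> oO.
pose L n := [set x : 'rV[R]_d | `|x| <= n%:R /\ forall y : 'rV[R]_d, ~ Omega y -> n.+1%:R^-1 <= `|x - y|].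
have LO n : L n `<=` Omega.
  move=> x [_ xL]; apply: contrapT => /xL.
  by rewrite subrr normr0 leNgt invr_gt0 ltr0n.
have cdist (y : 'rV[R]_d) : continuous (fun x : 'rV[R]_d => `|x - y|).
  by move=> x; exact: (cvg_norm (cvgB (@cvg_id _ (nbhs x)) (cvg_cst y))).
have cL n : compact (L n).
  apply: bounded_closed_compact.
    exists n%:R; split; first exact: num_real.
    by move=> M nM x [xn _]; exact: le_trans xn (ltW nM).
  have -> : L n = [set x | `|x| <= n%:R] `&`
      \bigcap_(y in ~` Omega) [set x | n.+1%:R^-1 <= `|x - y|].
    by apply/seteqP; split=> x [xn xL]; split => // y /xL.
  apply: closedI.
    have -> : [set x : 'rV[R]_d | `|x| <= n%:R] = (fun z : 'rV[R]_d => `|z|) @^-1` [set r : R | r <= n%:R] by [].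
    by apply: preimage_closed => [x _|]; [exact: norm_continuous|exact: closed_le].
  apply: closed_bigI => y _.
  have -> : [set x : 'rV[R]_d | n.+1%:R^-1 <= `|x - y|] =
    (fun z : 'rV[R]_d => `|z - y|) @^-1` [set r : R | n.+1%:R^-1 <= r] by [].
  by apply: preimage_closed => [x _|]; [exact: cdist|exact: closed_ge].
exists (fun n => \val @^-1` L n); split=> [n|K].
  exact: compact_preimage_val.
move=> /compact_near_coveringP cK.
have : \forall n \near \oo, K `<=` (\val @^-1` L n).
  apply: cK => x Kx.
  have /rV_nbhsP[r r0 rO] : nbhs (\val x) Omega.
    by apply: open_nbhs_nbhs; split => //; exact: set_valP.
  have r2 : 0 < r / 2 by rewrite divr_gt0.
  exists ([set y | `|\val y - \val x| < r / 2],
      [set n | (n.+1%:R^-1 < r / 2) /\ `|\val x| + r / 2 <= n%:R]).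
    split; first by apply/set_type_nbhsP; exists (r / 2).
    apply: filterI.
      by have := near_infty_natSinv_lt (PosNum r2); apply: filterS.
    exact: nbhs_infty_ger.
  move=> [y n] /= [yx [n1 n2]]; split.
    rewrite -[\val y](subrK (\val x)) (le_trans (ler_normD _ _))//.
    by rewrite (le_trans _ n2)// addrC lerD2l ltW.
  move=> z Oz; have : r <= `|z - \val x| by rewrite leNgt; apply/negP => /rO.
  have := ler_distD (\val y) z (\val x); rewrite (distrC (\val y) z) => h1 h2.
  move: n1 yx h1 h2; set a : R := n.+1%:R^-1; set b : R := `|_|; set c : R := `|_|; set b' : R := `|_|.
  move=> *; lra.
by move=> [N _ NP]; exists N => n /NP.
Qed.

Lemma family_nbhsP f (U : set (Omega -> E)) :
  nbhs (f : {family compact, Omega -> E}) U <->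
  exists K, exists2 e : R, compact K /\ 0 < e &
    forall g : Omega -> E, (forall x, K x -> normR (g x - f x) < e) -> U g.
Proof.
split=> [nU|[K [e [cK e0] eU]]]; last first.
  have ee : (0 : R[i]) < e%:C by rewrite ltcR.
  have := @fam_nbhs _ E compact K _ f (entourage_ball E (PosNum ee)) cK.
  apply: filterS => g gK; apply: eU => x Kx; have := gK x Kx.
  by rewrite -ball_normE /= normRC ltcR normRBC.
(* For the forward direction: the filter of uniform neighbourhoods on compact sets converges to [f],
   so it contains every neighbourhood of [f]. *)
pose F := filter_from [set Ke : set Omega * R | compact Ke.1 /\ 0 < Ke.2]
  (fun Ke => [set g : Omega -> E | forall x, Ke.1 x -> normR (g x - f x) < Ke.2]).
have FF : Filter F.
  apply: filter_from_filter; first by exists (set0, 1); split => //; exact: compact0.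
  move=> [K e] [L r] [/= cK e0] [/= cL r0]; exists (K `|` L, Num.min e r).
    by split; [exact: compactU|rewrite /= lt_min e0].
  move=> g /= gKL; split=> x /= xK.
    by have := gKL x (or_introl xK); rewrite lt_min => /andP[].
  by have := gKL x (or_intror xK); rewrite lt_min => /andP[].
have : {family compact, F --> f}.
  apply/fam_cvgP => A cA W /uniform_nbhs[D [entD DW]].
  move: entD; rewrite -entourage_from_ballE => -[_ /= /posC_real[e e0 ->] eD].
  exists (A, e) => //.
  move=> g gA; apply: DW => x Ax; apply: eD => /=.
  by rewrite -ball_normE /= normRC ltcR normRBC; exact: gA.
move=> /(_ U nU)[[K e] [/= cK e0] eU].
by exists K, e.
Qed.

End OpenSubtype.

(** * Weighted seminorms and the Saks space structure *)

Section WeightedSeminorms.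
Context {R : realType} {d : nat} {Omega : set 'rV[R]_d} (oOmega : open Omega).
Context (v : Omega -> {posnum R}) (P : mpoly.mpoly d R[i]) (E : normedModType R[i]).
Local Notation X := (CPv_space oOmega v P E).
Local Notation nm := (CPv_norm oOmega v P E).
Implicit Types (f g : X) (x : Omega) (A B K : set Omega).

Lemma CPv_spaceP f : CPv v P E f.
Proof. by case: f => f /=; rewrite inE. Qed.

Lemma CPv_spaceB f g x : (f - g : X) x = f x - g x.
Proof. by []. Qed.

Definition weighted_sup A f : R := sup [set normR (f x) * (v x)%:num | x in A].

Lemma weighted_ge A f x : A x -> normR (f x) * (v x)%:num <= weighted_sup A f.
Proof.
move=> Ax; apply: ub_le_sup; last by exists x.
have [_ _ [M MP]] := CPv_spaceP f.
by exists M => _ [y _ <-].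
Qed.

Lemma weighted_le A f (c : R) : 0 <= c ->
  (forall x, A x -> normR (f x) * (v x)%:num <= c) -> weighted_sup A f <= c.
Proof.
(* The supremum of the empty set is 0, which is why [c] has to be non-negative. *)
move=> c0 Ac; have [->|/set0P[x Ax]] := eqVneq A set0.
  by rewrite /weighted_sup image_set0 sup0.
by apply: ge_sup => [|_ [y Ay <-]]; [exists (normR (f x) * (v x)%:num), x|exact: Ac].
Qed.

Lemma weighted_ge0 A f : 0 <= weighted_sup A f.
Proof.
have [->|/set0P[x Ax]] := eqVneq A set0.
  by rewrite /weighted_sup image_set0 sup0.
by apply: le_trans (weighted_ge f Ax); rewrite mulr_ge0// normR_ge0.
Qed.

Lemma weighted_seminorm A : seminorm (weighted_sup A).
Proof.
apply: seminorm_of_le => [f|f g|a f]; first exact: weighted_ge0.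
  apply: weighted_le => [|x Ax]; first by rewrite addr_ge0// weighted_ge0.
  apply: le_trans (lerD (weighted_ge f Ax) (weighted_ge g Ax)).
  by rewrite -mulrDl ler_pM2r//; exact: normRD.
apply: weighted_le => [|x Ax]; first by rewrite mulr_ge0 ?normR_ge0// weighted_ge0.
by rewrite normR_scale -mulrA ler_wpM2l ?normR_ge0//; exact: weighted_ge.
Qed.

Lemma weighted_subset A B f : A `<=` B -> weighted_sup A f <= weighted_sup B f.
Proof.
move=> AB; apply: weighted_le => [|x /AB]; [exact: weighted_ge0|exact: weighted_ge].
Qed.

Lemma CPv_norm_ge f x : normR (f x) * (v x)%:num <= nm f.
Proof. exact: (@weighted_ge setT). Qed.

Lemma CPv_norm_le f c : 0 <= c -> (forall x, normR (f x) * (v x)%:num <= c) -> nm f <= c.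
Proof. by move=> c0 fc; apply: (@weighted_le setT). Qed.

Lemma CPv_norm_seminorm : seminorm nm.
Proof. exact: weighted_seminorm. Qed.

Lemma CPv_norm_is_norm : is_norm nm.
Proof.
split; first exact: CPv_norm_seminorm.
move=> f f0; apply: val_inj; apply/funext => x; apply: normR0_eq0.
have := CPv_norm_ge f x; rewrite f0 pmulr_lle0// => fx.
by apply/eqP; rewrite eq_le fx normR_ge0.
Qed.

Definition weighted_seminorms (S : set (set Omega)) : set (X -> R) :=
  [set p | exists2 A, S A & p = weighted_sup A].

Lemma weighted_seminormsP S : seminorms (weighted_seminorms S).
Proof. by move=> _ [A _ ->]; exact: weighted_seminorm. Qed.

Lemma weighted_seminorms_le S p f : weighted_seminorms S p -> p f <= nm f.
Proof. by move=> [A _ ->]; exact: weighted_subset. Qed.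

Section Family.
Variable S : set (set Omega).
Hypothesis S0 : S set0.
Hypothesis SU : forall A B, S A -> S B -> S (A `|` B).
Hypothesis S1 : forall x, S [set x].

Lemma weighted_directed : directed_seminorms (weighted_seminorms S).
Proof.
split; first by exists (weighted_sup set0), set0.
move=> _ _ [A SA ->] [B SB ->]; exists (weighted_sup (A `|` B)).
  by exists (A `|` B) => //; exact: SU.
by move=> f; split; apply: weighted_subset => x Ax; [left|right].
Qed.

Lemma weighted_norm_sup f :
  ((nm f)%:E = ereal_sup [set (p f)%:E | p in weighted_seminorms S])%E.
Proof.
set s := ereal_sup _.
have ub p : weighted_seminorms S p -> ((p f)%:E <= s)%E.
  by move=> Sp; apply: ereal_sup_ubound; exists p.
have s_le : (s <= (nm f)%:E)%E.
  apply: ge_ereal_sup => _ [p Sp <-].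
  by rewrite lee_fin; exact: weighted_seminorms_le Sp.
apply/eqP; rewrite eq_le s_le andbT.
(* The member [set0] keeps the supremum away from minus infinity even if [Omega] has no point. *)
have s0 : (0%:E <= s)%E.
  apply: le_trans (ub _ (ex_intro2 _ _ set0 S0 erefl)).
  by rewrite lee_fin weighted_ge0.
case: s ub s_le s0 => [c|//|//] ub _ c0; rewrite lee_fin.
apply: CPv_norm_le => // x; rewrite -lee_fin.
apply: le_trans (ub (weighted_sup [set x]) _); last by exists [set x].
by rewrite lee_fin; exact: weighted_ge.
Qed.

Lemma tau_fam_saks_system :
  saks_system nm (tau_fam oOmega v P E S) (weighted_seminorms S).
Proof.
split=> //; [|exact: weighted_directed|exact: weighted_norm_sup].
move=> q Sq; split; first exact: weighted_seminormsP Sq.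
exact: (continuous_seminorm weighted_directed (@weighted_seminormsP S)).
Qed.

End Family.

Hypothesis v_cont : continuous (fun x => (v x)%:num).
Local Notation Gamma := (weighted_seminorms compact).
Local Notation tau := (tau_co oOmega v P E).

Lemma compact_directed : directed_seminorms Gamma.
Proof. by apply: weighted_directed; [exact: compact0|move=> ? ?; exact: compactU]. Qed.

Lemma compact_norm_sup f : ((nm f)%:E = ereal_sup [set (p f)%:E | p in Gamma])%E.
Proof. by apply: weighted_norm_sup; [exact: compact0|move=> x; exact: compact_set1]. Qed.

(** Continuity of [v] enters here: on a compact set the weight is bounded above and away from 0, so
    weighted and unweighted suprema are comparable. *)
Lemma weight_bounded K : compact K ->
  exists2 C : R, 0 < C & forall x, K x -> (v x)%:num <= C /\ ((v x)%:num)^-1 <= C.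
Proof.
move=> cK.
have [C CP] := compact_near_bounded cK (fun x _ => @v_cont x).
have [|D DP] := @compact_near_bounded R _ K (fun x => ((v x)%:num)^-1) cK.
  by move=> x _; exact: (cvgV _ (@v_cont x)).
exists (Num.max 1 (Num.max C D)); first by rewrite lt_max ltr01.
by move=> x Kx; rewrite !le_max CP// DP// !orbT.
Qed.

Lemma tau_co_nbhsP f (U : set X) : nbhs (f : top_space tau) U <->
  exists K, exists2 e : R, compact K /\ 0 < e &
    forall g : X, (forall x, K x -> normR (g x - f x) < e) -> U g.
Proof.
split=> [|[K [e [cK e0] eU]]].
  rewrite nbhsE => -[B [[V oV <-] /= Vf] BU].
  have /family_nbhsP[K [e Ke eV]] :
    nbhs (f : {family compact, Omega -> E}) V by exact: open_nbhs_nbhs.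
  by exists K, e => // g /eV /BU.
have : nbhs ((f : Omega -> E) : {family compact, Omega -> E})
    [set g | forall x, K x -> normR (g x - f x) < e].
  by apply/family_nbhsP; exists K, e.
rewrite !nbhsE => -[V [oV Vf] VU].
exists ((fun f : X => f : Omega -> E) @^-1` V); last by move=> g /VU; exact: eU.
by split => //; exists V.
Qed.

Lemma tau_coE : tau = seminorm_topology Gamma.
Proof.
apply: topology_eq; apply/seteqP; split=> U oU.
  move=> f Uf.
  have /tau_co_nbhsP[K [e [cK e0] eU]] : nbhs (f : top_space tau) U.
    by apply: open_nbhs_nbhs; split.
  have [C C0 CP] := weight_bounded cK.
  exists [set weighted_sup K], (e / C); split; first exact: finite_set1.
  - by move=> _ ->; exists K.
  - exact: divr_gt0.
  - move=> g /(_ _ erefl) gf; apply: eU => x Kx.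
    have := le_lt_trans (weighted_ge (g - f) Kx) gf.
    rewrite CPv_spaceB -ltr_pdivlMr// => h; rewrite (lt_le_trans h)//.
    rewrite -mulrA [C^-1 * _]mulrC; apply: ler_piMr; first exact: ltW.
    by rewrite ler_pdivrMr// mul1r (CP x Kx).2.
suff : @open (top_space tau) U by [].
rewrite openE => f Uf.
have /(nbhs_seminormP _ _ compact_directed (@weighted_seminormsP _))
    [_ [e [[K cK ->] e0] eU]] :
    nbhs (f : top_space (seminorm_topology Gamma)) U.
  by apply: open_nbhs_nbhs; split.
have [C C0 CP] := weight_bounded cK.
have e2 : 0 < e / 2 by rewrite divr_gt0.
apply/tau_co_nbhsP; exists K, (e / 2 / C); first by split => //; exact: divr_gt0.
move=> g gf; apply: eU.
apply: (@le_lt_trans _ _ (e / 2)); last exact: half_ltr.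
apply: weighted_le => [|x Kx]; first exact: ltW.
rewrite CPv_spaceB -[leRHS](divfK (lt0r_neq0 C0)).
by rewrite ler_pM ?normR_ge0// ?(CP x Kx).1// ltW// gf.
Qed.

Lemma CPv_saks_system : saks_system nm tau Gamma.
Proof.
rewrite tau_coE; apply: tau_fam_saks_system.
- exact: compact0.
- by move=> ? ?; exact: compactU.
- by move=> x; exact: compact_set1.
Qed.

Lemma CPv_saks_space : saks_space nm tau.
Proof.
have dG := compact_directed; have sG := @weighted_seminormsP compact.
split; [exact: CPv_norm_is_norm| | | |by exists Gamma; exact: CPv_saks_system];
  rewrite tau_coE.
- exact: seminorm_topology_locally_convex.
- apply: seminorm_topology_hausdorff => // f f0.
  apply: CPv_norm_is_norm.2; apply/eqP; rewrite eq_le weighted_ge0 andbT.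
  apply: CPv_norm_le => // x; rewrite -(f0 (weighted_sup [set x])); first exact: weighted_ge.
  by exists [set x] => //; exact: compact_set1.
- apply: seminorm_topology_le => //.
  + by split; [exists nm|move=> _ _ -> ->; exists nm].
  + by move=> _ ->; exact: CPv_norm_seminorm.
  + move=> q Gq; exists nm => // e e0; exists e => // f.
    by apply: le_lt_trans; exact: weighted_seminorms_le Gq.
Qed.

Lemma CPv_mixed_topology : is_mixed_topology nm tau (mixed_topology nm Gamma).
Proof.
rewrite tau_coE; apply: mixed_topologyP.
- exact: CPv_norm_seminorm.
- exact: weighted_seminormsP.
- exact: compact_directed.
- by move=> p f; exact: weighted_seminorms_le.
Qed.

Lemma CPv_C_sequential : C_sequential_saks nm tau.
Proof.
exists (mixed_topology nm Gamma); first exact: CPv_mixed_topology.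
have [L [cL LP]] := compact_exhaustion oOmega.
apply: (@mixed_C_sequential R X nm Gamma CPv_norm_seminorm (@weighted_seminormsP compact)
  compact_directed (fun n => weighted_sup (L n))) => [n|_ [K cK ->]].
  by exists (L n).
have [N NP] := LP K cK; exists N => n f nN.
exact/weighted_subset/NP.
Qed.

End WeightedSeminorms.

(** * Scalar solutions: completeness and compact balls *)

Section ScalarSolutions.
Context {R : realType} {d : nat} {Omega : set 'rV[R]_d} (oOmega : open Omega).
Context (v : Omega -> {posnum R}) (v_cont : continuous (fun x => (v x)%:num)).
Context (P : mpoly.mpoly d R[i]) (hP : hypoelliptic P).
Local Notation X := (CPv_space oOmega v P R[i]^o).
Local Notation nm := (CPv_norm oOmega v P R[i]^o).
Local Notation Gamma := (@weighted_seminorms R d Omega oOmega v P R[i]^o compact).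
Local Notation tau := (tau_co oOmega v P R[i]^o).
Local Notation absC := (@normR R R[i]^o).
Implicit Types (f g : X) (x y : Omega) (K : set Omega).

Lemma CPv_limit (h : Omega -> R[i]^o) (M : R) :
  (forall K (e : R), compact K -> 0 < e -> exists g : X, forall x, K x -> absC (h x - g x) <= e) ->
  (forall x, absC (h x) * (v x)%:num <= M) -> exists f : X, (f : Omega -> R[i]^o) = h.
Proof.
move=> happrox hM.
have hC : h \in CPv_pred v P (E := R[i]^o).
  rewrite inE; have [|sh Ph] := weak_limit_smooth (f := ext0 h) oOmega hP.
    move=> L e cL LO e0.
    have [g gP] := happrox _ e (compact_preimage_val cL LO) e0.
    have [sg Pg _] := CPv_spaceP g.
    exists (ext0 g); split => // z Lz; have Oz := LO z Lz.
    by rewrite !(ext0_in _ Oz); exact: gP.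
  by split => //; exists M.
by exists (CPvSpace oOmega hC).
Qed.

Lemma CPv_norm_point f x : absC (f x) <= nm f * ((v x)%:num)^-1.
Proof. by rewrite ler_pdivlMr//; exact: CPv_norm_ge. Qed.

(** Norm completeness with a rate, the form asked for by [uniform_boundedness]. Norm convergence is
    uniform on compact sets, so [CPv_limit] recognises the pointwise limit as a solution. *)
Lemma CPv_norm_complete (u : nat -> X) (r : nat -> R) : r @ \oo --> 0 ->
  (forall n m, (n <= m)%N -> nm (u m - u n) <= r n) ->
  exists f : X, forall n, nm (f - u n) <= r n.
Proof.
move=> r0 ur.
have r_ge0 n : 0 <= r n by apply: le_trans (ur n n (leqnn n)); exact: weighted_ge0.
have lim_ex x : exists l : R[i]^o, forall n, absC (l - u n x) <= r n * ((v x)%:num)^-1.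
  have [| |l [_ lP]] := @banach_cvg_seq R R[i]^o (fun n => u n x)
      (fun n => r n * ((v x)%:num)^-1) (@banach_complex R).
  - by have := cvgM r0 (@cvg_cst _ ((v x)%:num)^-1 _ \oo _); rewrite mul0r; apply.
  - move=> n m nm_; have := CPv_norm_point (u m - u n) x.
    by move=> h; apply: le_trans h _; rewrite ler_pM2r ?invr_gt0//; exact: ur.
  by exists l.
have [h hP'] := choice lim_ex.
have [|x|f fh] := @CPv_limit h (r 0%N + nm (u 0%N)).
- move=> K e cK e0; have [C C0 CP] := weight_bounded v_cont cK.
  have /(cvgrPdist_lt _ _) /(_ (e / C) (divr_gt0 e0 C0)) [n _ /(_ n (leqnn n))] := r0.
  rewrite /= sub0r normrN ger0_norm// => rn.
  exists (u n) => x Kx; apply: le_trans (hP' x n) _.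
  rewrite -[leRHS](divfK (lt0r_neq0 C0)).
  by rewrite ler_pM ?invr_ge0// ?(CP x Kx).2// ltW.
- have := hP' x 0%N; rewrite ler_pdivlMr// => h0.
  rewrite -[h x](subrK (u 0%N x)); apply: (@le_trans _ _ ((absC (h x - u 0%N x) + absC (u 0%N x)) * (v x)%:num)).
    by rewrite ler_pM2r//; exact: normRD.
  by rewrite mulrDl lerD//; exact: CPv_norm_ge.
exists f => n; apply: CPv_norm_le => // x.
by rewrite CPv_spaceB fh -ler_pdivlMr.
Qed.

(* Banach-Steinhaus for the difference quotients at x. *)
Lemma CPv_equi_lipschitz x : exists2 r : R, 0 < r & exists C : R, forall f y,
  `|\val y - \val x| < r -> absC (f y - f x) <= C * nm f * `|\val y - \val x|.
Proof.
have [r r0 rO] := closed_ball_sub oOmega (set_valP x); exists r => //.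
(* The indices of the difference quotients at [x]; each quotient is bounded by evaluation at two
   points. *)
pose A := [set y : Omega | `|\val y - \val x| < r /\ 0 < `|\val y - \val x|].
pose q y f := absC (f y - f x) * `|\val y - \val x|^-1.
have [| | | | | | | | | | |C CP] := @uniform_boundedness R X setT nm Omega A q.
- by [].
- by [].
- by move=> f _; exact: weighted_ge0.
- exact: (seminorm0 (CPv_norm_seminorm _ _ _ _)).
- by move=> f g _ _; exact: (CPv_norm_seminorm _ _ _ _).1.
- by move=> a f _; rewrite (seminormZ a f (CPv_norm_seminorm _ _ _ _)).
- move=> u s _ s0 us; have [f fP] := CPv_norm_complete s0 us.
  by exists f.
- move=> y f g; rewrite /q -mulrDl ler_wpM2r ?invr_ge0//.
  have -> : (f + g : X) y - (f + g : X) x = (f y - f x) + (g y - g x).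
    by rewrite [LHS]/= opprD addrACA.
  exact: normRD.
- move=> y a f; rewrite /q mulrA -absC_real -normR_scale; congr (absC _ * _).
  by rewrite scalerBr.
- move=> y _; exists ((((v y)%:num)^-1 + ((v x)%:num)^-1) * `|\val y - \val x|^-1) => f _.
  rewrite /q mulrAC ler_wpM2r ?invr_ge0// mulrC mulrDr.
  exact: le_trans (normRB _ _) (lerD (CPv_norm_point f y) (CPv_norm_point f x)).
(* Pointwise boundedness: a single solution is smooth, hence Lipschitz at [x] on the ball. *)
- move=> f _; have [sf _ _] := CPv_spaceP f.
  have [C C0 CP] := smooth_lipschitz_ball oOmega sf r0 rO.
  exists C => y [yr y0]; rewrite /q ler_pdivrMr//.
  by have := CP (\val y) (ltW yr); rewrite !ext0_val.
exists C => f y yr; have [y0|y0] := ltP 0 `|\val y - \val x|.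
  by rewrite -ler_pdivrMr//; exact: CP.
have /eqP : `|\val y - \val x| = 0 by apply/eqP; rewrite eq_le y0 normr_ge0.
rewrite normr_eq0 subr_eq0 => /eqP/val_inj ->.
by rewrite !subrr normr0 mulr0 normR0.
Qed.

(** Arzela-Ascoli with ultrafilters: bounded values give a pointwise limit [h], the equi-Lipschitz
    estimate makes the convergence uniform on compact sets, and [CPv_limit] turns [h] into a
    solution. *)
Lemma CPv_ball_compact (M : R) :
  compact ([set f | nm f <= M] : set (top_space (seminorm_topology Gamma))).
Proof.
rewrite -(tau_coE oOmega P R[i]^o v_cont) compact_ultra => F UF FM.
have FF : Filter F by exact: filter_filter.
have ex x : exists l : R[i]^o, forall e : R, 0 < e -> F [set f : X | absC (f x - l) < e].
  pose B := M * ((v x)%:num)^-1.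
  have part (L : R[i]^o -> R) : (forall z, `|L z| <= absC z) ->
      exists l : R, (fun f : X => L (f x)) @ F --> l.
    move=> LB; have : compact `[- B, B] by exact: segment_compact.
    have FB : F [set f : X | L (f x) \in `[- B, B]].
      apply: filterS FM => f /= fM; rewrite in_itv /= -ler_norml.
      apply: le_trans (LB _) _; apply: le_trans (CPv_norm_point f x) _.
      by rewrite ler_pM2r// invr_gt0.
    move=> /(_ ((fun f : X => L (f x)) @ F) _ FB)[l [_ ll]]; exists l => W lW.
    have [//|FW] := in_ultra_setVsetC ((fun f : X => L (f x)) @^-1` W) UF.
    have [z [/= nW Wz]] := ll (~` W) W FW lW.
    by [].
  have [a Fa] := part _ (@absC_Re R); have [b Fb] := part _ (@absC_Im R).
  have := @cvg_ReIm R X F FF (fun f : X => f x) (a +i* b) Fa Fb.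
  move=> Fab; exists (a +i* b) => e e0.
  suff : nbhs ((a +i* b)%C : R[i]^o) [set z | absC (z - (a +i* b)%C) < e] by move=> /Fab.
  by apply/normR_nbhsP; exists e.
have [h hF] := choice ex.
have M_ge0 : 0 <= M.
  by have [f /= fM] := filter_ex FM; apply: le_trans fM; exact: weighted_ge0.
have unif K (e : R) : compact K -> 0 < e ->
    F [set f : X | forall x, K x -> absC (f x - h x) < e].
  move=> /compact_near_coveringP cK e0.
  apply: (cK X F (fun (f : X) x => absC (f x - h x) < e)) => x Kx.
  have [r r0 [C CP]] := CPv_equi_lipschitz x.
  (* Five steps of size at most [e / 6] lead from [f y] through [f x], [h x], [g x] and [g y] to
     [h y]. *)
  have e6 : 0 < e / 6%:R by rewrite divr_gt0.
  pose D := Num.max C 0 * M + 1.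
  have D0 : 0 < D by rewrite ltr_wpDl// mulr_ge0// le_max lexx orbT.
  have close f y : nm f <= M -> `|\val y - \val x| < r ->
      `|\val y - \val x| < e / 6%:R / D -> absC (f y - f x) <= e / 6%:R.
    move=> fM yr yD; apply: le_trans (CP f y yr) _.
    have CD : C * nm f <= D.
      apply: (@le_trans _ _ (Num.max C 0 * nm f)).
        by rewrite ler_wpM2r ?le_max ?lexx//; exact: weighted_ge0.
      apply: (@le_trans _ _ (Num.max C 0 * M)); last by rewrite lerDl.
      by rewrite ler_wpM2l// le_max lexx orbT.
    rewrite -[leRHS](divfK (lt0r_neq0 D0)) mulrC.
    apply: (@le_trans _ _ (`|\val y - \val x| * D)); first by rewrite ler_wpM2l.
    by rewrite ler_pM2r// ltW.
  exists ([set y | `|\val y - \val x| < Num.min r (e / 6%:R / D)],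
      [set f | nm f <= M] `&` [set f | absC (f x - h x) < e / 6%:R]).
    split; last by apply: filterI => //; exact: hF.
    apply/set_type_nbhsP; exists (Num.min r (e / 6%:R / D)) => //.
    by rewrite lt_min r0 divr_gt0.
  move=> [y f] /= [yx [fM fx]]; move: yx; rewrite lt_min => /andP[yr yD].
  (* No continuity of [h] is available yet, so [h x] and [h y] are compared through a member of the
     ball that is close to [h] at both points. *)
  have [g [/= gM [gx gy]]] := filter_ex (filterI FM (filterI (hF x _ e6) (hF y _ e6))).
  have h1 := close f y fM yr yD; have h2 := close g y gM yr yD.
  have h3 := normR_distD (f x) (f y) (h y); have h4 := normR_distD (h x) (f x) (h y).
  have h5 := normR_distD (g x) (h x) (h y); have h6 := normR_distD (g y) (g x) (h y).
  move: gx; rewrite normRBC => gx.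
  move: h2; rewrite normRBC => h2.
  move: gx gy h1 h2 h3 h4 h5 h6 fx.
  set a1 := normR _; set a2 := normR _; set a3 := normR _; set a4 := normR _.
  set a5 := normR _; set a6 := normR _; set a7 := normR _; set a8 := normR _.
  move=> *; lra.
have hM x : absC (h x) * (v x)%:num <= M.
  rewrite -ler_pdivlMr//; apply/ler_addgt0Pr => e e0.
  have [g [/= gM gx]] := filter_ex (filterI FM (hF x e e0)).
  have := normRB (g x) (g x - h x); rewrite opprB addrC subrK => h1.
  apply: le_trans h1 _; apply: lerD; last exact: ltW.
  by apply: le_trans (CPv_norm_point g x) _; rewrite ler_pM2r// invr_gt0.
have [|f fh] := @CPv_limit h M _ hM.
  move=> K e cK e0; have [g /= gK] := filter_ex (unif K e cK e0).
  by exists g => x Kx; rewrite normRBC ltW// gK.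
exists f; split; first by apply: CPv_norm_le => // x; rewrite fh.
move=> U /tau_co_nbhsP[K [e [cK e0] eU]].
by apply: filterS (unif K e cK e0) => g gK; apply: eU => x Kx; rewrite fh; exact: gK.
Qed.

Lemma CPv_semi_montel : semi_montel_saks nm tau.
Proof.
have sG := @weighted_seminormsP _ _ _ oOmega v P R[i]^o compact.
have dG := compact_directed oOmega v P R[i]^o.
exists (mixed_topology nm Gamma); first exact: CPv_mixed_topology.
apply: (@mixed_semi_montel R X nm Gamma Gamma) => //.
- exact: CPv_norm_seminorm.
- by move=> q; exact: dominated_Gamma sG _.
- by move=> f; exact: compact_norm_sup.
- exact: CPv_ball_compact.
- exact: (CPv_norm_is_norm oOmega v P R[i]^o).2.
Qed.

(** The definition of the submixed topology ranges over all generating systems, so [Gs] is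
    arbitrary. Its seminorms are continuous for [tau_fam], hence dominated by suprema over members
    of [S], which are compact. *)
Lemma CPv_mixed_submixed (S : set (set Omega)) : S set0 ->
  (forall A B, S A -> S B -> S (A `|` B)) -> (forall x, S [set x]) -> S `<=` compact ->
  is_submixed_topology nm (tau_fam oOmega v P R[i]^o S) (mixed_topology nm Gamma).
Proof.
move=> S0 SU S1 Sc; split.
  by exists (@weighted_seminorms R d Omega oOmega v P R[i]^o S); exact: tau_fam_saks_system.
move=> Gs [Gsq dGs _ nm_sup].
have sG := @weighted_seminormsP _ _ _ oOmega v P R[i]^o compact.
have dG := compact_directed oOmega v P R[i]^o.
apply: (@submixed_eq_mixed R X nm Gamma Gs) => //.
- exact: CPv_norm_seminorm.
- by move=> p f; exact: weighted_seminorms_le.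
- move=> q /Gsq[sq cq]; split => // e e0.
  have : nbhs (0 : top_space (tau_fam oOmega v P R[i]^o S)) [set f : X | q f < e].
    have := cq 0 [set z | z < e]; rewrite (seminorm0 sq); apply.
    by apply: open_nbhs_nbhs; split => //; exact: open_lt.
  move=> /(nbhs_seminormP _ _ (weighted_directed oOmega v P R[i]^o S0 SU) (@weighted_seminormsP _ _ _ _ _ _ _ S)).
  move=> [_ [c [[A SA ->] c0] cP]]; exists (weighted_sup A), c.
    by split => //; exists A => //; exact: Sc.
  by move=> f fc; apply: cP; rewrite subr0.
- exact: CPv_ball_compact.
Qed.

End ScalarSolutions.

(** * Weakly smooth functions *)

Section WeakSmoothness.
Context {R : realType} {d : nat} {E : normedModType R[i]} (O : set 'rV[R]_d).
Hypothesis oO : open O.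
Implicit Types (g : 'rV[R]_d -> E) (x y : 'rV[R]_d) (i : 'I_d).
Local Notation absC := (@normR R R[i]^o).

Definition weakly_smooth g := forall e : {linear E -> R[i]^o}, continuous e -> smooth O (e \o g).

(** The increments of [g] at [x] divided by the distance are weakly bounded, since each [e \o g] is
    Lipschitz at [x]; bounded quotients make [g] itself Lipschitz there. At [y = x] the quotient is
    0, as [0^-1 = 0]. *)
Lemma weakly_smooth_continuous g x : weakly_smooth g -> O x -> {for x, continuous g}.
Proof.
move=> wg Ox; have [r r0 rO] := closed_ball_sub oO Ox.
pose A := [set z | exists2 y, `|y - x| <= r & z = (`|y - x|^-1)%:C *: (g y - g x)].
have [|M MP] := @weakly_bounded R E A.
  move=> e ce; have [C C0 CP] := smooth_lipschitz_ball oO (wg e ce) r0 rO.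
  exists C => _ [y yr ->]; rewrite linearZ [e (_ - _)]linearB normR_scale absC_real.
  rewrite ger0_norm ?invr_ge0//.
  have [y0|y0] := eqVneq `|y - x| 0; first by rewrite y0 invr0 mul0r.
  by rewrite mulrC ler_pdivrMr ?lt_neqAle 1?eq_sym ?y0//=; exact: CP.
move=> U /normR_nbhsP[e e0 eU]; apply/rV_nbhsP.
have [c c0 cP] := small_multiple M e0.
exists (Num.min r c); first by rewrite lt_min r0.
move=> y; rewrite lt_min => /andP[yr yc]; apply: eU.
have [y0|y0] := eqVneq `|y - x| 0.
  move/eqP: y0; rewrite normr_eq0 subr_eq0 => /eqP ->.
  by rewrite subrr normR0.
have y_gt0 : 0 < `|y - x| by rewrite lt_neqAle eq_sym y0 normr_ge0.
apply: (@le_lt_trans _ _ (M * `|y - x|)); last by rewrite cP// normr_ge0 ltW.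
have := MP ((`|y - x|^-1)%:C *: (g y - g x)) _; rewrite normR_scale absC_real.
rewrite ger0_norm ?invr_ge0// mulrC ler_pdivrMr//; apply.
by exists y => //; exact: ltW.
Qed.

Lemma weak_diff_quotient (e : {linear E -> R[i]^o}) i g x (h : R) :
  e (diff_quotient i g x h) = diff_quotient i (e \o g) x h.
Proof. by rewrite /diff_quotient linearZ [e (_ - _)]linearB. Qed.

(** The second-order estimate divided by the absolute value of [h], with the second derivative
    bounded on a compact ball. *)
Lemma diff_quotient_rate (f : 'rV[R]_d -> R[i]^o) i x (r : R) : smooth O f ->
  [set y | `|y - x| <= r] `<=` O ->
  exists C : R, forall h, 0 < `|h| <= r -> absC (diff_quotient i f x h - pderiv i f x) <= C * `|h|.
Proof.
move=> sf rO.
have [|M MP] := compact_near_bounded (f := fun y => absC (pderiv i (pderiv i f) y))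
    (@rV_closed_ball_compact R d x r).
  move=> y /rO Oy; have cf := (sf [:: i; i] y Oy).1.
  exact: (cvg_comp _ _ cf (@normR_continuous R R[i]^o _)).
exists (4%:R * M) => h /andP[h0 hr].
have := @pderiv_second_order R d i f x h M.
have H : forall t : R, `|t| <= `|h| ->
 pderivable i f (x + t *: (delta_mx 0 i : 'rV[R]_d)) /\
 pderivable i (pderiv i f) (x + t *: (delta_mx 0 i : 'rV[R]_d)) /\
 absC (pderiv i (pderiv i f) (x + t *: (delta_mx 0 i : 'rV[R]_d))) <= M.
  move=> t th; have xt : `|x + t *: (delta_mx 0 i : 'rV[R]_d) - x| <= r.
    by rewrite addrC addKr (le_trans (rV_line_norm i t))// (le_trans th).
  have Oxt := rO _ xt; split; first exact: ((sf [::] _ Oxt).2 i).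
  by split; [exact: ((sf [:: i] _ Oxt).2 i)|exact: MP].
move=> /(_ H) {H}; have h_neq0 : h != 0 by rewrite -normr_gt0.
have -> : f (x + h *: (delta_mx 0 i : 'rV[R]_d)) - f x - h%:C * pderiv i f x =
    h%:C * (diff_quotient i f x h - pderiv i f x).
  rewrite mulrBr /diff_quotient; congr (_ - _).
  rewrite /GRing.scale /= mulrA -rmorphM /= divff// mul1r.
  by [].
have -> : h ^+ 2 = `|h| * `|h| by rewrite -normrM -expr2 ger0_norm ?sqr_ge0.
by rewrite absCM absC_real mulrA [X in X <= _ -> _]mulrC ler_pM2r.
Qed.

(* The quotients (phi h - phi k) / (|h| + |k|) of difference quotients are weakly bounded, hence bounded. *)
Lemma weakly_smooth_pderivable g x i : banach E -> weakly_smooth g -> O x -> pderivable i g x.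
Proof.
move=> bE wg Ox; have [r r0 rO] := closed_ball_sub oO Ox.
pose phi h := diff_quotient i g x h.
pose A := [set z | exists h, exists2 k, 0 < `|h| <= r /\ 0 < `|k| <= r &
  z = ((`|h| + `|k|)^-1)%:C *: (phi h - phi k)].
have [|M MP] := @weakly_bounded R E A.
  move=> e ce; have [C CP] := diff_quotient_rate i (wg e ce) rO.
  exists C => _ [h [k [hr kr] ->]]; rewrite linearZ [e (_ - _)]linearB normR_scale absC_real.
  have hk : 0 < `|h| + `|k| by case/andP: hr => h0 _; rewrite ltr_pwDl.
  have hk' : 0 <= (`|h| + `|k|)^-1 by rewrite invr_ge0 ltW.
  rewrite (ger0_norm hk') mulrC ler_pdivrMr// mulrDr.
  rewrite !weak_diff_quotient.
  apply: le_trans (normR_distD (pderiv i (e \o g) x) _ _) _.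
  by apply: lerD; [exact: CP|rewrite normRBC; exact: CP].
have phiD h k : 0 < `|h| <= r -> 0 < `|k| <= r ->
    normR (phi h - phi k) <= `|M| * (`|h| + `|k|).
  move=> hr kr; have hk : 0 < `|h| + `|k| by case/andP: hr => h0 _; rewrite ltr_pwDl.
  have := MP (((`|h| + `|k|)^-1)%:C *: (phi h - phi k)) _.
  have hk' : 0 <= (`|h| + `|k|)^-1 by rewrite invr_ge0 ltW.
  rewrite normR_scale absC_real (ger0_norm hk') mulrC ler_pdivrMr// => H.
  apply: (@le_trans _ _ (M * (`|h| + `|k|))); first by apply: H; exists h, k.
  by rewrite ler_pM2r// ler_norm.
(* A decreasing null sequence of admissible increments: for [n <= m] the bound [|M| (t m + t n)] is
   at most [2 |M| t n], a rate for [banach_cvg_seq]. *)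
pose t n : R := r * n.+1%:R^-1.
have t0 n : 0 < t n by rewrite mulr_gt0// invr_gt0.
have tr n : 0 < `|t n| <= r.
  rewrite (gtr0_norm (t0 n)) (t0 n) /= /t; apply: ler_piMr; first exact: ltW.
  by rewrite invf_le1 ?ler1n// ltr0n.
have t_cvg c : (fun n => c * t n) @ \oo --> (0 : R).
  have -> : (fun n => c * t n) = (fun=> c * r) \* harmonic.
    by apply/funext => n; rewrite /t mulrA.
  by have := cvgM (@cvg_cst _ (c * r) _ \oo _) (@cvg_harmonic R); rewrite mulr0; apply.
have [| |l [_ lP]] := @banach_cvg_seq R E (fun n => phi (t n)) (fun n => (2 * `|M|) * t n) bE.
- exact: t_cvg.
- move=> n m nm; apply: le_trans (phiD _ _ (tr m) (tr n)) _.
  rewrite (gtr0_norm (t0 m)) (gtr0_norm (t0 n)) [2 * _]mulrC -mulrA ler_wpM2l//.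
  have : t m <= t n by rewrite /t ler_pM2l// lef_pV2 ?posrE ?ltr0n// ler_nat.
  by move=> ?; lra.
have phil h : 0 < `|h| <= r -> normR (phi h - l) <= `|M| * `|h|.
  move=> hr; apply/ler_addgt0Pr => e e0.
  (* The factor 3 collects one [|M| * t n] from comparing [phi h] with [phi (t n)] and two from
     comparing [phi (t n)] with the limit. *)
  have /(cvgrPdist_lt _ _) /(_ e e0) [n _ /(_ n (leqnn n))] := t_cvg (3%:R * `|M|).
  rewrite /= sub0r normrN ger0_norm; last by rewrite !mulr_ge0// ltW.
  move=> te; apply: le_trans (normR_distD (phi (t n)) _ _) _.
  have := phiD _ _ hr (tr n); have := lP n; rewrite (normRBC l) (gtr0_norm (t0 n)).
  move: te; set a := normR _; set b := normR _; set c := `|M|; set u := `|h|; set w := t n.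
  move=> *; nra.
apply/cvg_ex; exists l => U /normR_nbhsP[e e0 eU].
have [c c0 cP] := small_multiple `|M| e0.
exists (Num.min r c) => /=; first by rewrite lt_min r0.
move=> h; rewrite /= sub0r normrN lt_min => /andP[hr hc] h0; apply: eU.
apply: le_lt_trans (phil h _) _; first by rewrite normr_gt0 h0 ltW.
by rewrite cP// normr_ge0 ltW.
Qed.

(** Weak smoothness passes to partial derivatives because these commute with continuous functionals,
    so [smooth_class] applies. *)
Lemma weakly_smooth_smooth g : banach E -> weakly_smooth g -> smooth O g.
Proof.
move=> bE; apply: (smooth_class oO) => [f wf x Ox|f i wf].
  split; first exact: weakly_smooth_continuous.
  by move=> i; exact: weakly_smooth_pderivable.
exists (pderiv i f); last by move=> x _; reflexivity.
move=> e ce.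
apply: smooth_local oO _ (smooth_pderivs [:: i] (wf e ce)) => x Ox /=.
have df : pderivable i f x by exact: weakly_smooth_pderivable.
exact: (pderiv_unique (pderiv_comp_linear ce df)).2.
Qed.

End WeakSmoothness.

(** * Solutions and weak solutions *)

Section WeakSolutions.
Context {R : realType} {d : nat} {Omega : set 'rV[R]_d} (oOmega : open Omega).
Context (v : Omega -> {posnum R}) (P : mpoly.mpoly d R[i]) {E : normedModType R[i]}.
Implicit Types (e : {linear E -> R[i]^o}) (f : Omega -> E).

Lemma ext0_comp_linear e f : ext0 (fun x => e (f x) : R[i]^o) = e \o ext0 f.
Proof.
apply/funext => z; have [Oz|Oz] := pselect (Omega z).
  by rewrite /= !(ext0_in _ Oz).
by rewrite /= !ext0_out// linear0.
Qed.

Lemma diff_op_comp_linear e (g : 'rV[R]_d -> E) x : continuous e -> smooth Omega g -> Omega x ->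
  diff_op P (e \o g) x = e (diff_op P g x).
Proof.
move=> ce sg Ox; rewrite /diff_op linear_sum; apply: eq_bigr => b _.
by rewrite linearZ /pderivm (pderivs_comp_linear ce _ oOmega sg Ox).
Qed.

Lemma CPv_comp_linear e f : continuous e -> CPv v P E f -> CPv v P R[i]^o (fun x => e (f x)).
Proof.
move=> ce [sf Pf [M MP]]; rewrite /CPv /= ext0_comp_linear; split.
- exact: smooth_comp_linear.
- by move=> x Ox; rewrite diff_op_comp_linear// Pf// linear0.
- have [C [C0 CP]] := linear_bounded ce; exists (C * M) => x.
  apply: (@le_trans _ _ (C * (normR (f x) * (v x)%:num))); last by rewrite ler_pM2l.
  by rewrite mulrA ler_pM2r.
Qed.

(** The equation holds because functionals separate points, and the growth bound is weak boundedness
    of the set of all values [f x] multiplied by the weight. *)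
Lemma CPv_sigma_sub : banach E -> CPv_sigma v P E `<=` CPv v P E.
Proof.
move=> bE f wf.
have sf : smooth Omega (ext0 f).
  apply: weakly_smooth_smooth => // e ce; rewrite -ext0_comp_linear.
  by have [] := wf e ce.
split=> //.
  move=> x Ox; apply: functional_eq0 => e ce; rewrite -diff_op_comp_linear//.
  by rewrite -ext0_comp_linear; have [_ ->] := wf e ce.
have [|M MP] := @weakly_bounded R E [set z | exists x, z = ((v x)%:num)%:C *: f x].
  move=> e ce; have [_ _ [M MP]] := wf e ce; exists M => _ [x ->].
  by rewrite linearZ normR_scale absC_real gtr0_norm// mulrC.
exists M => x; have := MP _ (ex_intro _ x erefl).
by rewrite normR_scale absC_real gtr0_norm// mulrC.
Qed.

Lemma CPv_sigmaE : banach E -> CPv v P E = CPv_sigma v P E.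
Proof.
move=> bE; apply/seteqP; split; last exact: CPv_sigma_sub.
by move=> f cf e ce; exact: CPv_comp_linear.
Qed.

End WeakSolutions.

(** * Completeness for values in a Banach space *)

Section Completeness.
Context {R : realType} {d : nat} {Omega : set 'rV[R]_d} (oOmega : open Omega).
Context (v : Omega -> {posnum R}) (v_cont : continuous (fun x => (v x)%:num)).
Context (P : mpoly.mpoly d R[i]) (hP : hypoelliptic P) {E : normedModType R[i]}.
Local Notation X := (CPv_space oOmega v P E).
Local Notation nm := (CPv_norm oOmega v P E).
Local Notation Gamma := (@weighted_seminorms R d Omega oOmega v P E compact).
Local Notation mixed := (mixed_topology nm Gamma).

Let sG := @weighted_seminormsP R d Omega oOmega v P E compact.
Let dG := compact_directed oOmega v P E.

Section CauchyFilter.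
Variable F : set_system X.
Hypothesis PF : ProperFilter F.
Hypothesis F_cauchy : forall U : set (top_space mixed), nbhs (0 : top_space mixed) U ->
  exists2 A, F A & forall f g, A f -> A g -> U (f - g).

Lemma mixed_cauchy_uniform K (e : R) : compact K -> 0 < e ->
  exists2 A : set X, F A & forall f g x, A f -> A g -> K x -> normR (f x - g x) < e.
Proof.
move=> cK e0; have [|A FA AP] := F_cauchy (U := [set h : X | forall x, K x -> normR (h x) < e]).
  have : nbhs (0 : top_space (tau_co oOmega v P E)) [set h : X | forall x, K x -> normR (h x) < e].
    apply/tau_co_nbhsP; exists K, e => // g gK x Kx.
    by have := gK x Kx; rewrite subr0.
  rewrite (tau_coE oOmega P E v_cont) !nbhsE => -[B [oB B0] BU]; exists B => //; split => //.
  exact: (tau_sub_mixed nm sG dG).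
by exists A => // f g x Af Ag Kx; rewrite -CPv_spaceB; exact: AP.
Qed.

Lemma mixed_cauchy_pointwise : banach E -> exists h : Omega -> E,
  forall K (e : R), compact K -> 0 < e -> F [set f : X | forall x, K x -> normR (f x - h x) <= e].
Proof.
move=> bE.
have lim_ex x : exists l : E, forall e : R, 0 < e -> F [set f : X | normR (f x - l) < e].
  have : cvg ((fun f : X => f x) @ F).
    apply: bE; apply: cauchy_exP => _ /posC_real[e e0 ->].
    have [A FA AP] := mixed_cauchy_uniform (@compact_set1 _ x) e0.
    have [f Af] := filter_ex FA; exists (f x).
    suff : F [set g : X | ball (f x) e%:C (g x)] by [].
    apply: filterS FA => g Ag; rewrite /= -ball_normE /= normRC ltcR.
    exact: AP.
  move=> /cvg_ex[l Fl]; exists l => e e0.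
  have : nbhs l [set z | normR (z - l) < e] by apply/normR_nbhsP; exists e.
  by move=> /Fl.
have [h hF] := choice lim_ex; exists h => K e cK e0.
have [A FA AP] := mixed_cauchy_uniform cK e0.
apply: (filterS _ (FA)) => f Af x Kx; apply/ler_addgt0Pr => c c0.
have [g [Ag gx]] := filter_ex (filterI FA (hF x c c0)).
apply: le_trans (normR_distD (g x) _ _) _; apply: lerD; last exact: ltW.
by apply/ltW/AP.
Qed.

(** If the weighted values of [h] were above [(n + 1)^2] at points [x n], the seminorm [Q] with
    weights [1 / (n + 1)] at these points would be mixed-continuous, and a set of [F] with [Q]-small
    differences could not approximate [h] at all of them. *)
Lemma mixed_cauchy_bounded (h : Omega -> E) :
  (forall x (e : R), 0 < e -> F [set f : X | normR (f x - h x) <= e]) ->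
  exists M : R, forall x, normR (h x) * (v x)%:num <= M.
Proof.
move=> hF; apply: contrapT => unb.
have large n : exists x, n.+1%:R ^+ 2 < normR (h x) * (v x)%:num.
  apply: contrapT => nx; apply: unb; exists (n.+1%:R ^+ 2) => x.
  by rewrite leNgt; apply/negP => xn; apply: nx; exists x.
have [x xP] := choice large.
pose q n := @weighted_sup R d Omega oOmega v P E [set x n].
pose a n : R := n.+1%:R^-1.
pose Q f := sup (range (fun n => q n f * a n)).
have Gq n : Gamma (q n) by exists [set x n] => //; exact: compact_set1.
have a_ge0 n : 0 <= a n by rewrite invr_ge0.
have Gdom p : Gamma p -> dominated Gamma p by exact: dominated_Gamma sG _.
have nm_sup := @compact_norm_sup R d Omega oOmega v P E.
have mQ : mixed_seminorms nm Gamma Q.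
  exact: (submixed_mixed sG dG Gdom nm_sup Gq a_ge0 (@cvg_harmonic R)).
have [|A FA AP] := F_cauchy (U := [set f | Q f < 1]).
  apply/(nbhs_mixedP nm sG dG); exists Q, 1; first by split.
  by move=> f; rewrite subr0.
have [g Ag] := filter_ex FA.
(* With [g] fixed, every [f] in [A] has weighted value below [nm g + N + 1] at [x N]; one that is
   within weighted distance 1 of [h] there contradicts [(N + 1)^2] once [N] exceeds [nm g + 2]. *)
have [N NP] : exists N : nat, nm g + 2 < N%:R.
  have := @nbhs_infty_gtr R (nm g + 2) => -[N _ NP]; exists N; exact: (NP N (leqnn N)).
have vN : 0 < ((v (x N))%:num)^-1 by rewrite invr_gt0.
have [f [Af fx]] := filter_ex (filterI FA (hF (x N) ((v (x N))%:num)^-1 vN)).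
have Qfg : q N (f - g) < N.+1%:R.
  have h1 : q N (f - g) * a N <= Q (f - g).
    exact: (@submixed_ge _ _ nm Gamma Gamma Gdom nm_sup q a Gq a_ge0 (@cvg_harmonic R)).
  have := le_lt_trans h1 (AP f g Af Ag).
  by rewrite ltr_pdivrMr// mul1r.
have h1 : normR (f (x N) - g (x N)) * (v (x N))%:num < N.+1%:R.
  by apply: le_lt_trans Qfg; rewrite -CPv_spaceB; exact: weighted_ge.
have h2 := CPv_norm_ge g (x N).
have h3 : normR (h (x N)) * (v (x N))%:num <=
    (normR (f (x N) - h (x N)) + normR (f (x N) - g (x N)) + normR (g (x N))) * (v (x N))%:num.
  rewrite ler_pM2r//; have := normR_distD (f (x N)) (h (x N)) 0.
  have := normR_distD (g (x N)) (f (x N)) 0; rewrite !subr0 (normRBC (h _)).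
  move: (normR _) (normR (f _)) (normR (f _ - _)) (normR (h _)) (normR (g _)) => a1 a2 a3 a4 a5.
  by move=> *; lra.
have h4 : normR (f (x N) - h (x N)) * (v (x N))%:num <= 1 by rewrite -ler_pdivlMr// mul1r.
have := xP N; have Nge : 0 <= nm g by exact: weighted_ge0.
move: h1 h2 h3 h4; rewrite !mulrDl -natr1.
move: (N%:R : R) (_ * _) (_ * _) (_ * _) (_ * _) (nm g) Nge NP => n b1 b2 b3 b4 c c0 nP *.
nra.
Qed.

End CauchyFilter.

Lemma CPv_complete : banach E -> complete_saks nm (tau_co oOmega v P E).
Proof.
move=> bE; exists mixed; first exact: CPv_mixed_topology.
move=> F PF F_cauchy.
have [h hF] := mixed_cauchy_pointwise PF F_cauchy bE.
have [M MP] : exists M : R, forall x, normR (h x) * (v x)%:num <= M.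
  apply: (mixed_cauchy_bounded PF F_cauchy) => x e e0.
  by apply: filterS (hF [set x] e (@compact_set1 _ x) e0) => f; apply.
have hC : h \in CPv_pred v P (E := E).
  (* Hypoellipticity concerns scalar distributions, so [h] is shown to be a weak solution: each
     [e \o h] is a limit of scalar solutions, uniform on compact sets. *)
  rewrite inE; apply: CPv_sigma_sub => // e ce.
  have [C [C0 CP]] := linear_bounded ce.
  have [|x|k <-] := @CPv_limit R d Omega oOmega v P hP (fun x => e (h x)) (C * M).
  - move=> K r cK r0.
    have [f /= fK] := filter_ex (hF K (r / C) cK (divr_gt0 r0 C0)).
    have eC : (fun x => e (f x) : R[i]^o) \in CPv_pred v P (E := R[i]^o).
      by rewrite inE; apply: CPv_comp_linear => //; exact: CPv_spaceP.
    exists (CPvSpace oOmega eC) => x Kx /=; rewrite -linearB; apply: le_trans (CP _) _.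
    by rewrite mulrC -ler_pdivlMr// normRBC fK.
  - apply: (@le_trans _ _ (C * (normR (h x) * (v x)%:num))); last by rewrite ler_pM2l.
    by rewrite mulrA ler_pM2r.
  exact: CPv_spaceP.
pose f : X := CPvSpace oOmega hC; exists f.
apply: (mixed_cauchy_cvg (CPv_norm_seminorm oOmega v P E) sG dG) => //.
rewrite -(tau_coE oOmega P E v_cont) => U /tau_co_nbhsP[K [e [cK e0] eU]].
have e2 : 0 < e / 2 by rewrite divr_gt0.
apply: filterS (hF K (e / 2) cK e2) => g gK; apply: eU => x Kx.
apply: le_lt_trans (gK x Kx) _.
exact: half_ltr.
Qed.

End Completeness.

Theorem corollary4p8 (R : realType) (d : nat) (d_gt0 : (0 < d)%N)
    (Omega : set 'rV[R]_d) (Omega_neq0 : Omega !=set0) (oOmega : open Omega)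
    (v : Omega -> {posnum R}) (v_cont : continuous (fun x => (v x)%:num))
    (E : normedModType R[i]) (P : mpoly.mpoly d R[i]) (hP : hypoelliptic P) :
  (saks_space (CPv_norm oOmega v P E) (tau_co oOmega v P E) /\
   C_sequential_saks (CPv_norm oOmega v P E) (tau_co oOmega v P E)) /\
  (semi_montel_saks (CPv_norm oOmega v P R[i]^o)
     (tau_co oOmega v P R[i]^o) /\
   forall S : set (set Omega), S = finite_set \/ S = compact ->
     exists2 gamma,
       is_mixed_topology (CPv_norm oOmega v P R[i]^o)
         (tau_co oOmega v P R[i]^o) gamma &
       is_submixed_topology (CPv_norm oOmega v P R[i]^o)
         (tau_fam oOmega v P R[i]^o S) gamma) /\
  (banach E ->
   CPv v P E = CPv_sigma v P E /\
   complete_saks (CPv_norm oOmega v P E) (tau_co oOmega v P E)).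
Proof.
split; first by split; [exact: CPv_saks_space|exact: CPv_C_sequential].
split; last by move=> bE; split; [exact: CPv_sigmaE|exact: CPv_complete].
split=> [|S Sfc]; first exact: CPv_semi_montel.
eexists; first exact: CPv_mixed_topology.
apply: CPv_mixed_submixed => //.
- by case: Sfc => ->; [exact: finite_set0|exact: compact0].
- move=> A B; case: Sfc => ->; last exact: compactU.
  by move=> fA fB; rewrite finite_setU.
- by move=> x; case: Sfc => ->; [exact: finite_set1|exact: compact_set1].
- by move=> A; case: Sfc => -> //; exact: finite_compact.
Qed.
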